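(* Let $W:\mathbb{R}\to\mathbb{R}$ be $C^3$ and strictly convex (with $W''>0$), let $T>0$, and let $u\in C^3([0,1]\times[0,T])$ solve $$\frac{u_t}{\sqrt{1+u_x^2}}=W''(u_x)\,u_{xx}\quad (0\le x\le 1),\qquad u(x,0)=u_0(x),\qquad u(0,t)=u(1,t)=0 .$$ Then there exist $m_0>0$, functions $\Lambda,\Gamma:[0,T]\to[0,\infty)$ and a constant $C_T$, all independent of $m$ and of the discretization below (they may depend on $u$, $W$ and $T$), such that the following holds for every $0<m\le m_0$. Let $u^m$ be the crystalline evolution with homogeneous Dirichlet boundary conditions (defined in the context) with slope set $S$ and compatible initial datum $u_0^m$, where $$\|(u_0^m)_x-(u_0)_x\|_{L^\infty([0,1])}\le m$$ and any two consecutive faces of $u_0^m$ have slopes differing by at most $m$ in absolute value: $$\bigl|[(u_0^m)_x]_i-[(u_0^m)_x]_{i-1}\bigr|\le m\quad\text{for all } i .$$ Then $$\Upsilon(t):=\tfrac12\int_0^1|u_x(x,t)-u^m_x(x,t)|^2\,dx$$ satisfies $$\frac{d\Upsilon}{dt}\le \Lambda(t)\,\Upsilon+\Gamma(t)\,m$$ on $[0,T]$ (away from the finitely many times at which faces of $u^m$ disappear; $\Upsilon$ is continuous and piecewise $C^1$ in $t$). In particular, $$\sup_{0\le t\le T}\|u(\cdot,t)-u^m(\cdot,t)\|_{H^1([0,1])}\le C_T\,m^{1/2}.$$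
   Context: Slope set. $S\subset\mathbb{R}$ is a locally finite set of ''admissible slopes'' (the corners of a continuous piecewise linear function $\bar W$ that coincides with $W$ at the points of $S$). Two elements of $S$ are adjacent if they are distinct and no element of $S$ lies strictly between them. Admissible functions. An admissible function is a continuous piecewise linear function on $[0,1]$, made of finitely many linear pieces (''faces''), each with slope in $S$. Its corners have abscissas $0=x_0<x_1<\dots<x_N=1$; face $i$ lies over $(x_{i-1},x_i)$, has projected length $l_i=x_i-x_{i-1}$ and slope $p_i=(u^m_x)_i\in S$. Compatible initial datum. $u_0^m$ is admissible, $u_0^m(0)=u_0^m(1)=0$, and the slopes of any two consecutive faces of $u_0^m$ are adjacent elements of $S$. Crystalline evolution, homogeneous Dirichlet conditions. $u^m(\cdot,t)$ is a family of admissible functions, continuous in $t$, with $u^m(\cdot,0)=u_0^m$. Each face keeps its slope $p_i$ and moves with vertical velocity $v_i=(u^m_t)_i$, where $v_1=v_N=0$ and, for $2\le i\le N-1$, $$v_i=\sqrt{1+p_i^2}\;\frac{\Delta_i}{l_i},\qquad \Delta_i=\frac{W(p_{i+1})-W(p_i)}{p_{i+1}-p_i}-\frac{W(p_i)-W(p_{i-1})}{p_i-p_{i-1}} .$$ Since $u^m$ stays continuous, the corners move by $$\dot x_i=-\frac{v_{i+1}-v_i}{p_{i+1}-p_i}\ (1\le i\le N-1),\qquad x_0=0,\ x_N=1,$$ which is a system of ODEs for the lengths: $\dot l_1=\dot x_1$, $\dot l_N=-\dot x_{N-1}$ and $\dot l_i=\dot x_i-\dot x_{i-1}$ otherwise.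 When one or more lengths reach zero, the corresponding faces are removed, consecutive remaining faces of equal slope are merged into one face, the faces are renumbered from left to right ($N$ is the current number of faces, and the current first and last faces have zero velocity), and the evolution continues by the same rules. No new faces are ever created. *)

(* Defs.v *)
From Stdlib Require Import Reals List Arith.
From Coquelicot Require Import Coquelicot.
Import ListNotations.
Open Scope R_scope.

Definition Icc (a b x : R) : Prop := a <= x <= b.

Definition rect (T : R) (z : R * R) : Prop := Icc 0 1 (fst z) /\ Icc 0 T (snd z).

(** Partial derivatives on [0,1] x [0,T], one-sided on the boundary; they
    determine [ux] and [ut] uniquely on the rectangle (when [0 < T]). *)
Definition partial_x (T : R) (u ux : R -> R -> R) : Prop :=
  forall x t, Icc 0 1 x -> Icc 0 T t ->
    D_in (fun y => u y t) (fun y => ux y t) (Icc 0 1) x.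

Definition partial_t (T : R) (u ut : R -> R -> R) : Prop :=
  forall x t, Icc 0 1 x -> Icc 0 T t ->
    D_in (fun s => u x s) (fun s => ut x s) (Icc 0 T) t.

(** [u] is of class C^n on the closed rectangle: all partial derivatives of
    order at most [n] exist and are jointly continuous up to the boundary. *)
Fixpoint Cn_rect (T : R) (n : nat) (u : R -> R -> R) : Prop :=
  continuous_on (rect T) (fun z => u (fst z) (snd z)) /\
  match n with
  | O => True
  | S n' => exists ux ut : R -> R -> R,
      partial_x T u ux /\ partial_t T u ut /\ Cn_rect T n' ux /\ Cn_rect T n' ut
  end.

(** All orders [k <= n] are listed because [Derive_n] is total: for a single
    [k], [ex_derive_n W k] does not by itself give the lower derivatives. *)
Definition Cn (n : nat) (W : R -> R) : Prop :=
  (forall k x, (k <= n)%nat -> ex_derive_n W k x) /\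
  (forall x, continuous (Derive_n W n) x).

Definition strictly_convex (W : R -> R) : Prop :=
  forall x y a, x <> y -> 0 < a < 1 ->
    W (a * x + (1 - a) * y) < a * W x + (1 - a) * W y.

(** Lebesgue-null subsets of the line, by countable covers of small length. *)
Definition null_set (A : R -> Prop) : Prop :=
  forall eps, 0 < eps -> exists a b : nat -> R,
    (forall n, a n <= b n) /\
    (forall x, A x -> exists n, a n < x < b n) /\
    (forall n, sum_f_R0 (fun k => b k - a k) n <= eps).

Definition Linf_norm (f : R -> R) : Rbar :=
  Glb_Rbar (fun M => 0 <= M /\ null_set (fun x => Icc 0 1 x /\ M < Rabs (f x))).

(** For a Lipschitz, piecewise C^1 function, [Derive f] is the weak derivative
    off finitely many points, and these do not affect [RInt]. *)
Definition H1_norm (f : R -> R) : R :=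
  sqrt (RInt (fun x => f x ^ 2) 0 1 + RInt (fun x => Derive f x ^ 2) 0 1).

(** Only the values on the slope set of the piecewise linear interpolant of [W]
    ever matter, and there it agrees with [W]; it is therefore not introduced. *)
Definition locally_finite (Sl : R -> Prop) : Prop :=
  forall a b, exists l : list R, forall s, Sl s -> Icc a b s -> In s l.

Definition adjacent (Sl : R -> Prop) (a b : R) : Prop :=
  Sl a /\ Sl b /\ a <> b /\
  forall s, Sl s -> ~ (Rmin a b < s < Rmax a b).

(** Faces are numbered from [1] to [N]; face [i] has slope [p i] and lies over
    [[x (i - 1), x i]], where [x 0], ..., [x N] are the corner abscissas. *)
Definition is_face (N i : nat) : Prop := (1 <= i <= N)%nat.

Definition len (x : nat -> R) (i : nat) : R := x i - x (i - 1)%nat.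

(** Faces of zero length are allowed here. *)
Definition linear_on_faces (f : R -> R) (N : nat) (p x : nat -> R) : Prop :=
  x 0%nat = 0 /\ x N = 1 /\
  forall i, is_face N i ->
    x (i - 1)%nat <= x i /\
    forall y, Icc (x (i - 1)%nat) (x i) y ->
      f y = f (x (i - 1)%nat) + p i * (y - x (i - 1)%nat).

Definition admissible (Sl : R -> Prop) (f : R -> R) (N : nat) (p x : nat -> R)
  : Prop :=
  linear_on_faces f N p x /\
  forall i, is_face N i -> Sl (p i) /\ 0 < len x i.

Definition compatible (Sl : R -> Prop) (f : R -> R) (N : nat) (p x : nat -> R)
  : Prop :=
  admissible Sl f N p x /\ f 0 = 0 /\ f 1 = 0 /\
  forall i, (2 <= i <= N)%nat -> adjacent Sl (p (i - 1)%nat) (p i).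

Definition Delta (W : R -> R) (p : nat -> R) (i : nat) : R :=
  (W (p (i + 1)%nat) - W (p i)) / (p (i + 1)%nat - p i) -
  (W (p i) - W (p (i - 1)%nat)) / (p i - p (i - 1)%nat).

Definition velocity (W : R -> R) (N : nat) (p x : nat -> R) (i : nat) : R :=
  if orb (Nat.eqb i 1) (Nat.eqb i N) then 0
  else sqrt (1 + p i ^ 2) * (Delta W p i / len x i).

(** A list of faces is encoded, from left to right, by pairs (length, slope). *)
Definition face_list (N : nat) (p x : nat -> R) : list (R * R) :=
  map (fun i => (len x i, p i)) (seq 1 N).

Definition remove_vanished (l : list (R * R)) : list (R * R) :=
  filter (fun f => if Rlt_dec 0 (fst f) then true else false) l.

Fixpoint merge_equal (l : list (R * R)) : list (R * R) :=
  match l with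
  | [] => []
  | (l1, p1) :: q =>
      match merge_equal q with
      | [] => [(l1, p1)]
      | (l2, p2) :: r =>
          if Req_dec_T p1 p2 then (l1 + l2, p1) :: r
          else (l1, p1) :: (l2, p2) :: r
      end
  end.

(** The evolution on [0,T] is a succession of [K] stages, stage [k] occupying
    [[tau k, tau (k + 1)]] with a fixed list of faces.  At the end of a stage
    some lengths are zero (for the last stage, which ends at [T], perhaps none);
    the corners at that time are the limits of the moving ones. *)
Record stage := Stage {
  nfaces : nat;
  slope : nat -> R;
  corner : nat -> R -> R   (* face number, time *)
}.

Definition corners_at (s : stage) (t : R) : nat -> R := fun i => corner s i t.

Definition length_at (s : stage) (t : R) (i : nat) : R := len (corners_at s t) i.

Definition velocity_at (W : R -> R) (s : stage) (t : R) (i : nat) : R :=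
  velocity W (nfaces s) (slope s) (corners_at s t) i.

Definition faces_at (s : stage) (t : R) : list (R * R) :=
  face_list (nfaces s) (slope s) (corners_at s t).

(** [um] is the crystalline evolution with initial datum [um0].  Continuity of
    [um] in time is carried by [ce_corners_cont] and [ce_boundary], since both
    of two successive stages describe [um] at their common time. *)
Record crystalline_evolution (W : R -> R) (Sl : R -> Prop) (T : R)
    (um0 : R -> R) (um : R -> R -> R)
    (K : nat) (tau : nat -> R) (st : nat -> stage) : Prop := {
  ce_stages : (1 <= K)%nat /\ tau 0%nat = 0 /\ tau K = T /\
    forall k, (k < K)%nat -> tau k < tau (k + 1)%nat;
  ce_initial : forall y, Icc 0 1 y -> um y 0 = um0 y;
  ce_boundary : forall t, Icc 0 T t -> um 0 t = 0 /\ um 1 t = 0;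
  ce_admissible : forall k t, (k < K)%nat -> tau k <= t < tau (k + 1)%nat ->
    admissible Sl (fun y => um y t)
      (nfaces (st k)) (slope (st k)) (corners_at (st k) t);
  ce_stage_end : forall k, (k < K)%nat ->
    linear_on_faces (fun y => um y (tau (k + 1)%nat))
      (nfaces (st k)) (slope (st k)) (corners_at (st k) (tau (k + 1)%nat));
  ce_corners_cont : forall k i, (k < K)%nat -> (i <= nfaces (st k))%nat ->
    continuous_on (Icc (tau k) (tau (k + 1)%nat)) (corner (st k) i);
  ce_face_velocity : forall k t i y, (k < K)%nat ->
    tau k < t < tau (k + 1)%nat -> is_face (nfaces (st k)) i ->
    corner (st k) (i - 1)%nat t < y < corner (st k) i t ->
    is_derive (fun s => um y s) t (velocity_at W (st k) t i);
  ce_corner_velocity : forall k t i, (k < K)%nat ->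
    tau k < t < tau (k + 1)%nat -> (1 <= i < nfaces (st k))%nat ->
    is_derive (corner (st k) i) t
      (- ((velocity_at W (st k) t (i + 1)%nat - velocity_at W (st k) t i)
          / (slope (st k) (i + 1)%nat - slope (st k) i)));
  ce_vanish : forall k, (k + 1 < K)%nat -> exists i,
    is_face (nfaces (st k)) i /\ length_at (st k) (tau (k + 1)%nat) i = 0;
  ce_update : forall k, (k + 1 < K)%nat ->
    faces_at (st (k + 1)%nat) (tau (k + 1)%nat) =
    merge_equal (remove_vanished (faces_at (st k) (tau (k + 1)%nat)))
}.

Definition disappearance_time (K : nat) (tau : nat -> R) (st : nat -> stage)
    (t : R) : Prop :=
  exists k i, (k < K)%nat /\ is_face (nfaces (st k)) i /\
    t = tau (k + 1)%nat /\ length_at (st k) t i = 0.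

(** [Derive (fun y => um y t)] has arbitrary values at the corners, which the
    integral ignores. *)
Definition Upsilon (ux um : R -> R -> R) (t : R) : R :=
  / 2 * RInt (fun x => (ux x t - Derive (fun y => um y t) x) ^ 2) 0 1.

(* Main.v *)
Require Import Defs.
From Stdlib Require Import Reals Lra Lia List Arith Sorted Classical.
From Coquelicot Require Import Coquelicot.
Import ListNotations.
Open Scope R_scope.

(** The proof is an energy estimate for [Upsilon], closed by Gronwall's
    inequality.

    During a stage, expanding the square gives
    [Upsilon = 1/2 int u_x^2 - sum p_i (u(x_i) - u(x_(i-1))) + 1/2 sum p_i^2 l_i],
    which involves the moving corners only through values of [u]
    ([slope_distance_expand]).  Differentiating, integrating by parts with the
    boundary conditions, inserting the law of motion of the corners and
    summing by parts ([face_terms_sum]) writes the derivative as a sum over the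
    faces.  With [kappa = (p_(i+1) - p_(i-1)) / (2 l_i)], a discrete [u_xx], the
    contribution of face [i] is the integral over it of
    [- (u_xx - kappa) (u_t - v_i)], up to [O(m l_i)] because consecutive slopes
    differ by at most [m] and [u_t] is Lipschitz in space.  Now
    [u_t = beta(u_x) u_xx] with [beta = sqrt (1 + p^2) W''], while adjacency of
    consecutive slopes yields [v_i = beta_i kappa] with
    [beta_i = beta(p_i) + O(m)] ([secant_jump]); hence the integrand equals
    [- beta_i (u_xx - kappa)^2 - (beta(u_x) - beta_i) u_xx (u_xx - kappa)], and
    completing the square bounds it by [C (|u_x - p_i|^2 + m^2)]
    ([dissipation_bound], [face_pointwise]).  The first and the last face do not
    move, and there [u_t] is small because it vanishes at the end points.

    The estimate needs consecutive slopes to stay adjacent and [m]-close after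
    faces have disappeared.  This holds because a face that vanishes between
    two persistent ones has neighbours of equal slope ([vanishing_face_flat]),
    so that removal and merging create no new pair of consecutive slopes, up
    to order ([linked_update]); at the two ends of the interval faces are merely dropped.

    Initially [Upsilon <= m^2 / 2], the essential bound on the difference of
    slopes being a pointwise one inside each face ([Linf_norm_pointwise]), so
    [Upsilon = O(m)] on the whole time interval, and a Poincare inequality
    ([H1_norm_bound]) bounds the H^1 norm by [2 sqrt Upsilon]. *)
(** * Calculus on closed intervals *)

(** Versions for real functions of the library's rules for normed modules. *)
Lemma continuous_Rplus (f g : R -> R) t :
  continuous f t -> continuous g t -> continuous (fun s => f s + g s) t.
Proof. apply (continuous_plus (V := R_NormedModule)). Qed.

Lemma continuous_Rminus (f g : R -> R) t :
  continuous f t -> continuous g t -> continuous (fun s => f s - g s) t.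
Proof. apply (continuous_minus (V := R_NormedModule)). Qed.

Lemma continuous_Rmult (f g : R -> R) t :
  continuous f t -> continuous g t -> continuous (fun s => f s * g s) t.
Proof. apply (continuous_mult (K := R_AbsRing)). Qed.

Lemma is_derive_Rplus (f g : R -> R) t (df dg : R) :
  is_derive f t df -> is_derive g t dg -> is_derive (fun s => f s + g s) t (df + dg).
Proof. apply (is_derive_plus (V := R_NormedModule)). Qed.

Lemma is_derive_Rminus (f g : R -> R) t (df dg : R) :
  is_derive f t df -> is_derive g t dg -> is_derive (fun s => f s - g s) t (df - dg).
Proof. apply (is_derive_minus (V := R_NormedModule)). Qed.

Lemma is_RInt_Rplus (f g : R -> R) a b (If Ig : R) :
  is_RInt f a b If -> is_RInt g a b Ig -> is_RInt (fun y => f y + g y) a b (If + Ig).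
Proof. apply (is_RInt_plus (V := R_NormedModule)). Qed.

(** Nearest-point projection of the line onto [[a, b]]; composing with it
    turns continuity relative to [[a, b]] into continuity everywhere. *)
Definition clamp (a b x : R) : R := Rmax a (Rmin b x).

Lemma clamp_in a b x : a <= b -> a <= clamp a b x <= b.
Proof.
  intros H. unfold clamp. split; [apply Rmax_l|].
  apply Rmax_lub; [exact H|apply Rmin_l].
Qed.

Lemma clamp_id a b x : a <= x <= b -> clamp a b x = x.
Proof.
  intros H. unfold clamp. rewrite Rmin_right, Rmax_right; lra.
Qed.

Lemma clamp_lipschitz a b x y : Rabs (clamp a b x - clamp a b y) <= Rabs (x - y).
Proof.
  unfold clamp, Rmax, Rmin.
  repeat destruct Rle_dec; unfold Rabs; repeat destruct Rcase_abs; lra.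
Qed.

Lemma locally_Rabs (P : R -> Prop) x :
  locally x P <-> exists d, 0 < d /\ forall y, Rabs (y - x) < d -> P y.
Proof.
  split.
  - intros [d Hd]. exists d. split; [apply cond_pos|]. intros y Hy. apply Hd. exact Hy.
  - intros (d & Hd & H). exists (mkposreal d Hd). intros y Hy. apply H. exact Hy.
Qed.

Lemma locally_near (l e : R) : 0 < e -> locally l (fun z => Rabs (z - l) < e).
Proof. intros He. exists (mkposreal e He). intros y Hy. exact Hy. Qed.

Lemma continuous_eps (f : R -> R) x :
  continuous f x <->
  forall e, 0 < e -> exists d, 0 < d /\
    forall y, Rabs (y - x) < d -> Rabs (f y - f x) < e.
Proof.
  split.
  - intros H e He.
    apply (proj1 (locally_Rabs (fun y => Rabs (f y - f x) < e) x)).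
    apply (H (fun z => Rabs (z - f x) < e)), locally_near, He.
  - intros H P [e He]. destruct (H e (cond_pos e)) as (d & Hd & Hy).
    exists (mkposreal d Hd). intros y Hb. apply He. apply Hy. exact Hb.
Qed.

Lemma clamp_continuous a b x : continuous (clamp a b) x.
Proof.
  apply continuous_eps. intros e He. exists e. split; [exact He|].
  intros y Hy. apply Rle_lt_trans with (2 := Hy). apply clamp_lipschitz.
Qed.

Lemma locally_between a b x : a < x < b -> locally x (fun y => a < y < b).
Proof.
  intros H. apply locally_Rabs. exists (Rmin (x - a) (b - x)). split.
  - apply Rmin_pos; lra.
  - intros y Hy. assert (H1 := Rmin_l (x - a) (b - x)).
    assert (H2 := Rmin_r (x - a) (b - x)). apply Rabs_def2 in Hy. lra.
Qed.

Lemma continuous_on_eps (D : R -> Prop) (f : R -> R) :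
  continuous_on D f <->
  forall x, D x -> forall e, 0 < e -> exists d, 0 < d /\
    forall y, D y -> Rabs (y - x) < d -> Rabs (f y - f x) < e.
Proof.
  split.
  - intros H x Hx e He.
    assert (H' := H x Hx (fun z => Rabs (z - f x) < e) (locally_near _ e He)).
    apply (proj1 (locally_Rabs _ x)) in H'. destruct H' as (d & Hd & H').
    exists d. split; [exact Hd|]. intros y Dy Hy. apply H'; assumption.
  - intros H x Hx P [e He]. destruct (H x Hx e (cond_pos e)) as (d & Hd & Hy).
    exists (mkposreal d Hd). intros y Hb Dy. apply He. apply Hy; assumption.
Qed.

Lemma continuous_on_clamp a b (f : R -> R) : a <= b ->
  continuous_on (Icc a b) f -> forall x, continuous (fun y => f (clamp a b y)) x.
Proof.
  intros Hab H x. apply continuous_eps. intros e He.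
  destruct (proj1 (continuous_on_eps _ _) H (clamp a b x) (clamp_in a b x Hab) e He)
    as (d & Hd & Hf).
  exists d. split; [exact Hd|]. intros y Hy. apply Hf.
  - apply clamp_in, Hab.
  - apply Rle_lt_trans with (2 := Hy). apply clamp_lipschitz.
Qed.

(** The mean value theorem with the derivative required only in the interior. *)
Lemma mean_value (f df : R -> R) a b : a < b ->
  (forall x, a < x < b -> is_derive f x (df x)) ->
  (forall x, a <= x <= b -> continuous f x) ->
  exists c, a < c < b /\ f b - f a = df c * (b - a).
Proof.
  intros Hab Hd Hc.
  assert (pr1 : forall c, a < c < b -> derivable_pt f c).
  { intros c Hcc. exists (df c). apply is_derive_Reals, Hd, Hcc. }
  assert (pr2 : forall c, a < c < b -> derivable_pt id c).
  { intros c Hcc. apply derivable_pt_id. }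
  destruct (MVT f id a b pr1 pr2 Hab) as (c & P & E).
  - intros c Hcc. apply continuity_pt_filterlim, Hc, Hcc.
  - intros c Hcc. apply derivable_continuous_pt, derivable_pt_id.
  - exists c. split; [exact P|].
    assert (E1 : derive_pt f c (pr1 c P) = df c).
    { apply derive_pt_eq_0. apply is_derive_Reals, Hd, P. }
    assert (E2 : derive_pt id c (pr2 c P) = 1).
    { apply derive_pt_eq_0, derivable_pt_lim_id. }
    rewrite E1, E2 in E. unfold id in E. lra.
Qed.

Lemma nonincreasing_of_derive (f df : R -> R) a b : a <= b ->
  (forall x, a < x < b -> is_derive f x (df x)) ->
  (forall x, a <= x <= b -> continuous f x) ->
  (forall x, a < x < b -> df x <= 0) -> f b <= f a.
Proof.
  intros [Hab|<-] Hd Hc Hn; [|lra].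
  destruct (mean_value f df a b Hab Hd Hc) as (c & P & E).
  specialize (Hn c P). nra.
Qed.

Lemma lipschitz_of_derive (f df : R -> R) a b M : a <= b ->
  (forall x, a < x < b -> is_derive f x (df x)) ->
  (forall x, a <= x <= b -> continuous f x) ->
  (forall x, a < x < b -> Rabs (df x) <= M) -> Rabs (f b - f a) <= M * (b - a).
Proof.
  intros [Hab|<-] Hd Hc Hn.
  - destruct (mean_value f df a b Hab Hd Hc) as (c & P & E).
    rewrite E, Rabs_mult, (Rabs_right (b - a)) by lra.
    apply Rmult_le_compat_r; [lra|auto].
  - replace (f a - f a) with 0 by ring. rewrite Rabs_R0. lra.
Qed.

(** The fundamental theorem of calculus, same weakening. *)
Lemma RInt_of_derive (f df : R -> R) a b : a <= b ->
  (forall x, a < x < b -> is_derive f x (df x)) ->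
  (forall x, a <= x <= b -> continuous f x) ->
  (forall x, continuous df x) -> RInt df a b = f b - f a.
Proof.
  intros Hab Hd Hc Hdc.
  assert (HI : forall u v, ex_RInt df u v).
  { intros u v. apply (ex_RInt_continuous (V := R_CompleteNormedModule)).
    intros; apply Hdc. }
  assert (HD : forall x, is_derive (fun y => RInt df a y) x (df x)).
  { intros x. apply (is_derive_RInt df (fun y => RInt df a y) a x).
    - apply locally_Rabs. exists 1. split; [lra|]. intros y _.
      apply (RInt_correct (V := R_CompleteNormedModule)), HI.
    - apply Hdc. }
  assert (L := lipschitz_of_derive (fun x => RInt df a x - f x) (fun _ => 0) a b 0 Hab).
  assert (L' : Rabs (RInt df a b - f b - (RInt df a a - f a)) <= 0 * (b - a)).
  { apply L.
    - intros x Hx. replace 0 with (df x - df x) by ring.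
      apply is_derive_Rminus; auto.
    - intros x Hx. apply continuous_Rminus; [|auto].
      apply (ex_derive_continuous (V := R_NormedModule)). exists (df x). apply HD.
    - intros x Hx. rewrite Rabs_R0. lra. }
  rewrite RInt_point in L'. unfold zero in L'; simpl in L'.
  assert (Hz := Rabs_pos (RInt df a b - f b - (0 - f a))).
  destruct (Req_dec (RInt df a b - f b - (0 - f a)) 0) as [E|E]; [lra|].
  apply Rabs_pos_lt in E. lra.
Qed.

(** A continuous function whose interior derivative extends continuously to
    a point is differentiable there relative to the closed interval. *)
Lemma D_in_of_interior (f df : R -> R) a b t : a <= t <= b ->
  (forall x, a < x < b -> is_derive f x (df x)) ->
  (forall x, continuous f x) -> continuous df t ->
  D_in f df (Icc a b) t.
Proof.
  intros Ht Hd Hc Hdt. unfold D_in, limit1_in, limit_in. simpl.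
  intros e He. destruct (proj1 (continuous_eps df t) Hdt e He) as (d & Hd0 & Hdd).
  exists d. split; [exact Hd0|]. unfold D_x, Rdist. intros s [[Hs Hst] Hsd].
  destruct (Rtotal_order s t) as [L|[E|L]]; [|congruence|].
  - destruct (mean_value f df s t L) as (c & P & E).
    + intros; apply Hd; unfold Icc in *; lra.
    + auto.
    + replace ((f s - f t) / (s - t)) with (df c) by (replace (f s - f t) with (- (f t - f s)) by ring; rewrite E; field; lra).
      apply Hdd. apply Rle_lt_trans with (2 := Hsd).
      rewrite !Rabs_left; lra.
  - destruct (mean_value f df t s L) as (c & P & E).
    + intros; apply Hd; unfold Icc in *; lra.
    + auto.
    + replace ((f s - f t) / (s - t)) with (df c) by (rewrite E; field; lra).
      apply Hdd. apply Rle_lt_trans with (2 := Hsd).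
      rewrite !Rabs_right; lra.
Qed.

Lemma D_in_is_derive (f df : R -> R) a b x : a < x < b ->
  D_in f df (Icc a b) x -> is_derive f x (df x).
Proof.
  intros Hx H. apply is_derive_Reals. intros e He.
  destruct (H e He) as (d & Hd & Hl). simpl in Hl. unfold Rdist, D_x, Icc in Hl.
  destruct (proj1 (locally_Rabs _ x) (locally_between a b x Hx)) as (d' & Hd' & Hl').
  assert (Hm : 0 < Rmin d d') by (apply Rmin_pos; assumption).
  exists (mkposreal _ Hm). intros h Hh Hhd. simpl in Hhd.
  assert (H1 := Rmin_l d d'). assert (H2 := Rmin_r d d').
  replace h with (x + h - x) at 2 by ring. apply Hl.
  assert (Hhh : Rabs (x + h - x) = Rabs h) by (f_equal; ring).
  repeat split; rewrite ?Hhh; try lra; apply Rlt_le, Hl'; rewrite Hhh; lra.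
Qed.

(** * Continuous functions of two variables *)

(** Joint continuity on the whole plane. *)
Definition cont2 (f : R -> R -> R) : Prop := forall x y, continuity_2d_pt f x y.

Lemma cont2_clamp (f : R -> R -> R) T : 0 <= T ->
  continuous_on (rect T) (fun z => f (fst z) (snd z)) ->
  cont2 (fun x t => f (clamp 0 1 x) (clamp 0 T t)).
Proof.
  intros HT H x t e.
  assert (Hz : rect T (clamp 0 1 x, clamp 0 T t)).
  { split; simpl; apply clamp_in; lra. }
  assert (H' := H _ Hz (fun z => Rabs (z - f (clamp 0 1 x) (clamp 0 T t)) < e)
    (locally_near _ e (cond_pos e))).
  destruct H' as [d Hd]. exists d. intros x' t' Hx' Ht'.
  apply (Hd (clamp 0 1 x', clamp 0 T t')).
  - split; simpl; (eapply Rle_lt_trans; [apply clamp_lipschitz|assumption]).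
  - split; simpl; apply clamp_in; lra.
Qed.

Lemma cont2_comp (f : R -> R -> R) (g h : R -> R) t :
  cont2 f -> continuous g t -> continuous h t ->
  continuous (fun s => f (g s) (h s)) t.
Proof.
  intros Hf Hg Hh.
  apply (continuous_comp_2 g h f); [assumption|assumption|].
  apply continuity_2d_pt_filterlim, Hf.
Qed.

Lemma cont2_fst (f : R -> R -> R) t x : cont2 f -> continuous (fun y => f y t) x.
Proof.
  intros H. apply (cont2_comp f (fun y => y) (fun _ => t)); auto.
  apply continuous_id. apply continuous_const.
Qed.

Lemma cont2_snd (f : R -> R -> R) t x : cont2 f -> continuous (fun s => f x s) t.
Proof.
  intros H. apply (cont2_comp f (fun _ => x) (fun y => y)); auto.
  apply continuous_const. apply continuous_id.
Qed.

Lemma cont2_mult f g : cont2 f -> cont2 g -> cont2 (fun x y => f x y * g x y).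
Proof. intros Hf Hg x y. apply continuity_2d_pt_mult; auto. Qed.

Lemma cont2_RInt (f : R -> R -> R) t : cont2 f ->
  continuous (fun s => RInt (fun x => f x s) 0 1) t.
Proof.
  intros Hf. apply continuous_eps. intros e He.
  assert (He2 : 0 < e / 2) by lra.
  destruct (uniform_continuity_2d f 0 1 (t - 1) (t + 1) (fun x y _ _ => Hf x y)
    (mkposreal _ He2)) as [d Hd].
  exists (Rmin 1 d). split; [apply Rmin_pos; [lra|apply cond_pos]|].
  intros s Hs. assert (H1 := Rmin_l 1 d). assert (H2 := Rmin_r 1 d).
  assert (Hi : forall r u v, ex_RInt (fun x => f x r) u v).
  { intros r u v. apply (ex_RInt_continuous (V := R_CompleteNormedModule)).
    intros; apply cont2_fst, Hf. }
  rewrite <- (RInt_minus (V := R_CompleteNormedModule)) by apply Hi.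
  apply Rle_lt_trans with ((1 - 0) * (e / 2)); [|lra].
  apply abs_RInt_le_const; [lra| |].
  - apply (ex_RInt_minus (V := R_CompleteNormedModule)); apply Hi.
  - intros x Hx. unfold minus, plus, opp; simpl. apply Rlt_le.
    assert (Hs' := Rabs_def2 _ _ Hs).
    apply (Hd x t x s); try lra.
    replace (x - x) with 0 by ring. rewrite Rabs_R0. apply cond_pos.
Qed.

Lemma cont2_bounded (f : R -> R -> R) T : 0 <= T -> cont2 f ->
  exists M, 0 < M /\ forall x t, Icc 0 1 x -> Icc 0 T t -> Rabs (f x t) <= M.
Proof.
  intros HT Hf.
  destruct (uniform_continuity_2d f 0 1 0 T (fun x y _ _ => Hf x y)
    (mkposreal 1 Rlt_0_1)) as [d Hd]. simpl in Hd.
  destruct (nfloor_ex ((1 + T) / d)) as [n0 [_ Hn]].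
  { apply Rdiv_le_0_compat; [lra|apply cond_pos]. }
  set (n := S n0). assert (Hn' : (1 + T) / d < INR n) by (unfold n; rewrite S_INR; lra).
  assert (Hnp : 0 < INR n) by (apply lt_0_INR; unfold n; lia).
  assert (Hnd : (1 + T) / INR n < d).
  { apply Rmult_lt_reg_r with (INR n / d).
    - apply Rdiv_lt_0_compat; [lra|apply cond_pos].
    - assert (Hdp := cond_pos d).
      replace ((1 + T) / INR n * (INR n / d)) with ((1 + T) / d) by (field; lra).
      replace (d * (INR n / d)) with (INR n) by (field; lra). exact Hn'. }
  exists (Rabs (f 0 0) + INR n). split; [assert (Hp := Rabs_pos (f 0 0)); lra|].
  intros x t Hx Ht. unfold Icc in *.
  (* subdivide the segment from (0,0) to (x,t) *)
  assert (Hk : forall k, (k <= n)%nat ->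
    Rabs (f (x * (INR k / INR n)) (t * (INR k / INR n)) - f 0 0) <= INR k).
  { induction k as [|k IH]; intros Hkn.
    - simpl. unfold Rdiv. rewrite !Rmult_0_l, !Rmult_0_r, Rminus_diag, Rabs_R0. lra.
    - assert (Hr : forall j, (j <= n)%nat -> 0 <= INR j / INR n <= 1).
      { intros j Hj. apply le_INR in Hj. assert (Hj0 := pos_INR j). split.
        - apply Rdiv_le_0_compat; lra.
        - apply Rmult_le_reg_r with (INR n); [lra|].
          unfold Rdiv. rewrite Rmult_assoc, Rinv_l; lra. }
      assert (H1 := Hr k ltac:(lia)). assert (H2 := Hr (S k) Hkn).
      assert (Hst : INR (S k) / INR n - INR k / INR n = / INR n).
      { rewrite S_INR. field. lra. }
      assert (Hin : 0 < / INR n) by (apply Rinv_0_lt_compat; lra).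
      assert (Hd1 : / INR n < d).
      { apply Rle_lt_trans with (2 := Hnd). unfold Rdiv. nra. }
      assert (Hd2 : T * / INR n < d).
      { apply Rle_lt_trans with (2 := Hnd). unfold Rdiv. nra. }
      specialize (IH ltac:(lia)).
      assert (Hstep := Hd (x * (INR k / INR n)) (t * (INR k / INR n))
        (x * (INR (S k) / INR n)) (t * (INR (S k) / INR n))).
      assert (Hs : Rabs (f (x * (INR (S k) / INR n)) (t * (INR (S k) / INR n)) -
        f (x * (INR k / INR n)) (t * (INR k / INR n))) < 1).
      { apply Hstep; try nra.
        - rewrite <- Rmult_minus_distr_l, Hst, Rabs_right; nra.
        - rewrite <- Rmult_minus_distr_l, Hst, Rabs_right; nra. }
      replace (INR (S k)) with (1 + INR k) at 3 by (rewrite S_INR; ring).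
      replace (f (x * (INR (S k) / INR n)) (t * (INR (S k) / INR n)) - f 0 0) with
        ((f (x * (INR (S k) / INR n)) (t * (INR (S k) / INR n)) -
        f (x * (INR k / INR n)) (t * (INR k / INR n))) +
        (f (x * (INR k / INR n)) (t * (INR k / INR n)) - f 0 0)) by ring.
      eapply Rle_trans; [apply Rabs_triang|]. lra. }
  specialize (Hk n (Nat.le_refl n)).
  replace (INR n / INR n) with 1 in Hk by (field; lra). rewrite !Rmult_1_r in Hk.
  replace (f x t) with ((f x t - f 0 0) + f 0 0) by ring.
  eapply Rle_trans; [apply Rabs_triang|]. lra.
Qed.

Lemma continuous_bounded (f : R -> R) P : 0 <= P -> (forall x, continuous f x) ->
  exists M, 0 < M /\ forall x, Rabs x <= P -> Rabs (f x) <= M.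
Proof.
  intros HP Hf.
  destruct (continuity_ab_maj (fun x => Rabs (f x)) (- P) P) as (x0 & Hx0 & _); [lra| |].
  - intros c _. apply continuity_pt_filterlim. apply continuous_Rabs_comp, Hf.
  - exists (Rabs (f x0) + 1). split; [assert (H := Rabs_pos (f x0)); lra|].
    intros x Hx. apply Rabs_le_between in Hx. specialize (Hx0 x Hx). lra.
Qed.

(** * Null sets and the sup norm *)

Lemma sum_f_R0_le (f g : nat -> R) n :
  (forall k, f k <= g k) -> sum_f_R0 f n <= sum_f_R0 g n.
Proof. intros H. apply sum_Rle. intros k _. apply H. Qed.

(** The measure of an initial part of the cover, [F n x] being the total
    length to the left of [x] of the first intervals, grows at least as fast as [x]:
    at the supremum of the points reached so far, one more interval helps. *)
Lemma interval_not_null a b : a < b ->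
  ~ null_set (fun x => a <= x <= b).
Proof.
  intros Hab Hn. destruct (Hn ((b - a) / 2)) as (l & r & Hlr & Hcov & Hsum); [lra|].
  set (F := fun n x => sum_f_R0 (fun k => Rmax 0 (Rmin x (r k) - l k)) n).
  assert (Fmono : forall n x y, x <= y -> F n x <= F n y).
  { intros n x y Hxy. apply sum_f_R0_le. intros k.
    unfold Rmax, Rmin. repeat destruct Rle_dec; lra. }
  assert (Fstep : forall n m x y, x <= y -> (n <= m)%nat ->
            F n y - F n x <= F m y - F m x).
  { intros n m x y Hxy Hnm. induction Hnm as [|m Hnm IH]; [lra|].
    eapply Rle_trans; [exact IH|]. unfold F. rewrite !tech5.
    assert (Rmax 0 (Rmin x (r (S m)) - l (S m)) <= Rmax 0 (Rmin y (r (S m)) - l (S m))).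
    { unfold Rmax, Rmin. repeat destruct Rle_dec; lra. }
    lra. }
  assert (Fin : forall k x y, l k <= x -> x <= y -> y <= r k ->
            y - x <= F k y - F k x).
  { intros k x y H1 H2 H3.
    assert (E : forall z, l k <= z <= r k -> Rmax 0 (Rmin z (r k) - l k) = z - l k).
    { intros z Hz. rewrite Rmin_left, Rmax_right; lra. }
    unfold F. destruct k as [|k]; simpl; rewrite !E by lra; [lra|].
    assert (H := Fmono k x y H2). unfold F in H. lra. }
  set (E := fun x => a <= x <= b /\ exists n, x - a <= F n x - F n a).
  assert (Ea : E a). { split; [lra|]. exists 0%nat. lra. }
  destruct (completeness E) as [c [Hub Hlub]].
  { exists b. intros x [Hx _]. lra. }
  { exists a. exact Ea. }
  assert (Hac : a <= c) by (apply Hub, Ea).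
  assert (Hcb : c <= b) by (apply Hlub; intros x [Hx _]; lra).
  destruct (Hcov c) as [k Hk]; [lra|].
  assert (Hex : exists y, E y /\ l k < y <= c).
  { apply NNPP. intros Hno.
    assert (c <= l k); [|lra].
    apply Hlub. intros y Ey. apply Rnot_lt_le. intros Hly.
    apply Hno. exists y. split; [exact Ey|]. split; [exact Hly|apply Hub, Ey]. }
  destruct Hex as (y & [Hyb [n Hyn]] & Hly & Hyc).
  set (z := Rmin b ((c + r k) / 2)).
  assert (Hz1 := Rmin_l b ((c + r k) / 2)). assert (Hz2 := Rmin_r b ((c + r k) / 2)).
  assert (Hz3 : c <= z) by (apply Rmin_glb; lra). fold z in Hz1, Hz2.
  assert (Ez : exists j, z - a <= F j z - F j a).
  { exists (max n k).
    assert (H1 := Fin k y z ltac:(lra) ltac:(lra) ltac:(lra)).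
    assert (H2 := Fstep k (max n k) y z ltac:(lra) ltac:(lia)).
    assert (H3 := Fstep n (max n k) a y ltac:(lra) ltac:(lia)). lra. }
  assert (Hzc : z <= c) by (apply Hub; split; [lra|exact Ez]).
  assert (Hzb : z = b).
  { unfold z in *. destruct (Rle_lt_dec b ((c + r k) / 2)).
    - apply Rmin_left; lra.
    - rewrite Rmin_right in Hzc by lra. lra. }
  rewrite Hzb in Ez. destruct Ez as [j Hj].
  assert (HFb : F j b <= (b - a) / 2).
  { eapply Rle_trans; [|apply (Hsum j)]. apply sum_f_R0_le. intros i.
    specialize (Hlr i). unfold Rmax, Rmin. repeat destruct Rle_dec; lra. }
  assert (HFa : 0 <= F j a).
  { apply cond_pos_sum. intros i. apply Rmax_l. }
  lra.
Qed.

Lemma null_set_incl (A B : R -> Prop) :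
  (forall x, A x -> B x) -> null_set B -> null_set A.
Proof.
  intros H HB e He. destruct (HB e He) as (a & b & H1 & H2 & H3).
  exists a, b. repeat split; auto.
Qed.

(** Where a function agrees with a continuous one, the essential bound is a
    pointwise bound. *)
Lemma Linf_norm_pointwise (f g : R -> R) a b m :
  0 <= a -> b <= 1 -> (forall x, a < x < b -> f x = g x) ->
  (forall x, continuous g x) ->
  Rbar_le (Linf_norm f) (Finite m) ->
  forall x, a < x < b -> Rabs (g x) <= m.
Proof.
  intros Ha Hb Hfg Hg Hn x Hx. apply Rnot_lt_le. intros Hlt.
  assert (HM : exists M, null_set (fun y => Icc 0 1 y /\ M < Rabs (f y)) /\
                 M < (m + Rabs (g x)) / 2).
  { apply NNPP. intros Hno. unfold Linf_norm in Hn.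
    set (S := fun M => 0 <= M /\ null_set (fun y => Icc 0 1 y /\ M < Rabs (f y))) in Hn.
    assert (Hl : Rbar_le (Finite ((m + Rabs (g x)) / 2)) (Glb_Rbar S)).
    { apply (proj2 (Glb_Rbar_correct S)). intros M [_ HM]. simpl.
      apply Rnot_lt_le. intros H. apply Hno. exists M. auto. }
    assert (H := Rbar_le_trans _ _ _ Hl Hn). simpl in H. lra. }
  destruct HM as (M & Hnull & HM).
  assert (Hc := continuous_Rabs_comp g x (Hg x)).
  destruct (proj1 (continuous_eps _ x) Hc ((Rabs (g x) - m) / 2) ltac:(lra))
    as (d & Hd & Hy).
  set (r := Rmin (d / 2) (b - x)).
  assert (Hr1 := Rmin_l (d / 2) (b - x)). assert (Hr2 := Rmin_r (d / 2) (b - x)).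
  assert (Hr : 0 < r) by (apply Rmin_pos; lra). fold r in Hr1, Hr2.
  apply (interval_not_null (x + r / 3) (x + r / 2)); [lra|].
  apply null_set_incl with (2 := Hnull). intros y Hyr. split; [unfold Icc; lra|].
  rewrite Hfg by lra.
  assert (H := Hy y). rewrite Rabs_right in H by lra. specialize (H ltac:(lra)).
  apply Rabs_def2 in H. lra.
Qed.

(** * Second differences of the surface energy *)

Lemma taylor2 (W : R -> R) x y : Cn 3 W -> x <> y ->
  exists z, Rmin x y < z < Rmax x y /\
    W y = W x + Derive W x * (y - x) + (y - x) ^ 2 / 2 * Derive_n W 2 z.
Proof.
  intros [HW _] Hxy.
  destruct (Rtotal_order x y) as [L|[E|L]]; [|contradiction|].
  - destruct (Taylor_Lagrange W 1 x y L) as (z & Hz & E).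
    { intros t _ k Hk. apply HW. lia. }
    exists z. rewrite Rmin_left, Rmax_right by lra. split; [exact Hz|].
    rewrite E. change (Derive_n W 2 z) with (Derive (Derive W) z).
    unfold sum_f_R0. change (Derive_n W 0 x) with (W x).
    change (Derive_n W 1 x) with (Derive W x). simpl. field.
  - (* the expansion at the right end, by reflection *)
    assert (Hl : forall n z, (n <= 3)%nat -> locally (- z) (fun y0 =>
              forall k, (k <= n)%nat -> ex_derive_n W k y0)).
    { intros n z Hn. apply locally_Rabs. exists 1. split; [lra|].
      intros. apply HW. lia. }
    destruct (Taylor_Lagrange (fun s => W (- s)) 1 (- x) (- y)) as (z & Hz & E).
    { lra. }
    { intros t _ k Hk. apply ex_derive_n_comp_opp, Hl. lia. }
    exists (- z). rewrite Rmin_right, Rmax_left by lra. split; [lra|].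
    rewrite Derive_n_comp_opp in E by (apply Hl; lia).
    unfold sum_f_R0 in E. rewrite !Derive_n_comp_opp in E by (apply Hl; lia).
    rewrite !Ropp_involutive in E. rewrite E.
    change (Derive_n W 0 x) with (W x).
    change (Derive_n W 1 x) with (Derive W x).
    generalize (Derive_n W 2 (- z)). intros w. simpl. field.
Qed.

(** Bounds [w0], [w1] and a Lipschitz constant [L] for [W''] over the slopes
    in [[-P, P]]. *)
Record energy_bounds (W : R -> R) (P w0 w1 L : R) : Prop := {
  eb_pos : 0 < w0 /\ 0 < w1 /\ 0 < L;
  eb_low : forall q, Rabs q <= P -> w0 <= Derive_n W 2 q;
  eb_upp : forall q, Rabs q <= P -> Derive_n W 2 q <= w1;
  eb_lip : forall q r, Rabs q <= P -> Rabs r <= P ->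
    Rabs (Derive_n W 2 q - Derive_n W 2 r) <= L * Rabs (q - r)
}.
Arguments eb_pos {_ _ _ _ _} _.
Arguments eb_low {_ _ _ _ _} _.
Arguments eb_upp {_ _ _ _ _} _.
Arguments eb_lip {_ _ _ _ _} _.

Lemma Derive_n2_continuous (W : R -> R) x : Cn 3 W -> continuous (Derive_n W 2) x.
Proof.
  intros [HW _]. apply (ex_derive_continuous (V := R_NormedModule)).
  apply (HW 3%nat x). lia.
Qed.

Lemma energy_bounds_exist (W : R -> R) P : 0 <= P -> Cn 3 W ->
  (forall q, 0 < Derive_n W 2 q) -> exists w0 w1 L, energy_bounds W P w0 w1 L.
Proof.
  intros HP HW Hpos.
  destruct (continuous_bounded (Derive_n W 2) P HP) as (w1 & Hw1 & Hb1).
  { intros x. apply Derive_n2_continuous, HW. }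
  destruct (continuous_bounded (Derive_n W 3) P HP) as (L & HL & HbL).
  { apply HW. }
  destruct (continuity_ab_min (Derive_n W 2) (- P) P) as (q0 & Hq0 & _).
  { lra. }
  { intros c _. apply continuity_pt_filterlim, Derive_n2_continuous, HW. }
  exists (Derive_n W 2 q0), w1, L. constructor.
  - auto.
  - intros q Hq. apply Hq0. apply Rabs_le_between, Hq.
  - intros q Hq. apply Rle_trans with (2 := Hb1 q Hq). apply Rle_abs.
  - assert (Hlt : forall q r, q <= r -> Rabs q <= P -> Rabs r <= P ->
      Rabs (Derive_n W 2 r - Derive_n W 2 q) <= L * (r - q)).
    { intros q r Hqr Hq Hr.
      apply (lipschitz_of_derive (Derive_n W 2) (Derive_n W 3) q r L Hqr).
      - intros x _. apply (Derive_correct (Derive_n W 2) x).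
        apply (proj1 HW 3%nat x). lia.
      - intros x _. apply Derive_n2_continuous, HW.
      - intros x Hx. apply HbL. apply Rabs_le_between in Hq, Hr.
        apply Rabs_le. lra. }
    intros q r Hq Hr. destruct (Rle_lt_dec q r) as [H|H].
    + rewrite Rabs_minus_sym, (Rabs_minus_sym q r), (Rabs_right (r - q)) by lra. auto.
    + rewrite (Rabs_right (q - r)) by lra. apply Hlt; auto; lra.
Qed.

(** The slopes before and after a face of slope [q]: strictly on either side
    of [q], or equal. *)
Definition flanking (o q r : R) : Prop :=
  o <> q /\ q <> r /\ (0 < (q - o) * (r - q) \/ o = r).

Lemma adjacent_flanking Sl o q r :
  adjacent Sl o q -> adjacent Sl q r -> flanking o q r.
Proof.
  intros (So & Sq & Hoq & H1) (_ & Sr & Hqr & H2).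
  repeat split; auto.
  destruct (Rtotal_order o r) as [L|[E|L]]; [|right; exact E|]; left;
  destruct (Rtotal_order o q) as [L1|[E1|L1]]; try congruence;
  destruct (Rtotal_order q r) as [L2|[E2|L2]]; try congruence; try nra; exfalso.
  - apply (H1 r Sr). rewrite Rmin_left, Rmax_right; lra.
  - apply (H2 o So). rewrite Rmin_left, Rmax_right; lra.
  - apply (H2 o So). rewrite Rmin_right, Rmax_left; lra.
  - apply (H1 r Sr). rewrite Rmin_right, Rmax_left; lra.
Qed.

(** The jump of difference quotients is a second difference of the slopes
    times nearly [W'']; in the flat case [o = r] both vanish, and this is
    where adjacency is used: increments of opposite signs and different sizes
    would leave an error not controlled by the second difference. *)
Lemma secant_jump (W : R -> R) P w0 w1 L m o q r :
  Cn 3 W -> energy_bounds W P w0 w1 L ->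
  Rabs o <= P -> Rabs q <= P -> Rabs r <= P -> flanking o q r ->
  Rabs (q - o) <= m -> Rabs (r - q) <= m ->
  exists theta, w0 <= theta /\ Rabs (theta - Derive_n W 2 q) <= L * m /\
    (W r - W q) / (r - q) - (W q - W o) / (q - o) = theta * ((r - o) / 2).
Proof.
  intros HW HB Ho Hq Hr (N1 & N2 & Hf) Hm1 Hm2.
  assert (HL := eb_pos HB).
  assert (Hm : 0 <= m) by (assert (H := Rabs_pos (q - o)); lra).
  destruct Hf as [Hf|<-].
  - destruct (taylor2 W q r HW N2) as (z1 & Hz1 & E1).
    destruct (taylor2 W q o HW (not_eq_sym N1)) as (z2 & Hz2 & E2).
    set (h := r - q). set (k := q - o).
    assert (Hhk : h + k <> 0) by (unfold h, k; intros H; assert ((q - o) * (r - q) <= 0) by nra; lra).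
    set (A := Derive_n W 2 z1) in *. set (B := Derive_n W 2 z2) in *.
    assert (Hbd : forall x z, Rabs x <= P -> Rmin q x < z < Rmax q x ->
      Rabs (q - x) <= m -> Rabs z <= P /\ Rabs (z - q) <= m).
    { intros x z Hx Hz Hqx. unfold Rmin, Rmax in Hz.
      destruct Rle_dec; apply Rabs_le_between in Hx, Hq, Hqx;
      split; apply Rabs_le; lra. }
    rewrite Rabs_minus_sym in Hm2.
    destruct (Hbd r z1 Hr Hz1 Hm2) as [P1 D1].
    destruct (Hbd o z2 Ho Hz2 Hm1) as [P2 D2].
    assert (A0 := eb_low HB z1 P1). assert (B0 := eb_low HB z2 P2).
    assert (A1 := eb_lip HB z1 q P1 Hq). assert (B1 := eb_lip HB z2 q P2 Hq).
    fold A in A0, A1. fold B in B0, B1.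
    (* [theta] is an average of [A] and [B], the increments having one sign *)
    set (a := h / (h + k)).
    assert (Ha : 0 <= a <= 1).
    { unfold a. assert (Hs : 0 < h * k) by (unfold h, k; lra).
      destruct (Rlt_le_dec 0 h) as [H|H].
      - assert (0 < k) by nra. split.
        + apply Rdiv_le_0_compat; lra.
        + apply Rmult_le_reg_r with (h + k); [lra|]. unfold Rdiv. rewrite Rmult_assoc, Rinv_l; lra.
      - assert (k < 0) by nra.
        replace (h / (h + k)) with ((- h) / (- h + - k)) by (field; split; [|lra]; intro; apply Hhk; lra).
        split.
        + apply Rdiv_le_0_compat; nra.
        + apply Rmult_le_reg_r with (- h + - k); [nra|]. unfold Rdiv. rewrite Rmult_assoc, Rinv_l; nra. }
    exists (a * A + (1 - a) * B). split; [nra|]. split.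
    + replace (a * A + (1 - a) * B - Derive_n W 2 q) with
        (a * (A - Derive_n W 2 q) + (1 - a) * (B - Derive_n W 2 q)) by ring.
      eapply Rle_trans; [apply Rabs_triang|].
      rewrite !Rabs_mult, (Rabs_right a), (Rabs_right (1 - a)) by lra.
      assert (Rabs (A - Derive_n W 2 q) <= L * m) by nra.
      assert (Rabs (B - Derive_n W 2 q) <= L * m) by nra. nra.
    + rewrite E1, E2.
      replace (r - o) with (h + k) by (unfold h, k; ring).
      unfold a. replace (r - q) with h by reflexivity. replace (q - o) with k by reflexivity.
      replace (o - q) with (- k) by (unfold k; ring). field.
      unfold h, k in *. repeat split; lra.
  - exists (Derive_n W 2 q). split; [apply (eb_low HB), Hq|]. split.
    + rewrite Rminus_diag, Rabs_R0. nra.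
    + field. split; lra.
Qed.

(** The equation reads [u_t = mobility W u_x * u_xx]. *)
Definition mobility (W : R -> R) (q : R) : R := sqrt (1 + q ^ 2) * Derive_n W 2 q.

Lemma sqrt1_ge1 q : 1 <= sqrt (1 + q ^ 2).
Proof. rewrite <- sqrt_1 at 1. apply sqrt_le_1_alt. nra. Qed.

Lemma sqrt1_le q P : Rabs q <= P -> sqrt (1 + q ^ 2) <= 1 + P.
Proof.
  intros H. apply Rabs_le_between in H.
  rewrite <- (sqrt_pow2 (1 + P)) by lra. apply sqrt_le_1_alt. nra.
Qed.

Lemma sqrt1_lipschitz q r :
  Rabs (sqrt (1 + q ^ 2) - sqrt (1 + r ^ 2)) <= Rabs (q - r).
Proof.
  assert (Hq := sqrt1_ge1 q). assert (Hr := sqrt1_ge1 r).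
  assert (Eq : sqrt (1 + q ^ 2) * sqrt (1 + q ^ 2) = 1 + q ^ 2) by (apply sqrt_sqrt; nra).
  assert (Er : sqrt (1 + r ^ 2) * sqrt (1 + r ^ 2) = 1 + r ^ 2) by (apply sqrt_sqrt; nra).
  set (a := sqrt (1 + q ^ 2)) in *. set (b := sqrt (1 + r ^ 2)) in *.
  apply Rsqr_le_abs_0. unfold Rsqr.
  assert (1 + q * r <= a * b).
  { apply Rnot_lt_le. intros H. assert (0 <= a * b) by nra.
    assert ((a * b) * (a * b) < (1 + q * r) * (1 + q * r)) by nra.
    assert ((a * b) * (a * b) = (1 + q ^ 2) * (1 + r ^ 2)) by (rewrite <- Eq, <- Er; ring).
    assert (H' := Rle_0_sqr (q - r)). unfold Rsqr in H'. lra. }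
  nra.
Qed.

Lemma mobility_lipschitz (W : R -> R) P w0 w1 L q r :
  energy_bounds W P w0 w1 L -> Rabs q <= P -> Rabs r <= P ->
  Rabs (mobility W q - mobility W r) <= ((1 + P) * L + w1) * Rabs (q - r).
Proof.
  intros HB Hq Hr. unfold mobility.
  assert (H1 := sqrt1_le q P Hq). assert (H0 := sqrt1_ge1 q).
  assert (H2 := sqrt1_lipschitz q r). assert (H3 := eb_lip HB q r Hq Hr).
  assert (H4 := eb_low HB r Hr). assert (H5 := eb_upp HB r Hr).
  assert (H6 := eb_pos HB).
  replace (sqrt (1 + q ^ 2) * Derive_n W 2 q - sqrt (1 + r ^ 2) * Derive_n W 2 r) with
    (sqrt (1 + q ^ 2) * (Derive_n W 2 q - Derive_n W 2 r) +
     Derive_n W 2 r * (sqrt (1 + q ^ 2) - sqrt (1 + r ^ 2))) by ring.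
  eapply Rle_trans; [apply Rabs_triang|]. rewrite !Rabs_mult.
  rewrite (Rabs_right (sqrt (1 + q ^ 2))), (Rabs_right (Derive_n W 2 r)) by lra.
  assert (Hp := Rabs_pos (q - r)).
  assert (Hp1 := Rabs_pos (Derive_n W 2 q - Derive_n W 2 r)).
  assert (Hp2 := Rabs_pos (sqrt (1 + q ^ 2) - sqrt (1 + r ^ 2))).
  rewrite Rmult_plus_distr_r. apply Rplus_le_compat.
  - rewrite Rmult_assoc. apply Rmult_le_compat; lra.
  - apply Rmult_le_compat; lra.
Qed.

(** * Removing and merging faces *)

Lemma Sorted_map_seq {A} (Q : A -> A -> Prop) (f : nat -> A) n : forall s,
  Sorted Q (map f (seq s n)) <->
  forall i, (s <= i)%nat -> (S i < s + n)%nat -> Q (f i) (f (S i)).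
Proof.
  induction n as [|n IH]; intros s.
  - split; [intros; lia|intros; constructor].
  - change (seq s (S n)) with (s :: seq (S s) n). simpl map. split.
    + intros H i Hi Hin. apply Sorted_inv in H. destruct H as [HS HH].
      destruct (Nat.eq_dec i s) as [->|N].
      * destruct n as [|n]; [lia|]. change (seq (S s) (S n)) with (S s :: seq (S (S s)) n) in HH.
        simpl in HH. inversion HH; assumption.
      * apply (proj1 (IH (S s)) HS); lia.
    + intros H. constructor.
      * apply IH. intros i Hi Hin. apply H; lia.
      * destruct n as [|n]; [constructor|].
        change (seq (S s) (S n)) with (S s :: seq (S (S s)) n). constructor. apply H; lia.
Qed.

(** Two entries become consecutive after filtering when everything between
    them is dropped. *)
Lemma Sorted_filter_map_seq {A} (Q : A -> A -> Prop) (b : A -> bool) (f : nat -> A) n :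
  forall s,
  (forall i j, (s <= i)%nat -> (i < j)%nat -> (j < s + n)%nat ->
     b (f i) = true -> b (f j) = true ->
     (forall l, (i < l < j)%nat -> b (f l) = false) -> Q (f i) (f j)) ->
  Sorted Q (filter b (map f (seq s n))).
Proof.
  induction n as [|n IH]; intros s H; [constructor|].
  change (seq s (S n)) with (s :: seq (S s) n). simpl map. simpl filter.
  assert (HS : Sorted Q (filter b (map f (seq (S s) n)))).
  { apply IH. intros i j H1 H2 H3. apply H; lia. }
  destruct (b (f s)) eqn:E; [|exact HS]. constructor; [exact HS|].
  assert (Hh : forall k d, (s < d)%nat -> (d + k = s + S n)%nat ->
    (forall l, (s < l < d)%nat -> b (f l) = false) ->
    HdRel Q (f s) (filter b (map f (seq d k)))).
  { induction k as [|k IHk]; intros d Hd Hdk Hl; [constructor|].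
    change (seq d (S k)) with (d :: seq (S d) k). simpl map. simpl filter.
    destruct (b (f d)) eqn:Ed.
    - constructor. apply H; auto; lia.
    - apply IHk; [lia|lia|]. intros l Hl'.
      destruct (Nat.eq_dec l d) as [->|N]; [exact Ed|apply Hl; lia]. }
  apply Hh; lia.
Qed.

(** Merging turns a list of slopes whose successive entries are equal or
    related into one whose successive entries are related. *)
Lemma merge_equal_sorted (Q : R -> R -> Prop) l :
  Sorted (fun f g => snd f = snd g \/ Q (snd f) (snd g)) l ->
  Sorted (fun f g => Q (snd f) (snd g)) (merge_equal l) /\
  match l, merge_equal l with
  | [], [] => True
  | f :: _, g :: _ => snd f = snd g
  | _, _ => False
  end.
Proof.
  induction l as [|[l1 p1] q IH]; intros H; [split; constructor|].
  apply Sorted_inv in H. destruct H as [HS HH]. destruct (IH HS) as [IS IM].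
  simpl. destruct (merge_equal q) as [|[l2 p2] r] eqn:E.
  - split; [repeat constructor|reflexivity].
  - destruct q as [|[l3 p3] q']; [discriminate|]. rewrite E in IM. simpl in IM. subst p3.
    apply Sorted_inv in IS. destruct IS as [IS1 IS2].
    inversion HH as [|? ? HQ]; subst. simpl in HQ.
    destruct (Req_dec_T p1 p2) as [->|N].
    + split; [|reflexivity]. constructor; [exact IS1|].
      inversion IS2; subst; constructor. assumption.
    + split; [|reflexivity]. constructor.
      * constructor; assumption.
      * constructor. simpl. destruct HQ; [contradiction|assumption].
Qed.

Lemma merge_equal_Forall (Q : R -> Prop) l :
  List.Forall (fun f => Q (snd f)) l -> List.Forall (fun f => Q (snd f)) (merge_equal l).
Proof.
  intros H. induction H as [|[l1 p1] q H1 H2 IH]; [constructor|]. simpl.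
  destruct (merge_equal q) as [|[l2 p2] r]; [constructor; auto|].
  inversion IH; subst.
  destruct (Req_dec_T p1 p2); repeat constructor; auto.
Qed.

(** Consecutive slopes are related by [Q], and all of them satisfy [B]. *)
Definition linked (Q : R -> R -> Prop) (B : R -> Prop) (N : nat) (p : nat -> R) : Prop :=
  (forall i, (1 <= i < N)%nat -> Q (p i) (p (S i))) /\
  forall i, is_face N i -> B (p i).

(** Slopes alternate along a run of faces each of which has equal neighbours. *)
Lemma alternating_slopes (p : nat -> R) i n :
  (forall l, (i < l < i + S n)%nat -> p (l - 1)%nat = p (l + 1)%nat) ->
  (p (i + n)%nat = p i /\ p (S (i + n)) = p (S i)) \/
  (p (i + n)%nat = p (S i) /\ p (S (i + n)) = p i).
Proof.
  induction n as [|n IH]; intros H.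
  - left. rewrite Nat.add_0_r. auto.
  - assert (E := H (i + S n)%nat ltac:(lia)).
    replace (i + S n - 1)%nat with (i + n)%nat in E by lia.
    replace (i + S n + 1)%nat with (S (i + S n)) in E by lia.
    rewrite <- E. replace (i + S n)%nat with (S (i + n)) by lia.
    destruct IH as [[H1 H2]|[H1 H2]]; [intros; apply H; lia| |]; auto.
Qed.

(** The link between consecutive slopes survives the removal of vanished
    faces, provided those lying between two persistent ones are flat. *)
Lemma linked_update Q B N p x N' p' x' :
  (forall a b, Q a b -> Q b a) ->
  linked Q B N p ->
  (forall i j k, (1 <= j < i)%nat -> (i < k <= N)%nat ->
     0 < len x j -> 0 < len x k -> len x i <= 0 ->
     p (i - 1)%nat = p (i + 1)%nat) ->
  face_list N' p' x' = merge_equal (remove_vanished (face_list N p x)) ->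
  linked Q B N' p'.
Proof.
  intros Hsym [HL HB] Hflat E.
  assert (Hb : forall f : R * R, (if Rlt_dec 0 (fst f) then true else false) = true <-> 0 < fst f).
  { intros f. destruct Rlt_dec; split; auto; discriminate. }
  assert (Hs : Sorted (fun f g => snd f = snd g \/ Q (snd f) (snd g))
                 (remove_vanished (face_list N p x))).
  { unfold remove_vanished, face_list. apply Sorted_filter_map_seq.
    intros i j Hi Hij Hj Bi Bj Hz.
    apply Hb in Bi, Bj. simpl in Bi, Bj, Hz |- *.
    assert (Hp := alternating_slopes p i (j - S i)).
    replace (i + (j - S i))%nat with (j - 1)%nat in Hp by lia.
    replace (S (j - 1)) with j in Hp by lia.
    assert (HQ := HL i ltac:(lia)).
    destruct Hp as [[_ ->]|[_ ->]]; auto.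
    intros l Hl. apply (Hflat l i j); try lia; auto.
    specialize (Hz l ltac:(lia)). destruct (Rlt_dec 0 (len x l)); [discriminate|lra]. }
  assert (HF : List.Forall (fun f => B (snd f)) (remove_vanished (face_list N p x))).
  { apply Forall_forall. intros f Hf. apply filter_In in Hf. destruct Hf as [Hf _].
    apply in_map_iff in Hf. destruct Hf as (i & <- & Hi). apply in_seq in Hi.
    simpl. apply HB. unfold is_face. lia. }
  apply merge_equal_sorted in Hs. destruct Hs as [Hs _].
  apply merge_equal_Forall in HF. rewrite <- E in Hs, HF. split.
  - intros i Hi. unfold face_list in Hs. rewrite Sorted_map_seq in Hs.
    apply (Hs i); lia.
  - intros i Hi. rewrite Forall_forall in HF.
    apply (HF (len x' i, p' i)). unfold face_list. apply in_map_iff.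
    exists i. split; [reflexivity|]. apply in_seq. unfold is_face in Hi. lia.
Qed.

(** * Finite sums *)

(** [f 1 + ... + f n], a numbering that fits faces and inner corners. *)
Fixpoint sum1 (f : nat -> R) (n : nat) : R :=
  match n with O => 0 | S k => sum1 f k + f (S k) end.

Lemma sum1_ext f g n : (forall i, (1 <= i <= n)%nat -> f i = g i) -> sum1 f n = sum1 g n.
Proof.
  induction n as [|n IH]; intros H; [reflexivity|].
  simpl. rewrite IH, (H (S n)); auto; [lia|]. intros; apply H; lia.
Qed.

Lemma sum1_le f g n : (forall i, (1 <= i <= n)%nat -> f i <= g i) -> sum1 f n <= sum1 g n.
Proof.
  induction n as [|n IH]; intros H; simpl; [lra|].
  apply Rplus_le_compat; [apply IH; intros; apply H; lia|apply H; lia].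
Qed.

Lemma sum1_plus f g n : sum1 (fun i => f i + g i) n = sum1 f n + sum1 g n.
Proof. induction n as [|n IH]; simpl; [ring|rewrite IH; ring]. Qed.

Lemma sum1_scal c f n : sum1 (fun i => c * f i) n = c * sum1 f n.
Proof. induction n as [|n IH]; simpl; [ring|rewrite IH; ring]. Qed.

Lemma sum1_telescope (f : nat -> R) n : sum1 (fun i => f i - f (i - 1)%nat) n = f n - f 0%nat.
Proof.
  induction n as [|n IH]; simpl; [ring|]. rewrite IH, Nat.sub_0_r. ring.
Qed.

Lemma sum1_is_derive (f : nat -> R -> R) df n t :
  (forall i, (1 <= i <= n)%nat -> is_derive (f i) t (df i)) ->
  is_derive (fun s => sum1 (fun i => f i s) n) t (sum1 df n).
Proof.
  induction n as [|n IH]; intros H; simpl.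
  - apply (is_derive_const (V := R_NormedModule)).
  - apply is_derive_Rplus; [apply IH; intros; apply H; lia|apply H; lia].
Qed.

Lemma sum1_continuous (f : nat -> R -> R) n t :
  (forall i, (1 <= i <= n)%nat -> continuous (f i) t) ->
  continuous (fun s => sum1 (fun i => f i s) n) t.
Proof.
  induction n as [|n IH]; intros H; simpl.
  - apply continuous_const.
  - apply continuous_Rplus; [apply IH; intros; apply H; lia|apply H; lia].
Qed.

(** * Crystalline motion between two disappearances *)

(** Corners [x 0], ..., [x N] obeying the evolution law on [[a, b]]; lengths
    are positive before time [b].  The corners are continuous on the whole
    line, which costs nothing as they may be extended by constants. *)
Record motion (W : R -> R) (N : nat) (p : nat -> R) (x : nat -> R -> R)
    (a b : R) : Prop := {
  mo_time : a < b;
  mo_cont : forall i t, (i <= N)%nat -> continuous (x i) t;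
  mo_left : forall t, x 0%nat t = 0;
  mo_right : forall t, x N t = 1;
  mo_pos : forall t i, a <= t < b -> is_face N i -> 0 < len (fun j => x j t) i;
  mo_end : forall i, is_face N i -> 0 <= len (fun j => x j b) i;
  mo_der : forall t i, a < t < b -> (1 <= i < N)%nat ->
    is_derive (x i) t
      (- ((velocity W N p (fun j => x j t) (i + 1)%nat - velocity W N p (fun j => x j t) i)
          / (p (i + 1)%nat - p i)))
}.
Arguments mo_time {_ _ _ _ _ _} _.
Arguments mo_cont {_ _ _ _ _ _} _.
Arguments mo_left {_ _ _ _ _ _} _.
Arguments mo_right {_ _ _ _ _ _} _.
Arguments mo_pos {_ _ _ _ _ _} _.
Arguments mo_end {_ _ _ _ _ _} _.
Arguments mo_der {_ _ _ _ _ _} _.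

Lemma motion_pos_faces W N p x a b : motion W N p x a b -> (1 <= N)%nat.
Proof.
  intros H. destruct N; [|lia]. assert (H0 := mo_left H a).
  assert (H1 := mo_right H a). lra.
Qed.

Lemma motion_nonneg W N p x a b : motion W N p x a b ->
  forall t i, a <= t <= b -> is_face N i -> 0 <= len (fun j => x j t) i.
Proof.
  intros H t i [Ht [Hb| ->]] Hi.
  - apply Rlt_le, (mo_pos H); auto.
  - apply (mo_end H), Hi.
Qed.

Lemma corners_monotone N (x : nat -> R) i j :
  (forall i, is_face N i -> 0 <= len x i) -> (i <= j <= N)%nat -> x i <= x j.
Proof.
  intros H [Hij Hj]. induction Hij as [|j Hij IH]; [lra|].
  specialize (H (S j)). unfold is_face, len in H.
  specialize (H ltac:(lia)). replace (S j - 1)%nat with j in H by lia.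
  specialize (IH ltac:(lia)). lra.
Qed.

Lemma len_continuous W N p x a b i t : motion W N p x a b -> is_face N i ->
  continuous (fun s => len (fun j => x j s) i) t.
Proof.
  intros H Hi. unfold is_face in Hi. unfold len.
  apply continuous_Rminus;
  apply (mo_cont H); lia.
Qed.

Lemma velocity_ends W N p x i : i = 1%nat \/ i = N -> velocity W N p x i = 0.
Proof.
  intros H. unfold velocity.
  replace (orb (Nat.eqb i 1) (Nat.eqb i N)) with true; [reflexivity|].
  symmetry. apply Bool.orb_true_iff. rewrite !Nat.eqb_eq. exact H.
Qed.

Lemma velocity_inner W N p x i : (1 < i < N)%nat ->
  velocity W N p x i = sqrt (1 + p i ^ 2) * (Defs.Delta W p i / len x i).
Proof.
  intros H. unfold velocity.
  replace (orb (Nat.eqb i 1) (Nat.eqb i N)) with false; [reflexivity|].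
  symmetry. apply Bool.orb_false_iff. rewrite !Nat.eqb_neq. lia.
Qed.

(** The line carrying face [i] meets the vertical axis at height
    [- intercept p x i t], since the graph starts at the origin. *)
Definition intercept (p : nat -> R) (x : nat -> R -> R) (i : nat) (t : R) : R :=
  sum1 (fun l => (p (l + 1)%nat - p l) * x l t) (i - 1).

Lemma intercept_S p x i t : (1 <= i)%nat ->
  intercept p x (S i) t = intercept p x i t + (p (i + 1)%nat - p i) * x i t.
Proof.
  intros Hi. unfold intercept. destruct i as [|i]; [lia|].
  replace (S (S i) - 1)%nat with (S i) by lia.
  replace (S i - 1)%nat with i by lia. reflexivity.
Qed.

(** Face [i] therefore moves with its prescribed velocity. *)
Lemma intercept_derive W N p x a b i t : motion W N p x a b ->
  (forall i, (1 <= i < N)%nat -> p i <> p (i + 1)%nat) ->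
  a < t < b -> is_face N i ->
  is_derive (intercept p x i) t (- velocity W N p (fun j => x j t) i).
Proof.
  intros H Hp Ht Hi. unfold is_face in Hi.
  set (v := velocity W N p (fun j => x j t)).
  assert (E : forall n, (n < N)%nat ->
    sum1 (fun l => (p (l + 1)%nat - p l) *
      (- ((v (l + 1)%nat - v l) / (p (l + 1)%nat - p l)))) n = - v (S n)).
  { induction n as [|n IH]; intros Hn.
    - simpl. unfold v. rewrite velocity_ends by auto. ring.
    - cbn [sum1]. rewrite IH by lia.
      replace (S n + 1)%nat with (S (S n)) by lia.
      assert (Hne := Hp (S n) ltac:(lia)).
      replace (S n + 1)%nat with (S (S n)) in Hne by lia. field. lra. }
  specialize (E (i - 1)%nat ltac:(lia)).
  replace (S (i - 1)) with i in E by lia. rewrite <- E.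
  apply (sum1_is_derive (fun l s => (p (l + 1)%nat - p l) * x l s)).
  intros l Hl. apply (is_derive_scal (x l)). apply (mo_der H); [exact Ht|lia].
Qed.

Lemma intercept_continuous W N p x a b i t : motion W N p x a b -> is_face N i ->
  continuous (intercept p x i) t.
Proof.
  intros H Hi. unfold is_face in Hi.
  apply (sum1_continuous (fun l s => (p (l + 1)%nat - p l) * x l s)).
  intros l Hl. apply (continuous_scal_r (V := R_NormedModule) _ (x l)).
  apply (mo_cont H). lia.
Qed.

Lemma nearest_below (P : nat -> Prop) j i : (j < i)%nat -> P j -> ~ P i ->
  exists l, (j <= l < i)%nat /\ P l /\ forall k, (l < k <= i)%nat -> ~ P k.
Proof.
  induction 1 as [|i Hji IH]; intros Hj Hi.
  - exists j. split; [lia|]. split; [exact Hj|].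
    intros k Hk. replace k with (S j) by lia. exact Hi.
  - destruct (classic (P i)) as [Pi|Ni].
    + exists i. split; [lia|]. split; [exact Pi|].
      intros k Hk. replace k with (S i) by lia. exact Hi.
    + destruct (IH Hj Ni) as (l & H1 & H2 & H3).
      exists l. split; [lia|]. split; [exact H2|]. intros k Hk.
      destruct (Nat.eq_dec k (S i)) as [->|N]; [exact Hi|apply H3; lia].
Qed.

Lemma nearest_above (P : nat -> Prop) i j : (i < j)%nat -> P j -> ~ P i ->
  exists l, (i < l <= j)%nat /\ P l /\ forall k, (i <= k < l)%nat -> ~ P k.
Proof.
  intros Hij Hj Hi.
  destruct (nearest_below (fun n => P (j + i - n)%nat) i j) as (l & H1 & H2 & H3).
  - exact Hij.
  - replace (j + i - i)%nat with j by lia. exact Hj.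
  - replace (j + i - j)%nat with i by lia. exact Hi.
  - exists (j + i - l)%nat. split; [lia|]. split; [exact H2|]. intros k Hk.
    replace k with (j + i - (j + i - k))%nat by lia. apply H3. lia.
Qed.

Lemma velocity_bounded_near W N p x a b i : motion W N p x a b -> is_face N i ->
  0 < len (fun j => x j b) i ->
  exists M d, 0 <= M /\ 0 < d /\ forall t, b - d < t < b ->
    Rabs (velocity W N p (fun j => x j t) i) <= M.
Proof.
  intros H Hi Hl.
  destruct (classic (i = 1%nat \/ i = N)) as [E|E].
  - exists 0, 1. split; [lra|]. split; [lra|]. intros t _.
    rewrite velocity_ends by exact E. rewrite Rabs_R0. lra.
  - set (l := fun t => len (fun j => x j t) i).
    destruct (proj1 (continuous_eps l b) (len_continuous _ _ _ _ _ _ _ b H Hi) (l b / 2))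
      as (d & Hd & Hy).
    { unfold l. lra. }
    exists (sqrt (1 + p i ^ 2) * (Rabs (Defs.Delta W p i) / (l b / 2))), d.
    assert (Hs := sqrt1_ge1 (p i)). assert (HD := Rabs_pos (Defs.Delta W p i)).
    fold (l b) in Hl.
    assert (Hq : 0 <= Rabs (Defs.Delta W p i) / (l b / 2)) by (apply Rdiv_le_0_compat; lra).
    split; [nra|]. split; [exact Hd|]. intros t Ht.
    assert (Hlt : l b / 2 < l t).
    { specialize (Hy t). rewrite Rabs_left in Hy by lra. specialize (Hy ltac:(lra)).
      apply Rabs_def2 in Hy. lra. }
    rewrite velocity_inner by (unfold is_face in Hi; lia). fold (l t).
    rewrite Rabs_mult, (Rabs_right (sqrt _)) by lra.
    apply Rmult_le_compat_l; [lra|]. unfold Rdiv at 1.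
    rewrite Rabs_mult. apply Rmult_le_compat_l; [exact HD|].
    rewrite Rabs_inv, Rabs_right by lra. apply Rinv_le_contravar; lra.
Qed.

(** The numerator of the velocity of an inner face is a positive multiple of
    the second difference of the slopes. *)
Definition convex_law (W : R -> R) (N : nat) (p : nat -> R) : Prop :=
  forall i, (1 < i < N)%nat ->
    flanking (p (i - 1)%nat) (p i) (p (i + 1)%nat) /\
    exists theta, 0 < theta /\
      Defs.Delta W p i = theta * ((p (i + 1)%nat - p (i - 1)%nat) / 2).

(** The velocity of an inner face drives each of its two corners away from
    the face, or leaves it at rest. *)
Lemma velocity_sign W N p x i : convex_law W N p -> (1 < i < N)%nat -> 0 < len x i ->
  0 <= velocity W N p x i / (p i - p (i - 1)%nat) /\
  0 <= velocity W N p x i / (p (i + 1)%nat - p i).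
Proof.
  intros HC Hi Hl. destruct (HC i Hi) as [(N1 & N2 & Hf) (th & Hth & E)].
  rewrite velocity_inner by exact Hi. rewrite E.
  assert (Hs := sqrt1_ge1 (p i)). set (s := sqrt _) in *.
  assert (Hsl : 0 < s / len x i) by (apply Rdiv_lt_0_compat; lra).
  set (o := p (i - 1)%nat) in *. set (q := p i) in *. set (r := p (i + 1)%nat) in *.
  destruct Hf as [Hf|Hf].
  - assert (Hg : forall e, e <> 0 -> 0 <= (r - o) * e -> 0 <= s * (th * ((r - o) / 2) / len x i) / e).
    { intros e He Hre.
      replace (s * (th * ((r - o) / 2) / len x i) / e) with
        (s / len x i * th / 2 * (((r - o) * e) * / (e * e))) by (field; lra).
      assert (0 < / (e * e)) by (apply Rinv_0_lt_compat; nra).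
      apply Rmult_le_pos; [nra|]. apply Rmult_le_pos; lra. }
    split; apply Hg; try lra; nra.
  - rewrite Hf. replace (s * (th * ((r - r) / 2) / len x i)) with 0 by (field; lra).
    unfold Rdiv. rewrite !Rmult_0_l. lra.
Qed.

(** A face that vanishes between two persistent ones is flat.  Consider the
    maximal block of vanishing faces around it.  The faces bounding the block
    have bounded velocity and the extreme faces of the block push outwards,
    so the block lies within [C (b - t)] of its limit point, and so do the heights
    of its faces.  The velocity of a face with non-zero jump would however
    be at least a multiple of the inverse of its length, hence unbounded. *)
Lemma vanishing_face_flat W N p x a b i j k :
  motion W N p x a b -> convex_law W N p ->
  (forall i, (1 <= i < N)%nat -> p i <> p (i + 1)%nat) ->
  (1 <= j < i)%nat -> (i < k <= N)%nat ->
  0 < len (fun n => x n b) j -> 0 < len (fun n => x n b) k ->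
  len (fun n => x n b) i <= 0 -> p (i - 1)%nat = p (i + 1)%nat.
Proof.
  intros HM HC Hp Hj Hk Lj Lk Li.
  destruct (nearest_below (fun n => 0 < len (fun n => x n b) n) j i)
    as (A & HA & LA & ZA); [lia|exact Lj|lra|].
  destruct (nearest_above (fun n => 0 < len (fun n => x n b) n) i k)
    as (B & HB & LB & ZB); [lia|exact Lk|lra|].
  assert (Hi : (1 < i < N)%nat) by lia.
  assert (HA' : (1 <= A < i)%nat) by lia.
  assert (HB' : exists B', B = (B' + 1)%nat) by (exists (B - 1)%nat; lia).
  destruct HB' as [D ->].
  assert (HD : (i <= D < N)%nat) by lia.
  assert (Z : forall n, (A < n <= D)%nat -> len (fun n => x n b) n = 0).
  { intros n Hn.
    assert (H1 := mo_end HM n ltac:(unfold is_face; lia)).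
    assert (H2 : ~ 0 < len (fun n => x n b) n).
    { destruct (le_lt_dec n i); [apply ZA|apply ZB]; lia. }
    lra. }
  clear j k Hj Hk Lj Lk Li ZA ZB HA HB.
  apply NNPP. intros Hne.
  set (v := fun n t => velocity W N p (fun m => x m t) n).
  set (X := x A b).
  assert (HX : forall n, (A <= n <= D)%nat -> x n b = X).
  { intros n [H1 H2]. induction H1 as [|n H1 IH]; [reflexivity|].
    rewrite <- IH by lia. specialize (Z (S n) ltac:(lia)). unfold len in Z.
    replace (S n - 1)%nat with n in Z by lia. lra. }
  assert (Hlen : forall t n, a < t < b -> is_face N n -> 0 < len (fun m => x m t) n).
  { intros t n Ht Hn. apply (mo_pos HM); [lra|exact Hn]. }
  destruct (velocity_bounded_near W N p x a b A HM ltac:(unfold is_face; lia) LA)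
    as (M1 & d1 & HM1 & Hd1 & Hv1).
  destruct (velocity_bounded_near W N p x a b (D + 1) HM ltac:(unfold is_face; lia) LB)
    as (M2 & d2 & HM2 & Hd2 & Hv2).
  set (eA := p (A + 1)%nat - p A). set (eD := p (D + 1)%nat - p D).
  assert (HeA : eA <> 0).
  { assert (H := Hp A ltac:(lia)). unfold eA. lra. }
  assert (HeD : eD <> 0).
  { assert (H := Hp D ltac:(lia)). unfold eD. lra. }
  set (C := M1 / Rabs eA + M2 / Rabs eD).
  assert (HC1 : 0 <= M1 / Rabs eA) by (apply Rdiv_le_0_compat; [lra|apply Rabs_pos_lt, HeA]).
  assert (HC2 : 0 <= M2 / Rabs eD) by (apply Rdiv_le_0_compat; [lra|apply Rabs_pos_lt, HeD]).
  assert (Hquot : forall w M e, e <> 0 -> Rabs w <= M -> - (M / Rabs e) <= w / e <= M / Rabs e).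
  { intros w M e He Hw. apply Rabs_le_between. unfold Rdiv. rewrite Rabs_mult, Rabs_inv.
    apply Rmult_le_compat_r; [|exact Hw]. apply Rlt_le, Rinv_0_lt_compat, Rabs_pos_lt, He. }
  assert (Hab := mo_time HM).
  set (d := Rmin (b - a) (Rmin d1 d2)).
  assert (Hdab := Rmin_l (b - a) (Rmin d1 d2)). fold d in Hdab.
  assert (Hd12 := Rmin_r (b - a) (Rmin d1 d2)). fold d in Hd12.
  assert (Hdd1 := Rmin_l d1 d2). assert (Hdd2 := Rmin_r d1 d2).
  assert (Hd : 0 < d) by (repeat apply Rmin_pos; lra).
  assert (Hleft : forall t, b - d < t < b -> X - x A t <= C * (b - t)).
  { intros t Ht.
    destruct (mean_value (x A)
      (fun s => - ((v (A + 1)%nat s - v A s) / (p (A + 1)%nat - p A))) t b) as (c & Hc & E).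
    - lra.
    - intros s Hs. apply (mo_der HM); [lra|lia].
    - intros s _. apply (mo_cont HM). lia.
    - fold X in E. rewrite E. apply Rmult_le_compat_r; [lra|]. fold eA.
      assert (H1 := Hquot _ _ eA HeA (Hv1 c ltac:(lra))). fold (v A c) in H1.
      assert (H2 := proj1 (velocity_sign W N p (fun m => x m c) (A + 1) HC ltac:(lia)
        (Hlen c (A + 1)%nat ltac:(lra) ltac:(unfold is_face; lia)))).
      replace (A + 1 - 1)%nat with A in H2 by lia. fold (v (A + 1)%nat c) eA in H2.
      replace ((v (A + 1)%nat c - v A c) / eA) with (v (A + 1)%nat c / eA - v A c / eA)
        by (field; exact HeA).
      unfold C. lra. }
  assert (Hright : forall t, b - d < t < b -> x D t - X <= C * (b - t)).
  { intros t Ht.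
    destruct (mean_value (x D)
      (fun s => - ((v (D + 1)%nat s - v D s) / (p (D + 1)%nat - p D))) t b) as (c & Hc & E).
    - lra.
    - intros s Hs. apply (mo_der HM); [lra|lia].
    - intros s _. apply (mo_cont HM). lia.
    - rewrite HX in E by lia. fold eD in E.
      assert (H1 := Hquot _ _ eD HeD (Hv2 c ltac:(lra))). fold (v (D + 1)%nat c) in H1.
      assert (H2 := proj2 (velocity_sign W N p (fun m => x m c) D HC ltac:(lia)
        (Hlen c D ltac:(lra) ltac:(unfold is_face; lia)))).
      fold (v D c) eD in H2.
      replace ((v (D + 1)%nat c - v D c) / eD) with (v (D + 1)%nat c / eD - v D c / eD)
        in E by (field; exact HeD).
      assert (- C <= - (v (D + 1)%nat c / eD - v D c / eD)) by (unfold C; lra).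
      nra. }
  assert (Hclose : forall t n, b - d < t < b -> (A <= n <= D)%nat ->
    Rabs (x n t - X) <= C * (b - t)).
  { intros t n Ht Hn. apply Rabs_le.
    assert (Hmon : forall l, is_face N l -> 0 <= len (fun m => x m t) l).
    { intros l Hl. apply Rlt_le, Hlen; [lra|exact Hl]. }
    assert (H1 := corners_monotone N (fun m => x m t) A n Hmon ltac:(lia)).
    assert (H2 := corners_monotone N (fun m => x m t) n D Hmon ltac:(lia)).
    simpl in H1, H2. specialize (Hleft t Ht). specialize (Hright t Ht). lra. }
  set (I := intercept p x).
  set (S0 := sum1 (fun l => Rabs (p (l + 1)%nat - p l)) (i - 1)).
  assert (Hint : forall t, b - d < t < b ->
    Rabs ((I i b - I A b) - (I i t - I A t)) <= S0 * (C * (b - t))).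
  { intros t Ht.
    assert (Hn : forall n, (A <= n)%nat -> (n <= i)%nat ->
      Rabs ((I n b - I A b) - (I n t - I A t)) <=
      sum1 (fun l => Rabs (p (l + 1)%nat - p l)) (n - 1) * (C * (b - t))).
    { induction 1 as [|n Hn IH]; intros Hni.
      - replace (I A b - I A b - (I A t - I A t)) with 0 by ring. rewrite Rabs_R0.
        apply Rmult_le_pos; [|unfold C; nra].
        generalize (A - 1)%nat. intros k. induction k as [|k IHk]; simpl; [lra|].
        assert (H := Rabs_pos (p (S (k + 1)) - p (S k))). lra.
      - specialize (IH ltac:(lia)). unfold I. rewrite !(intercept_S p x n) by lia. fold I.
        replace (S n - 1)%nat with (S (n - 1)) by lia. cbn [sum1].
        replace (S (n - 1)) with n by lia.
        rewrite HX by lia. specialize (Hclose t n Ht ltac:(lia)).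
        replace (I n b + (p (n + 1)%nat - p n) * X - I A b - (I n t + (p (n + 1)%nat - p n) * x n t - I A t))
          with ((I n b - I A b - (I n t - I A t)) + (p (n + 1)%nat - p n) * - (x n t - X)) by ring.
        eapply Rle_trans; [apply Rabs_triang|]. rewrite Rmult_plus_distr_r.
        apply Rplus_le_compat; [exact IH|]. rewrite Rabs_mult, Rabs_Ropp.
        apply Rmult_le_compat_l; [apply Rabs_pos|exact Hclose]. }
    apply Hn; lia. }
  assert (HIA : forall t, b - d < t < b -> Rabs (I A b - I A t) <= M1 * (b - t)).
  { intros t Ht. apply (lipschitz_of_derive (I A) (fun s => - v A s) t b M1).
    - lra.
    - intros s Hs. apply (intercept_derive W N p x a b); auto; [lra|unfold is_face; lia].
    - intros s _. apply (intercept_continuous W N p x a b A s HM). unfold is_face; lia.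
    - intros s Hs. rewrite Rabs_Ropp. apply Hv1. lra. }
  (* the speed required of face [i] exceeds any bound as its length vanishes *)
  set (K := S0 * C + M1).
  destruct (HC i Hi) as [_ (th & Hth & EDelta)].
  assert (HDelta : Defs.Delta W p i <> 0) by (rewrite EDelta; nra).
  apply Rabs_pos_lt in HDelta.
  set (l := fun t => len (fun m => x m t) i).
  assert (Hlb : l b = 0) by (apply Z; lia).
  assert (HK : 0 < Rabs K + 1) by (assert (H := Rabs_pos K); lra).
  destruct (proj1 (continuous_eps l b)
    (len_continuous W N p x a b i b HM ltac:(unfold is_face; lia))
    (Rabs (Defs.Delta W p i) / (Rabs K + 1))) as (d3 & Hd3 & Hl3).
  { apply Rdiv_lt_0_compat; lra. }
  set (t := b - Rmin d d3 / 2).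
  assert (Hm1 := Rmin_l d d3). assert (Hm2 := Rmin_r d d3).
  assert (Hm0 : 0 < Rmin d d3) by (apply Rmin_pos; lra).
  assert (Ht : b - d < t < b) by (unfold t; lra).
  destruct (mean_value (I i) (fun s => - v i s) t b) as (c & Hc & E).
  - lra.
  - intros s Hs. apply (intercept_derive W N p x a b); auto; [lra|unfold is_face; lia].
  - intros s _. apply (intercept_continuous W N p x a b i s HM). unfold is_face; lia.
  - assert (Hsmall : Rabs (I i b - I i t) <= K * (b - t)).
    { replace (I i b - I i t) with ((I i b - I A b - (I i t - I A t)) + (I A b - I A t)) by ring.
      eapply Rle_trans; [apply Rabs_triang|]. specialize (Hint t Ht). specialize (HIA t Ht).
      unfold K. lra. }
    rewrite E, Rabs_mult, Rabs_Ropp, (Rabs_right (b - t)) in Hsmall by lra.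
    apply Rmult_le_reg_r in Hsmall; [|lra].
    assert (Hlc : 0 < l c) by (apply Hlen; [lra|unfold is_face; lia]).
    assert (Hlc2 : l c < Rabs (Defs.Delta W p i) / (Rabs K + 1)).
    { specialize (Hl3 c). rewrite Hlb in Hl3. rewrite (Rabs_left (c - b)) in Hl3 by lra.
      assert (Hx : - (c - b) < d3) by (unfold t in Hc; lra). specialize (Hl3 Hx).
      rewrite Rminus_0_r, Rabs_right in Hl3; lra. }
    assert (Hbig : Rabs K + 1 < Rabs (Defs.Delta W p i) / l c).
    { apply Rmult_lt_reg_r with (l c); [exact Hlc|].
      unfold Rdiv at 1. rewrite Rmult_assoc, Rinv_l, Rmult_1_r by lra.
      apply Rmult_lt_compat_l with (r := Rabs K + 1) in Hlc2; [|exact HK].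
      replace ((Rabs K + 1) * (Rabs (Defs.Delta W p i) / (Rabs K + 1)))
        with (Rabs (Defs.Delta W p i)) in Hlc2 by (field; lra). lra. }
    unfold v in Hsmall. rewrite velocity_inner in Hsmall by exact Hi. fold (l c) in Hsmall.
    unfold Rdiv at 1 in Hsmall. rewrite !Rabs_mult, Rabs_inv in Hsmall.
    rewrite (Rabs_right (l c)), (Rabs_right (sqrt _)) in Hsmall
      by (try lra; assert (H := sqrt1_ge1 (p i)); lra).
    assert (H1 := sqrt1_ge1 (p i)). assert (H2 := Rle_abs K).
    unfold Rdiv in Hbig. nra.
Qed.

(** * The smooth solution *)

(** The solution with those of its partial derivatives that are needed, all
    of them extended continuously to the plane; the differential relations
    hold on the rectangle only, where they are two-sided. *)
Record solution (W : R -> R) (T : R) (u ux ut uxx uxt utx : R -> R -> R) : Prop := {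
  so_time : 0 < T;
  so_u : cont2 u;
  so_ux : cont2 ux;
  so_ut : cont2 ut;
  so_uxx : cont2 uxx;
  so_uxt : cont2 uxt;
  so_utx : cont2 utx;
  so_du_dx : forall x t, 0 < x < 1 -> 0 <= t <= T -> is_derive (fun y => u y t) x (ux x t);
  so_du_dt : forall x t, 0 <= x <= 1 -> 0 < t < T -> is_derive (fun s => u x s) t (ut x t);
  so_dux_dx : forall x t, 0 < x < 1 -> 0 <= t <= T -> is_derive (fun y => ux y t) x (uxx x t);
  so_dux_dt : forall x t, 0 <= x <= 1 -> 0 < t < T -> is_derive (fun s => ux x s) t (uxt x t);
  so_dut_dx : forall x t, 0 < x < 1 -> 0 <= t <= T -> is_derive (fun y => ut y t) x (utx x t);
  so_pde : forall x t, 0 <= x <= 1 -> 0 <= t <= T ->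
    ut x t = mobility W (ux x t) * uxx x t;
  so_bc : forall t, 0 <= t <= T -> u 0 t = 0 /\ u 1 t = 0
}.
Arguments so_time {_ _ _ _ _ _ _ _} _.
Arguments so_u {_ _ _ _ _ _ _ _} _.
Arguments so_ux {_ _ _ _ _ _ _ _} _.
Arguments so_ut {_ _ _ _ _ _ _ _} _.
Arguments so_uxx {_ _ _ _ _ _ _ _} _.
Arguments so_uxt {_ _ _ _ _ _ _ _} _.
Arguments so_utx {_ _ _ _ _ _ _ _} _.
Arguments so_du_dx {_ _ _ _ _ _ _ _} _.
Arguments so_du_dt {_ _ _ _ _ _ _ _} _.
Arguments so_dux_dx {_ _ _ _ _ _ _ _} _.
Arguments so_dux_dt {_ _ _ _ _ _ _ _} _.
Arguments so_dut_dx {_ _ _ _ _ _ _ _} _.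
Arguments so_pde {_ _ _ _ _ _ _ _} _.
Arguments so_bc {_ _ _ _ _ _ _ _} _.

Lemma ex_RInt_cont (f : R -> R) a b : (forall x, continuous f x) -> ex_RInt f a b.
Proof.
  intros H. apply (ex_RInt_continuous (V := R_CompleteNormedModule)). intros; apply H.
Qed.

Lemma is_derive_unique_R (f : R -> R) x l l' :
  is_derive f x l -> is_derive f x l' -> l = l'.
Proof. intros H H'. rewrite <- (is_derive_unique f x l H). apply is_derive_unique, H'. Qed.

Lemma is_derive_eq (f : R -> R) x (l l' : R) : is_derive f x l -> l = l' -> is_derive f x l'.
Proof. intros H <-. exact H. Qed.

(** Differentiation under the integral sign over an interval on whose closure
    the integrand is differentiable in the parameter. *)
Lemma RInt_param_derive (f df : R -> R -> R) T x t : 0 <= x <= 1 -> 0 < t < T ->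
  cont2 f -> cont2 df ->
  (forall y s, 0 <= y <= 1 -> 0 < s < T -> is_derive (fun r => f y r) s (df y s)) ->
  is_derive (fun s => RInt (fun y => f y s) 0 x) t (RInt (fun y => df y t) 0 x).
Proof.
  intros Hx Ht Hf Hdf Hd.
  set (g := fun s y => f (clamp 0 1 y) s).
  assert (Hg : forall y s, 0 < s < T -> is_derive (fun r => g r y) s (df (clamp 0 1 y) s)).
  { intros y s Hs. apply Hd; [apply clamp_in; lra|exact Hs]. }
  assert (Hloc := proj1 (locally_Rabs _ t) (locally_between 0 T t Ht)).
  destruct Hloc as (d & Hd0 & Hloc).
  assert (E : forall h : R -> R, RInt (fun y => h (clamp 0 1 y)) 0 x = RInt h 0 x).
  { intros h. apply RInt_ext. intros y Hy.
    rewrite Rmin_left, Rmax_right in Hy by lra. rewrite clamp_id by lra. reflexivity. }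
  apply (is_derive_ext (fun s => RInt (fun y => g s y) 0 x)).
  { intros s. apply (E (fun y => f y s)). }
  replace (RInt (fun y => df y t) 0 x) with
    (RInt (fun y => Derive (fun s => g s y) t) 0 x).
  2:{ rewrite <- (E (fun y => df y t)). apply RInt_ext. intros y _.
      apply is_derive_unique, Hg, Ht. }
  apply is_derive_RInt_param.
  - apply locally_Rabs. exists d. split; [exact Hd0|]. intros s Hs y _.
    exists (df (clamp 0 1 y) s). apply Hg, Hloc, Hs.
  - intros y _. apply continuity_2d_pt_ext_loc with (fun s z => df (clamp 0 1 z) s).
    + exists (mkposreal d Hd0). intros s z Hs _. symmetry.
      apply is_derive_unique, Hg, Hloc, Hs.
    + apply continuity_2d_pt_filterlim.
      apply (continuous_comp_2 (fun z : R * R => clamp 0 1 (snd z)) (fun z : R * R => fst z)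
        (fun a b => df a b) (t, y)).
      * apply (continuous_comp (fun z : R * R => snd z) (clamp 0 1)).
        apply continuous_snd. apply clamp_continuous.
      * apply continuous_fst.
      * apply continuity_2d_pt_filterlim, Hdf.
  - apply locally_Rabs. exists d. split; [exact Hd0|]. intros s Hs. apply ex_RInt_cont.
    intros z. apply (cont2_comp f (clamp 0 1) (fun _ => s)); auto.
    apply clamp_continuous. apply continuous_const.
Qed.

Lemma is_derive_RInt_right (f : R -> R) a x : (forall y, continuous f y) ->
  is_derive (fun y => RInt f a y) x (f x).
Proof.
  intros H. apply (is_derive_RInt f (fun y => RInt f a y) a x).
  - apply locally_Rabs. exists 1. split; [lra|]. intros y _.
    apply (RInt_correct (V := R_CompleteNormedModule)), ex_RInt_cont, H.
  - apply H.
Qed.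

Section Solution.
Context (W : R -> R) (T : R) (u ux ut uxx uxt utx : R -> R -> R)
  (Hsol : solution W T u ux ut uxx uxt utx).

Lemma so_u_RInt x t : 0 <= x <= 1 -> 0 <= t <= T -> u x t = RInt (fun y => ux y t) 0 x.
Proof.
  intros Hx Ht. rewrite (RInt_of_derive (fun y => u y t) (fun y => ux y t)).
  - rewrite (proj1 (so_bc Hsol t Ht)). ring.
  - lra.
  - intros y Hy. apply (so_du_dx Hsol); lra.
  - intros y _. apply cont2_fst, (so_u Hsol).
  - intros y. apply cont2_fst, (so_ux Hsol).
Qed.

Lemma so_ut_bc t : 0 <= t <= T -> ut 0 t = 0 /\ ut 1 t = 0.
Proof.
  assert (HT := so_time Hsol).
  assert (Hin : forall x s, x = 0 \/ x = 1 -> 0 < s < T -> ut x s = 0).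
  { intros x s Hx Hs. apply (is_derive_unique_R (fun r => u x r) s).
    - apply (so_du_dt Hsol); [|exact Hs]. destruct Hx; subst; lra.
    - apply (is_derive_ext_loc (fun _ => 0)).
      + destruct (proj1 (locally_Rabs _ s) (locally_between 0 T s Hs)) as (d & Hd & Hl).
        apply locally_Rabs. exists d. split; [exact Hd|]. intros r Hr.
        specialize (Hl r Hr). destruct (so_bc Hsol r) as [H0 H1]; [lra|].
        destruct Hx; subst; auto.
      + apply (is_derive_const (V := R_NormedModule)). }
  intros Ht.
  assert (Hall : forall x, x = 0 \/ x = 1 -> ut x t = 0).
  { intros x Hx. apply NNPP. intros Hne.
    assert (Hp := Rabs_pos_lt _ Hne).
    destruct (proj1 (continuous_eps (fun s => ut x s) t)
      (cont2_snd ut t x (so_ut Hsol)) _ Hp) as (d & Hd & Hy).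
    set (r := Rmin (d / 2) (T / 2)).
    assert (H1 := Rmin_l (d / 2) (T / 2)). assert (H2 := Rmin_r (d / 2) (T / 2)).
    assert (H3 : 0 < r) by (apply Rmin_pos; lra). fold r in H1, H2.
    destruct (Rle_lt_dec t (T / 2)) as [L|L].
    - specialize (Hy (t + r / 2)). rewrite Hin in Hy by (auto; lra).
      replace (t + r / 2 - t) with (r / 2) in Hy by ring.
      rewrite (Rabs_right (r / 2)) in Hy by lra. specialize (Hy ltac:(lra)).
      rewrite Rminus_0_l, Rabs_Ropp in Hy. lra.
    - specialize (Hy (t - r / 2)). rewrite Hin in Hy by (auto; lra).
      replace (t - r / 2 - t) with (- (r / 2)) in Hy by ring.
      rewrite Rabs_Ropp, (Rabs_right (r / 2)) in Hy by lra. specialize (Hy ltac:(lra)).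
      rewrite Rminus_0_l, Rabs_Ropp in Hy. lra. }
  split; apply Hall; auto.
Qed.

(** The mixed derivatives agree, in integrated form. *)
Lemma so_ut_RInt x t : 0 <= x <= 1 -> 0 < t < T -> ut x t = RInt (fun y => uxt y t) 0 x.
Proof.
  intros Hx Ht. apply (is_derive_unique_R (fun s => u x s) t).
  - apply (so_du_dt Hsol); assumption.
  - apply (is_derive_ext_loc (fun s => RInt (fun y => ux y s) 0 x)).
    + destruct (proj1 (locally_Rabs _ t) (locally_between 0 T t Ht)) as (d & Hd & Hl).
      apply locally_Rabs. exists d. split; [exact Hd|]. intros s Hs. symmetry.
      specialize (Hl s Hs). apply so_u_RInt; lra.
    + apply (RInt_param_derive ux uxt T); auto.
      * apply (so_ux Hsol).
      * apply (so_uxt Hsol).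
      * apply (so_dux_dt Hsol).
Qed.

Definition dirichlet_energy (t : R) : R := / 2 * RInt (fun y => ux y t ^ 2) 0 1.

Lemma dirichlet_energy_derive t : 0 < t < T ->
  is_derive dirichlet_energy t (- RInt (fun y => uxx y t * ut y t) 0 1).
Proof.
  intros Ht.
  assert (HD : is_derive (fun s => RInt (fun y => ux y s ^ 2) 0 1) t
                 (RInt (fun y => 2 * (ux y t * uxt y t)) 0 1)).
  { apply (RInt_param_derive (fun y s => ux y s ^ 2) (fun y s => 2 * (ux y s * uxt y s)) T).
    - lra.
    - exact Ht.
    - intros x y. apply continuity_2d_pt_ext with (fun x y => ux x y * ux x y).
      { intros; ring. }
      apply cont2_mult; apply (so_ux Hsol).
    - apply cont2_mult; [intros x y; apply continuity_2d_pt_const|].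
      apply cont2_mult; [apply (so_ux Hsol)|apply (so_uxt Hsol)].
    - intros y s Hy Hs.
      assert (Hux := so_dux_dt Hsol y s Hy Hs).
      apply (is_derive_ext (fun r => ux y r * ux y r)).
      { intros r. simpl. rewrite Rmult_1_r. reflexivity. }
      apply is_derive_eq with (uxt y s * ux y s + ux y s * uxt y s); [|ring].
      apply (is_derive_mult (fun r => ux y r) (fun r => ux y r)); auto.
      intros; apply Rmult_comm. }
  assert (HP : RInt (fun y => uxx y t * ut y t + ux y t * uxt y t) 0 1 = 0).
  { rewrite (RInt_of_derive (fun y => ux y t * ut y t)).
    - destruct (so_ut_bc t ltac:(lra)) as [-> ->]. rewrite !Rmult_0_r. apply Rminus_diag.
    - lra.
    - intros y Hy. apply (is_derive_mult (fun y => ux y t) (fun y => ut y t)).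
      + apply (so_dux_dx Hsol); lra.
      + apply (is_derive_ext_loc (fun z => RInt (fun w => uxt w t) 0 z)).
        * destruct (proj1 (locally_Rabs _ y) (locally_between 0 1 y Hy)) as (d & Hd & Hl).
          apply locally_Rabs. exists d. split; [exact Hd|]. intros z Hz. symmetry.
          specialize (Hl z Hz). apply so_ut_RInt; [lra|exact Ht].
        * apply (is_derive_RInt_right (fun w => uxt w t)).
          intros z. apply cont2_fst, (so_uxt Hsol).
      + intros; apply Rmult_comm.
    - intros y _. apply continuous_Rmult;
      apply cont2_fst; [apply (so_ux Hsol)|apply (so_ut Hsol)].
    - intros y. apply continuous_Rplus.
      + apply (cont2_fst (fun y t => uxx y t * ut y t)), cont2_mult;
          [apply (so_uxx Hsol)|apply (so_ut Hsol)].
      + apply (cont2_fst (fun y t => ux y t * uxt y t)), cont2_mult;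
          [apply (so_ux Hsol)|apply (so_uxt Hsol)]. }
  assert (H1 : ex_RInt (fun y => uxx y t * ut y t) 0 1).
  { apply ex_RInt_cont. intros y.
    apply (cont2_fst (fun y t => uxx y t * ut y t)), cont2_mult;
      [apply (so_uxx Hsol)|apply (so_ut Hsol)]. }
  assert (H2 : ex_RInt (fun y => ux y t * uxt y t) 0 1).
  { apply ex_RInt_cont. intros y.
    apply (cont2_fst (fun y t => ux y t * uxt y t)), cont2_mult;
      [apply (so_ux Hsol)|apply (so_uxt Hsol)]. }
  rewrite (RInt_plus (V := R_CompleteNormedModule)) in HP by assumption.
  unfold plus in HP; simpl in HP.
  rewrite (RInt_scal (V := R_CompleteNormedModule) (fun y => ux y t * uxt y t)) in HD by exact H2.
  unfold scal in HD; simpl in HD; unfold mult in HD; simpl in HD.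
  unfold dirichlet_energy.
  replace (- RInt (fun y => uxx y t * ut y t) 0 1) with
    (/ 2 * (2 * RInt (fun y => ux y t * uxt y t) 0 1)) by lra.
  apply (is_derive_scal (fun s => RInt (fun y => ux y s ^ 2) 0 1)). exact HD.
Qed.

(** Chain rule for the value of the solution at a moving point. *)
Lemma so_chain (x : R -> R) xd t : 0 < t < T -> 0 < x t < 1 -> is_derive x t xd ->
  is_derive (fun s => u (x s) s) t (ux (x t) t * xd + ut (x t) t).
Proof.
  intros Ht Hx Hd. apply is_derive_Reals.
  replace (ux (x t) t * xd + ut (x t) t) with (ux (x t) t * xd + ut (x t) t * 1) by ring.
  apply (derivable_pt_lim_comp_2d u x (fun s => s)).
  - apply filterdiff_differentiable_pt_lim.
    apply (is_derive_filterdiff u (x t) t ux (ut (x t) t)).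
    + apply (locally_2d_locally (fun a s => is_derive (fun z => u z s) a (ux a s))).
      destruct (proj1 (locally_Rabs _ t) (locally_between 0 T t Ht)) as (d & Hd0 & Hl).
      destruct (proj1 (locally_Rabs _ (x t)) (locally_between 0 1 (x t) Hx)) as (d' & Hd0' & Hl').
      assert (Hm : 0 < Rmin d d') by (apply Rmin_pos; assumption).
      exists (mkposreal _ Hm). simpl. intros a s Ha Hs.
      assert (H1 := Rmin_l d d'). assert (H2 := Rmin_r d d').
      specialize (Hl s ltac:(lra)). specialize (Hl' a ltac:(lra)).
      apply (so_du_dx Hsol); lra.
    + apply (so_du_dt Hsol); lra.
    + apply continuity_2d_pt_filterlim, (so_ux Hsol).
  - apply is_derive_Reals, Hd.
  - apply derivable_pt_lim_id.
Qed.

End Solution.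

(** * Integrals over the faces of a piecewise linear function *)

Lemma faces_is_RInt (h : R -> R) (phi : nat -> R -> R) (x : nat -> R) n :
  (forall i, (1 <= i <= n)%nat -> x (i - 1)%nat <= x i /\
     (forall y, x (i - 1)%nat < y < x i -> h y = phi i y) /\
     forall y, continuous (phi i) y) ->
  is_RInt h (x 0%nat) (x n) (sum1 (fun i => RInt (phi i) (x (i - 1)%nat) (x i)) n).
Proof.
  induction n as [|n IH]; intros H.
  - simpl. apply (is_RInt_point (V := R_NormedModule)).
  - cbn [sum1]. apply (is_RInt_Chasles (V := R_NormedModule)) with (x n).
    + apply IH. intros i Hi. apply H. lia.
    + destruct (H (S n) ltac:(lia)) as (H1 & H2 & H3).
      replace (S n - 1)%nat with n in * by lia.
      apply (is_RInt_ext (V := R_NormedModule) (phi (S n))).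
      * intros y. rewrite Rmin_left, Rmax_right by exact H1. intros Hy. symmetry. auto.
      * apply (RInt_correct (V := R_CompleteNormedModule)), ex_RInt_cont, H3.
Qed.

Lemma faces_range f N p x i : linear_on_faces f N p x -> is_face N i ->
  0 <= x (i - 1)%nat /\ x i <= 1.
Proof.
  intros (H0 & H1 & H) Hi. unfold is_face in Hi.
  assert (Hn : forall j, is_face N j -> 0 <= len x j).
  { intros j Hj. destruct (H j Hj) as [Hx _]. unfold len. lra. }
  rewrite <- H0 at 1. rewrite <- H1. split; apply (corners_monotone N); auto; lia.
Qed.

Lemma face_derive f N p x i y : linear_on_faces f N p x -> is_face N i ->
  x (i - 1)%nat < y < x i -> is_derive f y (p i).
Proof.
  intros (_ & _ & H) Hi Hy. destruct (H i Hi) as [_ Hl].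
  apply (is_derive_ext_loc (fun z => f (x (i - 1)%nat) + p i * (z - x (i - 1)%nat))).
  - destruct (proj1 (locally_Rabs _ y) (locally_between _ _ y Hy)) as (d & Hd & Hz).
    apply locally_Rabs. exists d. split; [exact Hd|]. intros z Hzd. symmetry. apply Hl.
    specialize (Hz z Hzd). unfold Icc. lra.
  - auto_derive; auto. ring.
Qed.

(** Half the squared L^2 distance between [g] and the slopes of a piecewise
    linear function, face by face. *)
Definition slope_distance (g : R -> R) (N : nat) (p x : nat -> R) : R :=
  / 2 * sum1 (fun i => RInt (fun y => (g y - p i) ^ 2) (x (i - 1)%nat) (x i)) N.

Lemma sq_diff_continuous (g : R -> R) c y : (forall z, continuous g z) ->
  continuous (fun z => (g z - c) ^ 2) y.
Proof.
  intros Hg. apply (continuous_comp (fun z => g z - c) (fun z => z ^ 2)).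
  - apply continuous_Rminus.
    apply Hg. apply continuous_const.
  - apply (ex_derive_continuous (V := R_NormedModule)). auto_derive. auto.
Qed.

(** The a priori meaningless values of [Derive f] at the corners do not matter. *)
Lemma slope_distance_is_RInt f N p x (g g0 : R -> R) :
  linear_on_faces f N p x -> (forall y, continuous g y) ->
  (forall y, 0 <= y <= 1 -> g0 y = g y) ->
  is_RInt (fun y => (g0 y - Derive f y) ^ 2) 0 1 (2 * slope_distance g N p x).
Proof.
  intros Hf Hg H0. unfold slope_distance. rewrite <- Rmult_assoc, Rinv_r, Rmult_1_l by lra.
  destruct (Hf) as (X0 & X1 & Hl). rewrite <- X0, <- X1 at 1.
  apply (faces_is_RInt _ (fun i y => (g y - p i) ^ 2)). intros i Hi.
  destruct (Hl i Hi) as [Hx _]. split; [exact Hx|]. split.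
  - intros y Hy. destruct (faces_range f N p x i Hf Hi).
    rewrite H0 by lra. rewrite (is_derive_unique f y (p i)); [reflexivity|].
    apply (face_derive f N p x); auto.
  - intros y. apply sq_diff_continuous, Hg.
Qed.

(** Expanding the square leaves only values of a primitive at the corners,
    so that differentiation in time involves no moving domain. *)
Lemma slope_distance_expand N p x (g G : R -> R) :
  x 0%nat = 0 -> x N = 1 ->
  (forall i, is_face N i -> x (i - 1)%nat <= x i) ->
  (forall y, continuous g y) -> (forall y, continuous G y) ->
  (forall y, 0 < y < 1 -> is_derive G y (g y)) ->
  slope_distance g N p x =
    / 2 * RInt (fun y => g y ^ 2) 0 1
    - sum1 (fun i => p i * (G (x i) - G (x (i - 1)%nat))) N
    + / 2 * sum1 (fun i => p i ^ 2 * (x i - x (i - 1)%nat)) N.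
Proof.
  intros X0 X1 Hx Hg HG Hd.
  assert (Hg2 : forall y, continuous (fun y => g y ^ 2) y).
  { intros y. apply (continuous_ext (fun z => (g z - 0) ^ 2)).
    intros; simpl; ring. apply sq_diff_continuous, Hg. }
  assert (E : RInt (fun y => g y ^ 2) 0 1 =
    sum1 (fun i => RInt (fun y => g y ^ 2) (x (i - 1)%nat) (x i)) N).
  { rewrite <- X0, <- X1 at 1. apply is_RInt_unique.
    apply (faces_is_RInt _ (fun _ y => g y ^ 2)). intros i Hi. split; [apply Hx, Hi|]. auto. }
  unfold slope_distance. rewrite E.
  apply Rmult_eq_reg_l with 2; [|lra]. rewrite Rmult_plus_distr_l, Rmult_minus_distr_l.
  rewrite <- !Rmult_assoc, Rinv_r, !Rmult_1_l by lra.
  replace (sum1 (fun i => RInt (fun y => g y ^ 2) (x (i - 1)%nat) (x i)) N -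
    2 * sum1 (fun i => p i * (G (x i) - G (x (i - 1)%nat))) N +
    sum1 (fun i => p i ^ 2 * (x i - x (i - 1)%nat)) N) with
   (sum1 (fun i => RInt (fun y => g y ^ 2) (x (i - 1)%nat) (x i) +
     (-2) * (p i * (G (x i) - G (x (i - 1)%nat))) +
     p i ^ 2 * (x i - x (i - 1)%nat)) N)
   by (rewrite !sum1_plus, sum1_scal; ring).
  apply sum1_ext. intros i Hi.
  assert (Hxi := Hx i Hi).
  assert (Hlen : forall j, is_face N j -> 0 <= len x j).
  { intros j Hj. unfold len. specialize (Hx j Hj). lra. }
  assert (H0i : 0 <= x (i - 1)%nat).
  { rewrite <- X0. apply (corners_monotone N); auto; lia. }
  assert (Hi1 : x i <= 1).
  { rewrite <- X1. apply (corners_monotone N); auto; lia. }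
  set (a := x (i - 1)%nat) in *. set (b := x i) in *. set (q := p i).
  assert (EI : RInt g a b = G b - G a).
  { apply RInt_of_derive; auto. intros y Hy. apply Hd. lra. }
  assert (Hs : is_RInt (fun y => (g y - q) ^ 2) a b
    (RInt (fun y => g y ^ 2) a b + (-2) * (q * (G b - G a)) + q ^ 2 * (b - a))).
  { apply (is_RInt_ext (fun y => plus (plus (g y ^ 2) (scal (- 2 * q) (g y))) (q ^ 2))).
    - intros y _. unfold plus, scal; simpl; unfold mult; simpl. ring.
    - replace (RInt (fun y => g y ^ 2) a b + (-2) * (q * (G b - G a)) + q ^ 2 * (b - a)) with
        (plus (plus (RInt (fun y => g y ^ 2) a b) (scal (-2 * q) (RInt g a b))) (scal (b - a) (q ^ 2))).
      2:{ rewrite EI. unfold plus, scal; simpl; unfold mult; simpl. ring. }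
      apply is_RInt_Rplus; [apply is_RInt_Rplus|].
      + apply (RInt_correct (V := R_CompleteNormedModule)), ex_RInt_cont, Hg2.
      + apply (is_RInt_scal (V := R_NormedModule)).
        apply (RInt_correct (V := R_CompleteNormedModule)), ex_RInt_cont, Hg.
      + apply (is_RInt_const (V := R_NormedModule)). }
  apply is_RInt_unique, Hs.
Qed.

(** * The dissipation identity *)

(** Increment of slope across corner [i], zero at the ends of the interval. *)
Definition slope_jump (N : nat) (p : nat -> R) (i : nat) : R :=
  if orb (Nat.eqb i 0) (Nat.leb N i) then 0 else p (i + 1)%nat - p i.

Lemma slope_jump_inner N p i : (1 <= i < N)%nat -> slope_jump N p i = p (i + 1)%nat - p i.
Proof.
  intros H. unfold slope_jump.
  replace (Nat.eqb i 0) with false by (symmetry; apply Nat.eqb_neq; lia).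
  replace (Nat.leb N i) with false by (symmetry; apply Nat.leb_gt; lia). reflexivity.
Qed.

Lemma slope_jump_ends N p i : i = 0%nat \/ (N <= i)%nat -> slope_jump N p i = 0.
Proof.
  intros H. unfold slope_jump.
  replace (orb (Nat.eqb i 0) (Nat.leb N i)) with true; [reflexivity|].
  symmetry. apply Bool.orb_true_iff. rewrite Nat.eqb_eq, Nat.leb_le. exact H.
Qed.

(** Contribution of face [i] to the derivative of the distance, apart from the
    integral of [u_xx u_t]; [U] and [tau] are the values of [u_x] and [u_t] at
    the corners. *)
Definition face_term (N : nat) (p v U tau : nat -> R) (i : nat) : R :=
  v i * (U i - U (i - 1)%nat)
  - v i * ((slope_jump N p i + slope_jump N p (i - 1)) / 2)
  + / 2 * (slope_jump N p i * tau i + slope_jump N p (i - 1) * tau (i - 1)%nat).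

(** Summation by parts, from corners to faces. *)
Lemma face_terms_sum N p v U tau w xd :
  (1 <= N)%nat -> w 0%nat = 0 -> w N = 0 -> xd 0%nat = 0 -> xd N = 0 ->
  v 1%nat = 0 -> v N = 0 ->
  (forall i, (1 <= i < N)%nat -> w i = U i * xd i + tau i) ->
  (forall i, (1 <= i < N)%nat -> (p (i + 1)%nat - p i) * xd i = - (v (i + 1)%nat - v i)) ->
  - sum1 (fun i => p i * (w i - w (i - 1)%nat)) N
  + / 2 * sum1 (fun i => p i ^ 2 * (xd i - xd (i - 1)%nat)) N =
  sum1 (face_term N p v U tau) N.
Proof.
  intros HN W0 WN X0 XN V1 VN Hw Hxd.
  set (d := slope_jump N p).
  assert (Hn : forall n, (1 <= n)%nat -> (n <= N)%nat ->
    - sum1 (fun i => p i * (w i - w (i - 1)%nat)) n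
    + / 2 * sum1 (fun i => p i ^ 2 * (xd i - xd (i - 1)%nat)) n =
    sum1 (face_term N p v U tau) n +
    (- p n * w n + / 2 * p n ^ 2 * xd n - / 2 * d n * tau n - v n * U n
     + / 2 * v n * (2 * p n + d n))).
  { induction 1 as [|n Hn IH]; intros HnN.
    - cbn [sum1]. unfold face_term. fold d. replace (1 - 1)%nat with 0%nat by lia.
      rewrite W0, X0, V1. unfold d at 2 4. rewrite slope_jump_ends by auto. field.
    - specialize (IH ltac:(lia)). cbn [sum1].
      rewrite Ropp_plus_distr, Rmult_plus_distr_l.
      replace (S n - 1)%nat with n by lia. unfold face_term at 2. fold d.
      replace (S n - 1)%nat with n by lia.
      assert (E1 := Hw n ltac:(lia)). assert (E2 := Hxd n ltac:(lia)).
      assert (E3 : d n = p (n + 1)%nat - p n) by (apply slope_jump_inner; lia).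
      rewrite Nat.add_1_r in E2, E3. rewrite E3, E1 in *.
      match goal with |- - ?A + - ?B + (/ 2 * ?C + ?D) = _ =>
        replace (- A + - B + (/ 2 * C + D)) with ((- A + / 2 * C) + (- B + D)) by ring end.
      rewrite IH. apply Rminus_diag_uniq.
      transitivity ((U n - / 2 * (p n + p (S n))) * ((p (S n) - p n) * xd n + (v (S n) - v n))).
      { field. }
      rewrite E2. ring. }
  rewrite (Hn N HN (Nat.le_refl N)). rewrite WN, XN, VN.
  unfold d. rewrite slope_jump_ends by auto. ring.
Qed.

(** * The differential inequality *)

(** The quadratic form behind the estimate: replacing the factor [beta]
    of the equation by that of the face costs only a lower-order term. *)
Lemma dissipation_bound w0 K m M beta bi uxx kappa z :
  0 < w0 -> 0 <= K -> 0 <= m -> w0 <= bi -> Rabs uxx <= M ->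
  Rabs (beta - bi) <= K * (Rabs z + m) ->
  - ((uxx - kappa) * (beta * uxx - bi * kappa)) <=
    K ^ 2 * M ^ 2 / (2 * w0) * (z ^ 2 + m ^ 2).
Proof.
  intros Hw HK Hm Hbi HM Hb.
  set (s := uxx - kappa).
  set (e := (beta - bi) * uxx).
  assert (HM0 : 0 <= M) by (assert (H := Rabs_pos uxx); lra).
  assert (He : Rabs e <= K * M * (Rabs z + m)).
  { unfold e. rewrite Rabs_mult.
    apply Rle_trans with (K * (Rabs z + m) * M); [|lra].
    apply Rmult_le_compat; auto using Rabs_pos. }
  assert (He2 : e ^ 2 <= K ^ 2 * M ^ 2 * (2 * (z ^ 2 + m ^ 2))).
  { assert (Hz := Rabs_pos z). assert (H1 : e ^ 2 = Rabs e ^ 2) by (symmetry; apply pow2_abs).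
    assert (H2 : z ^ 2 = Rabs z ^ 2) by (symmetry; apply pow2_abs).
    rewrite H1, H2. apply Rle_trans with ((K * M * (Rabs z + m)) ^ 2).
    - apply pow_incr. split; [apply Rabs_pos|exact He].
    - assert (0 <= K ^ 2 * M ^ 2) by (apply Rmult_le_pos; apply pow2_ge_0).
      assert (H3 := pow2_ge_0 (Rabs z - m)).
      assert ((Rabs z + m) ^ 2 <= 2 * (Rabs z ^ 2 + m ^ 2)) by (simpl in *; lra).
      replace ((K * M * (Rabs z + m)) ^ 2) with (K ^ 2 * M ^ 2 * (Rabs z + m) ^ 2) by ring.
      apply Rmult_le_compat_l; assumption. }
  (* complete the square in [s] *)
  apply Rle_trans with (e ^ 2 / (4 * w0)).
  - replace (- (s * (beta * uxx - bi * kappa))) with (- bi * s ^ 2 - s * e)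
      by (unfold s, e; ring).
    apply Rmult_le_reg_l with (4 * w0); [lra|].
    replace (4 * w0 * (e ^ 2 / (4 * w0))) with (e ^ 2) by (field; lra).
    assert (0 <= (2 * w0 * s + e) ^ 2) by apply pow2_ge_0.
    assert (0 <= w0 * (bi - w0) * s ^ 2).
    { apply Rmult_le_pos; [nra|apply pow2_ge_0]. }
    clearbody s e. simpl in *. lra.
  - replace (K ^ 2 * M ^ 2 / (2 * w0) * (z ^ 2 + m ^ 2)) with
      (K ^ 2 * M ^ 2 * (2 * (z ^ 2 + m ^ 2)) / (4 * w0)) by (field; lra).
    apply Rmult_le_compat_r; [|exact He2]. apply Rlt_le, Rinv_0_lt_compat. lra.
Qed.

(** Uniform bounds: [M] for derivatives of the solution on the rectangle, the
    other ones for the energy on slopes up to [M + 1]. *)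
Record uniform_bounds (W : R -> R) (T : R) (ux ut uxx utx : R -> R -> R)
    (M w0 w1 L : R) : Prop := {
  ub_M : 0 < M;
  ub_ux : forall x t, 0 <= x <= 1 -> 0 <= t <= T -> Rabs (ux x t) <= M;
  ub_uxx : forall x t, 0 <= x <= 1 -> 0 <= t <= T -> Rabs (uxx x t) <= M;
  ub_utx : forall x t, 0 <= x <= 1 -> 0 <= t <= T -> Rabs (utx x t) <= M;
  ub_W : energy_bounds W (M + 1) w0 w1 L
}.
Arguments ub_M {_ _ _ _ _ _ _ _ _ _} _.
Arguments ub_ux {_ _ _ _ _ _ _ _ _ _} _.
Arguments ub_uxx {_ _ _ _ _ _ _ _ _ _} _.
Arguments ub_utx {_ _ _ _ _ _ _ _ _ _} _.
Arguments ub_W {_ _ _ _ _ _ _ _ _ _} _.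

(** Lipschitz constant of the mobility, with room for the error of the law. *)
Definition mob_const (M w1 L : R) : R := (2 + M) * L + w1.

(** Half the rate in the differential inequality. *)
Definition growth_const (M w0 w1 L : R) : R := mob_const M w1 L ^ 2 * M ^ 2 / (2 * w0).

(** Faces with slopes bounded by [M + 1], adjacent and at most [m] apart. *)
Definition good_slopes (Sl : R -> Prop) (m P : R) : nat -> (nat -> R) -> Prop :=
  linked (fun a b => adjacent Sl a b /\ Rabs (a - b) <= m) (fun a => Rabs a <= P).

Lemma good_slopes_law W Sl m P w0 w1 L N p i :
  Cn 3 W -> energy_bounds W P w0 w1 L -> good_slopes Sl m P N p -> (1 < i < N)%nat ->
  flanking (p (i - 1)%nat) (p i) (p (i + 1)%nat) /\
  exists theta, w0 <= theta /\ Rabs (theta - Derive_n W 2 (p i)) <= L * m /\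
    Defs.Delta W p i = theta * ((p (i + 1)%nat - p (i - 1)%nat) / 2).
Proof.
  intros HW HB [HQ HP] Hi.
  destruct (HQ (i - 1)%nat ltac:(lia)) as [A1 D1].
  destruct (HQ i ltac:(lia)) as [A2 D2].
  replace (S (i - 1)) with i in A1, D1 by lia.
  rewrite <- Nat.add_1_r in A2, D2.
  assert (F := adjacent_flanking _ _ _ _ A1 A2). split; [exact F|].
  apply (secant_jump W P w0 w1 L m); auto; try (apply HP; unfold is_face; lia).
  - rewrite Rabs_minus_sym. exact D1.
  - rewrite Rabs_minus_sym. exact D2.
Qed.

Lemma good_slopes_convex_law W Sl m P w0 w1 L N p :
  Cn 3 W -> energy_bounds W P w0 w1 L -> good_slopes Sl m P N p -> convex_law W N p.
Proof.
  intros HW HB HG i Hi.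
  destruct (good_slopes_law W Sl m P w0 w1 L N p i HW HB HG Hi) as [F (th & H1 & _ & H2)].
  split; [exact F|]. exists th. split; [|exact H2].
  assert (H := eb_pos HB). lra.
Qed.

Lemma good_slopes_distinct Sl m P N p i : good_slopes Sl m P N p -> (1 <= i < N)%nat ->
  p i <> p (i + 1)%nat.
Proof.
  intros [HQ _] Hi. destruct (HQ i Hi) as [(_ & _ & H & _) _].
  rewrite Nat.add_1_r. exact H.
Qed.

Lemma good_slopes_jump Sl m P N p i : 0 <= m -> good_slopes Sl m P N p ->
  Rabs (slope_jump N p i) <= m.
Proof.
  intros Hm [HQ _]. destruct (classic (1 <= i < N)%nat) as [H|H].
  - rewrite slope_jump_inner by exact H. rewrite Rabs_minus_sym, Nat.add_1_r. apply HQ, H.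
  - rewrite slope_jump_ends by lia. rewrite Rabs_R0. exact Hm.
Qed.

Section Inequality.
Context (W : R -> R) (T : R) (u ux ut uxx uxt utx : R -> R -> R)
  (Hsol : solution W T u ux ut uxx uxt utx)
  (M w0 w1 L : R) (HB : uniform_bounds W T ux ut uxx utx M w0 w1 L)
  (HW : Cn 3 W).

Lemma ut_lipschitz t y z : 0 <= t <= T -> 0 <= y <= z -> z <= 1 ->
  Rabs (ut z t - ut y t) <= M * (z - y).
Proof.
  intros Ht Hy Hz. apply (lipschitz_of_derive (fun x => ut x t) (fun x => utx x t)).
  - lra.
  - intros x Hx. apply (so_dut_dx Hsol); lra.
  - intros x _. apply cont2_fst, (so_ut Hsol).
  - intros x Hx. apply (ub_utx HB); lra.
Qed.

(** The estimate at one point of a face over [[a, b]]. *)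
Lemma face_pointwise t a b y m q v D dl dr :
  0 <= t <= T -> 0 <= a -> a < y < b -> b <= 1 -> 0 < m <= 1 -> Rabs q <= M + 1 ->
  Rabs dl <= m -> Rabs dr <= m -> D = (dr + dl) / 2 ->
  (v = 0 /\ (dl = 0 \/ b = 1) /\ (dr = 0 \/ a = 0) \/
   exists theta, w0 <= theta /\ Rabs (theta - Derive_n W 2 q) <= L * m /\
     v = sqrt (1 + q ^ 2) * (theta * D / (b - a))) ->
  - (uxx y t * ut y t) + v * uxx y t +
    (- (v * D) + / 2 * (dr * ut b t + dl * ut a t)) / (b - a) <=
  growth_const M w0 w1 L * (ux y t - q) ^ 2 + (growth_const M w0 w1 L + M) * m.
Proof.
  intros Ht Ha Hy Hb Hm Hq Hdl Hdr HD Hv.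
  assert (HE := ub_W HB). assert (HM := ub_M HB).
  assert (Hpos := eb_pos HE).
  assert (Hux := ub_ux HB y t ltac:(lra) Ht).
  assert (Huxx := ub_uxx HB y t ltac:(lra) Ht).
  assert (Hpde := so_pde Hsol y t ltac:(lra) Ht).
  assert (HG : 0 <= growth_const M w0 w1 L).
  { unfold growth_const. apply Rdiv_le_0_compat; [|lra].
    apply Rmult_le_pos; apply pow2_ge_0. }
  set (G := growth_const M w0 w1 L) in *.
  set (l := b - a). assert (Hl : 0 < l) by (unfold l; lra).
  assert (Hz2 := pow2_ge_0 (ux y t - q)).
  destruct Hv as [(Ev & H1 & H2)|(th & Hth & Hth2 & Ev)].
  - (* end faces do not move, and [u_t] vanishes at the ends *)
    assert (Hbd : Rabs (dr * ut b t + dl * ut a t) <= m * (M * l) + m * (M * l)).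
    { destruct (so_ut_bc _ _ _ _ _ _ _ _ Hsol t Ht) as [U0 U1].
      assert (Hab := ut_lipschitz t a b Ht ltac:(lra) Hb). fold l in Hab.
      eapply Rle_trans; [apply Rabs_triang|]. rewrite !Rabs_mult.
      assert (HMl : 0 <= M * l) by nra.
      apply Rplus_le_compat.
      - destruct H2 as [->|E]; [rewrite Rabs_R0; nra|].
        apply Rmult_le_compat; auto using Rabs_pos. rewrite E, U0, Rminus_0_r in Hab. exact Hab.
      - destruct H1 as [->|E]; [rewrite Rabs_R0; nra|].
        apply Rmult_le_compat; auto using Rabs_pos.
        rewrite E, U1, Rminus_0_l, Rabs_Ropp in Hab. exact Hab. }
    apply Rabs_le_between in Hbd.
    rewrite Ev, Hpde. unfold mobility.
    assert (Hs := sqrt1_ge1 (ux y t)).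
    assert (Hw := eb_low HE (ux y t) ltac:(lra)).
    assert (Hneg : 0 <= sqrt (1 + ux y t ^ 2) * Derive_n W 2 (ux y t) * uxx y t ^ 2).
    { apply Rmult_le_pos; [nra|apply pow2_ge_0]. }
    assert (Hc : (- (0 * D) + / 2 * (dr * ut b t + dl * ut a t)) / l <= M * m).
    { apply Rmult_le_reg_r with l; [exact Hl|]. unfold Rdiv.
      rewrite Rmult_assoc, Rinv_l by lra. lra. }
    assert (0 <= G * (ux y t - q) ^ 2) by nra.
    assert (0 <= G * m) by nra. nra.
  - set (bi := sqrt (1 + q ^ 2) * th).
    set (kappa := D / l).
    assert (Evk : v = bi * kappa).
    { rewrite Ev. unfold bi, kappa, l. field. lra. }
    assert (Hbi : w0 <= bi).
    { assert (H := sqrt1_ge1 q). unfold bi. nra. }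
    assert (Hbb : Rabs (mobility W (ux y t) - bi) <= mob_const M w1 L * (Rabs (ux y t - q) + m)).
    { replace (mobility W (ux y t) - bi) with
        ((mobility W (ux y t) - mobility W q) + - (sqrt (1 + q ^ 2) * (th - Derive_n W 2 q)))
        by (unfold bi, mobility; ring).
      eapply Rle_trans; [apply Rabs_triang|].
      assert (A1 := mobility_lipschitz W (M + 1) w0 w1 L (ux y t) q HE ltac:(lra) Hq).
      assert (A2 : Rabs (- (sqrt (1 + q ^ 2) * (th - Derive_n W 2 q))) <= (2 + M) * (L * m)).
      { rewrite Rabs_Ropp, Rabs_mult.
        assert (A3 := sqrt1_le q _ Hq). assert (A4 := sqrt1_ge1 q).
        rewrite (Rabs_right (sqrt _)) by lra.
        apply Rmult_le_compat; auto using Rabs_pos; lra. }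
      unfold mob_const. assert (A5 : 0 <= w1 * m) by nra.
      replace (1 + (M + 1)) with (2 + M) in A1 by ring. nra. }
    assert (HK : 0 <= mob_const M w1 L) by (unfold mob_const; nra).
    assert (Hd := dissipation_bound w0 (mob_const M w1 L) m M _ bi (uxx y t) kappa (ux y t - q)
      ltac:(lra) HK ltac:(lra) Hbi Huxx Hbb).
    fold (growth_const M w0 w1 L) in Hd. fold G in Hd. rewrite <- Hpde in Hd.
    (* [u_t] at the corners differs little from its value at [y] *)
    assert (Hc1 := ut_lipschitz t y b Ht ltac:(lra) Hb).
    assert (Hc2 := ut_lipschitz t a y Ht ltac:(lra) ltac:(lra)).
    set (e := dr * (ut b t - ut y t) - dl * (ut y t - ut a t)).
    assert (He : Rabs e <= m * (M * (b - y)) + m * (M * (y - a))).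
    { unfold e. replace (dr * (ut b t - ut y t) - dl * (ut y t - ut a t)) with
        (dr * (ut b t - ut y t) + - (dl * (ut y t - ut a t))) by ring.
      eapply Rle_trans; [apply Rabs_triang|]. rewrite Rabs_Ropp, !Rabs_mult.
      apply Rplus_le_compat; apply Rmult_le_compat; auto using Rabs_pos. }
    assert (He1 := Rle_abs e).
    assert (He2 : / 2 * e / l <= M * m).
    { apply Rmult_le_reg_r with l; [exact Hl|]. unfold Rdiv.
      rewrite Rmult_assoc, Rinv_l by lra.
      assert (0 <= m * (M * l)) by (apply Rmult_le_pos; [|apply Rmult_le_pos]; lra).
      unfold l in *. lra. }
    replace (- (uxx y t * ut y t) + v * uxx y t +
      (- (v * D) + / 2 * (dr * ut b t + dl * ut a t)) / l) with
      (- ((uxx y t - kappa) * (ut y t - bi * kappa)) + / 2 * e / l).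
    2:{ rewrite Evk. unfold kappa, e. rewrite HD. field. lra. }
    assert (m ^ 2 <= m) by nra.
    assert (G * m ^ 2 <= G * m) by (apply Rmult_le_compat_l; assumption).
    lra.
Qed.

Lemma face_estimate t a b m q v D dl dr :
  0 <= t <= T -> 0 <= a -> a < b -> b <= 1 -> 0 < m <= 1 -> Rabs q <= M + 1 ->
  Rabs dl <= m -> Rabs dr <= m -> D = (dr + dl) / 2 ->
  (v = 0 /\ (dl = 0 \/ b = 1) /\ (dr = 0 \/ a = 0) \/
   exists theta, w0 <= theta /\ Rabs (theta - Derive_n W 2 q) <= L * m /\
     v = sqrt (1 + q ^ 2) * (theta * D / (b - a))) ->
  - RInt (fun y => uxx y t * ut y t) a b +
  (v * (ux b t - ux a t) - v * D + / 2 * (dr * ut b t + dl * ut a t)) <=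
  growth_const M w0 w1 L * RInt (fun y => (ux y t - q) ^ 2) a b
  + (growth_const M w0 w1 L + M) * m * (b - a).
Proof.
  intros Ht Ha Hab Hb Hm Hq Hdl Hdr HD Hv.
  assert (C1 : forall y, continuous (fun y => uxx y t * ut y t) y).
  { intros y. apply (cont2_fst (fun y t => uxx y t * ut y t)), cont2_mult;
      [apply (so_uxx Hsol)|apply (so_ut Hsol)]. }
  assert (C2 : forall y, continuous (fun y => uxx y t) y).
  { intros y. apply cont2_fst, (so_uxx Hsol). }
  assert (C3 : forall y, continuous (fun y => (ux y t - q) ^ 2) y).
  { intros y. apply (sq_diff_continuous (fun y => ux y t)). intros z.
    apply cont2_fst, (so_ux Hsol). }
  set (G := growth_const M w0 w1 L).
  set (c := (- (v * D) + / 2 * (dr * ut b t + dl * ut a t)) / (b - a)).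
  assert (EU : RInt (fun y => uxx y t) a b = ux b t - ux a t).
  { apply (RInt_of_derive (fun y => ux y t)); auto; [lra| |].
    - intros x Hx. apply (so_dux_dx Hsol); lra.
    - intros x _. apply cont2_fst, (so_ux Hsol). }
  assert (HI1 : is_RInt (fun y => - (uxx y t * ut y t) + v * uxx y t + c) a b
    (- RInt (fun y => uxx y t * ut y t) a b + v * (ux b t - ux a t) + (b - a) * c)).
  { rewrite <- EU.
    apply is_RInt_Rplus.
    - apply is_RInt_Rplus.
      + apply (is_RInt_opp (V := R_NormedModule)).
        apply (RInt_correct (V := R_CompleteNormedModule)), ex_RInt_cont, C1.
      + apply (is_RInt_scal (V := R_NormedModule)).
        apply (RInt_correct (V := R_CompleteNormedModule)), ex_RInt_cont, C2.
    - apply (is_RInt_const (V := R_NormedModule)). }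
  assert (HI2 : is_RInt (fun y => G * (ux y t - q) ^ 2 + (G + M) * m) a b
    (G * RInt (fun y => (ux y t - q) ^ 2) a b + (b - a) * ((G + M) * m))).
  { apply is_RInt_Rplus.
    - apply (is_RInt_scal (V := R_NormedModule)).
      apply (RInt_correct (V := R_CompleteNormedModule)), ex_RInt_cont, C3.
    - apply (is_RInt_const (V := R_NormedModule)). }
  assert (Hle := is_RInt_le _ _ a b _ _ (Rlt_le _ _ Hab) HI1 HI2).
  assert (Ec : (b - a) * c = - (v * D) + / 2 * (dr * ut b t + dl * ut a t)).
  { unfold c. field. lra. }
  rewrite Ec in Hle.
  assert (Hle' := Hle (fun y Hy => face_pointwise t a b y m q v D dl dr
    Ht Ha Hy Hb Hm Hq Hdl Hdr HD Hv)). lra.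
Qed.

(** The derivative of the distance, as a function of the current corners. *)
Definition distance_rate (N : nat) (p : nat -> R) (x : nat -> R) (t : R) : R :=
  - RInt (fun y => uxx y t * ut y t) 0 1 +
  sum1 (face_term N p (velocity W N p x) (fun i => ux (x i) t) (fun i => ut (x i) t)) N.

Lemma distance_rate_bound Sl m N p x t :
  0 <= t <= T -> 0 < m <= 1 -> good_slopes Sl m (M + 1) N p ->
  x 0%nat = 0 -> x N = 1 -> (forall i, is_face N i -> 0 < len x i) ->
  distance_rate N p x t <=
  2 * growth_const M w0 w1 L * slope_distance (fun y => ux y t) N p x
  + (growth_const M w0 w1 L + M) * m.
Proof.
  intros Ht Hm HG X0 X1 Hx. unfold distance_rate.
  assert (HE := ub_W HB).
  assert (Hlen : forall i, is_face N i -> 0 <= len x i) by (intros; apply Rlt_le; auto).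
  assert (EI : RInt (fun y => uxx y t * ut y t) 0 1 =
    sum1 (fun i => RInt (fun y => uxx y t * ut y t) (x (i - 1)%nat) (x i)) N).
  { rewrite <- X0, <- X1 at 1. apply is_RInt_unique.
    apply (faces_is_RInt _ (fun _ y => uxx y t * ut y t)). intros i Hi.
    specialize (Hlen i Hi). unfold len in Hlen. split; [lra|]. split; [auto|].
    intros y. apply (cont2_fst (fun y t => uxx y t * ut y t)), cont2_mult;
      [apply (so_uxx Hsol)|apply (so_ut Hsol)]. }
  assert (EL : sum1 (fun i => x i - x (i - 1)%nat) N = 1).
  { rewrite sum1_telescope, X0, X1. ring. }
  set (G := growth_const M w0 w1 L).
  unfold slope_distance.
  replace (2 * G * (/ 2 * sum1 (fun i => RInt (fun y => (ux y t - p i) ^ 2) (x (i - 1)%nat) (x i)) N)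
    + (G + M) * m) with
    (sum1 (fun i => G * RInt (fun y => (ux y t - p i) ^ 2) (x (i - 1)%nat) (x i) +
      (G + M) * m * (x i - x (i - 1)%nat)) N).
  2:{ rewrite sum1_plus, !sum1_scal, EL. field. }
  rewrite EI.
  replace (- sum1 (fun i => RInt (fun y => uxx y t * ut y t) (x (i - 1)%nat) (x i)) N) with
    (sum1 (fun i => -1 * RInt (fun y => uxx y t * ut y t) (x (i - 1)%nat) (x i)) N)
    by (rewrite sum1_scal; ring).
  rewrite <- sum1_plus. apply sum1_le. intros i Hi.
  replace (-1 * RInt (fun y => uxx y t * ut y t) (x (i - 1)%nat) (x i)) with
    (- RInt (fun y => uxx y t * ut y t) (x (i - 1)%nat) (x i)) by ring.
  assert (Hxi := Hx i Hi). unfold len in Hxi.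
  assert (Ha : 0 <= x (i - 1)%nat).
  { rewrite <- X0. apply (corners_monotone N); auto; lia. }
  assert (Hb : x i <= 1).
  { rewrite <- X1. apply (corners_monotone N); auto; lia. }
  unfold face_term.
  apply face_estimate; auto.
  - lra.
  - apply HG, Hi.
  - apply (good_slopes_jump Sl m (M + 1)); [lra|exact HG].
  - apply (good_slopes_jump Sl m (M + 1)); [lra|exact HG].
  - destruct (classic (1 < i < N)%nat) as [Hin|Hend].
    + right.
      destruct (good_slopes_law W Sl m (M + 1) w0 w1 L N p i HW HE HG Hin)
        as [_ (th & H1 & H2 & H3)].
      exists th. split; [exact H1|]. split; [exact H2|].
      rewrite velocity_inner by exact Hin. rewrite H3.
      rewrite !slope_jump_inner by lia. replace (i - 1 + 1)%nat with i by lia.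
      unfold len. f_equal. f_equal. f_equal. f_equal. ring.
    + left. assert (Hc : i = 1%nat \/ i = N) by lia.
      split; [apply velocity_ends, Hc|].
      split.
      * destruct Hc as [->| ->]; [left; apply slope_jump_ends; auto|right; exact X1].
      * destruct Hc as [->| ->]; [right; exact X0|left; apply slope_jump_ends; auto].
Qed.

End Inequality.

(** * The distance during a stage *)

Lemma velocity_continuous W N p x a b i t : motion W N p x a b -> is_face N i ->
  0 < len (fun j => x j t) i ->
  continuous (fun s => velocity W N p (fun j => x j s) i) t.
Proof.
  intros HM Hi Hl. destruct (classic (1 < i < N)%nat) as [H|H].
  - apply (continuous_ext (fun s => sqrt (1 + p i ^ 2) *
      (Defs.Delta W p i / len (fun j => x j s) i))).
    { intros s. symmetry. apply velocity_inner, H. }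
    apply (continuous_scal_r (V := R_NormedModule) (sqrt (1 + p i ^ 2))
      (fun s => Defs.Delta W p i / len (fun j => x j s) i)).
    apply (continuous_scal_r (V := R_NormedModule) (Defs.Delta W p i)
      (fun s => / len (fun j => x j s) i)).
    apply (continuous_comp (fun s => len (fun j => x j s) i) Rinv).
    + apply (len_continuous W N p x a b i t HM Hi).
    + apply continuity_pt_filterlim. apply continuity_pt_inv; [|lra].
      apply derivable_continuous_pt, derivable_pt_id.
  - apply (continuous_ext (fun _ => 0)).
    { intros s. symmetry. apply velocity_ends. unfold is_face in Hi. lia. }
    apply continuous_const.
Qed.

Section Stage.
Context (W : R -> R) (T : R) (u ux ut uxx uxt utx : R -> R -> R)
  (Hsol : solution W T u ux ut uxx uxt utx)
  (N : nat) (p : nat -> R) (x : nat -> R -> R) (a b : R)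
  (HM : motion W N p x a b) (Hab : 0 <= a /\ b <= T)
  (Hp : forall i, (1 <= i < N)%nat -> p i <> p (i + 1)%nat).

(** The distance in expanded form. *)
Definition stage_distance (t : R) : R :=
  dirichlet_energy ux t
  - sum1 (fun i => p i * (u (x i t) t - u (x (i - 1)%nat t) t)) N
  + / 2 * sum1 (fun i => p i ^ 2 * (x i t - x (i - 1)%nat t)) N.

Lemma stage_distance_eq t : a <= t <= b ->
  stage_distance t = slope_distance (fun y => ux y t) N p (fun i => x i t).
Proof.
  intros Ht. symmetry.
  apply (slope_distance_expand N p (fun i => x i t) (fun y => ux y t) (fun y => u y t)).
  - apply (mo_left HM).
  - apply (mo_right HM).
  - intros i Hi. assert (H := motion_nonneg _ _ _ _ _ _ HM t i Ht Hi). unfold len in H. lra.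
  - intros y. apply cont2_fst, (so_ux Hsol).
  - intros y. apply cont2_fst, (so_u Hsol).
  - intros y Hy. apply (so_du_dx Hsol); lra.
Qed.

Lemma stage_distance_continuous t : continuous stage_distance t.
Proof.
  assert (Hx : forall i, (i <= N)%nat -> continuous (x i) t).
  { intros i Hi. apply (mo_cont HM), Hi. }
  assert (Hu : forall i, (i <= N)%nat -> continuous (fun s => u (x i s) s) t).
  { intros i Hi. apply cont2_comp; auto. apply (so_u Hsol). apply continuous_id. }
  apply continuous_Rplus.
  - apply continuous_Rminus.
    + apply (continuous_scal_r (V := R_NormedModule) (/ 2)
        (fun s => RInt (fun y => ux y s ^ 2) 0 1)).
      apply (cont2_RInt (fun y s => ux y s ^ 2)). intros y s.
      apply continuity_2d_pt_ext with (fun y s => ux y s * ux y s).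
      { intros; ring. }
      apply cont2_mult; apply (so_ux Hsol).
    + apply (sum1_continuous (fun i t => p i * (u (x i t) t - u (x (i - 1)%nat t) t))).
      intros i Hi. apply (continuous_scal_r (V := R_NormedModule) (p i)
        (fun t => u (x i t) t - u (x (i - 1)%nat t) t)).
      apply continuous_Rminus; apply Hu; lia.
  - apply (continuous_scal_r (V := R_NormedModule) (/ 2)
      (fun t => sum1 (fun i => p i ^ 2 * (x i t - x (i - 1)%nat t)) N)).
    apply (sum1_continuous (fun i t => p i ^ 2 * (x i t - x (i - 1)%nat t))).
    intros i Hi. apply (continuous_scal_r (V := R_NormedModule) (p i ^ 2)
      (fun t => x i t - x (i - 1)%nat t)).
    apply continuous_Rminus; apply Hx; lia.
Qed.

Definition stage_rate (t : R) : R := distance_rate W ux ut uxx N p (fun i => x i t) t.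

Lemma stage_distance_derive t : a < t < b -> is_derive stage_distance t (stage_rate t).
Proof.
  intros Ht.
  assert (HN := motion_pos_faces _ _ _ _ _ _ HM).
  set (v := velocity W N p (fun j => x j t)).
  set (inner := fun i => andb (Nat.ltb 0 i) (Nat.ltb i N)).
  assert (Hinner : forall i, inner i = true <-> (1 <= i < N)%nat).
  { intros i. unfold inner. rewrite Bool.andb_true_iff, !Nat.ltb_lt. lia. }
  set (xd := fun i => if inner i then - ((v (i + 1)%nat - v i) / (p (i + 1)%nat - p i)) else 0).
  set (w := fun i => if inner i then ux (x i t) t * xd i + ut (x i t) t else 0).
  assert (Hlen : forall i, is_face N i -> 0 < len (fun j => x j t) i).
  { intros i Hi. apply (mo_pos HM); [lra|exact Hi]. }
  assert (Hends : forall i, inner i = false -> (i <= N)%nat -> i = 0%nat \/ i = N).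
  { intros i E Hi. destruct (classic (1 <= i < N)%nat) as [H|H]; [|lia].
    apply Hinner in H. congruence. }
  assert (Dx : forall i, (i <= N)%nat -> is_derive (x i) t (xd i)).
  { intros i Hi. unfold xd. destruct (inner i) eqn:E.
    - apply Hinner in E. apply (mo_der HM); assumption.
    - destruct (Hends i E Hi) as [->| ->].
      + apply (is_derive_ext (fun _ => 0)).
        { intros s. symmetry. apply (mo_left HM). }
        apply (is_derive_const (V := R_NormedModule)).
      + apply (is_derive_ext (fun _ => 1)).
        { intros s. symmetry. apply (mo_right HM). }
        apply (is_derive_const (V := R_NormedModule)). }
  assert (Du : forall i, (i <= N)%nat -> is_derive (fun s => u (x i s) s) t (w i)).
  { intros i Hi. unfold w. destruct (inner i) eqn:E.
    - apply Hinner in E.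
      apply (so_chain W T u ux ut uxx uxt utx Hsol (x i)); [lra| |apply Dx, Hi].
      assert (H1 := Hlen i ltac:(unfold is_face; lia)).
      assert (H2 := Hlen (i + 1)%nat ltac:(unfold is_face; lia)).
      unfold len in H1, H2. replace (i + 1 - 1)%nat with i in H2 by lia.
      assert (Hn : forall j, is_face N j -> 0 <= len (fun j => x j t) j).
      { intros; apply Rlt_le, Hlen; assumption. }
      assert (H3 := corners_monotone N (fun j => x j t) 0 (i - 1) Hn ltac:(lia)).
      assert (H4 := corners_monotone N (fun j => x j t) (i + 1) N Hn ltac:(lia)).
      simpl in H3, H4. rewrite (mo_left HM) in H3.
      rewrite (mo_right HM) in H4. lra.
    - apply (is_derive_ext_loc (fun _ => 0)).
      + destruct (proj1 (locally_Rabs _ t) (locally_between a b t Ht)) as (d & Hd & Hl).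
        apply locally_Rabs. exists d. split; [exact Hd|]. intros s Hs.
        specialize (Hl s Hs). destruct (so_bc Hsol s ltac:(lra)) as [H0 H1].
        destruct (Hends i E Hi) as [->| ->].
        * rewrite (mo_left HM). auto.
        * rewrite (mo_right HM). auto.
      + apply (is_derive_const (V := R_NormedModule)). }
  apply is_derive_eq with
    (- RInt (fun y => uxx y t * ut y t) 0 1
     - sum1 (fun i => p i * (w i - w (i - 1)%nat)) N
     + / 2 * sum1 (fun i => p i ^ 2 * (xd i - xd (i - 1)%nat)) N).
  - apply is_derive_Rplus.
    + apply is_derive_Rminus.
      * apply (dirichlet_energy_derive W T u ux ut uxx uxt utx Hsol). lra.
      * apply (sum1_is_derive (fun i t => p i * (u (x i t) t - u (x (i - 1)%nat t) t))).
        intros i Hi. apply (is_derive_scal (fun t => u (x i t) t - u (x (i - 1)%nat t) t)).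
        apply is_derive_Rminus; apply Du; lia.
    + apply (is_derive_scal (fun t => sum1 (fun i => p i ^ 2 * (x i t - x (i - 1)%nat t)) N)).
      apply (sum1_is_derive (fun i t => p i ^ 2 * (x i t - x (i - 1)%nat t))).
      intros i Hi. apply (is_derive_scal (fun t => x i t - x (i - 1)%nat t)).
      apply is_derive_Rminus; apply Dx; lia.
  - unfold stage_rate, distance_rate. fold v.
    assert (E0 : inner 0%nat = false) by reflexivity.
    assert (EN : inner N = false).
    { unfold inner. rewrite Nat.ltb_irrefl. apply Bool.andb_false_r. }
    rewrite <- (face_terms_sum N p v (fun i => ux (x i t) t) (fun i => ut (x i t) t) w xd).
    + ring.
    + exact HN.
    + unfold w. rewrite E0. reflexivity.
    + unfold w. rewrite EN. reflexivity.
    + unfold xd. rewrite E0. reflexivity.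
    + unfold xd. rewrite EN. reflexivity.
    + apply velocity_ends. auto.
    + apply velocity_ends. auto.
    + intros i Hi. unfold w. apply Hinner in Hi. rewrite Hi. reflexivity.
    + intros i Hi. unfold xd. assert (Hpi := Hp i Hi). apply Hinner in Hi. rewrite Hi.
      field. lra.
Qed.

Lemma stage_rate_continuous t :
  (forall i, is_face N i -> 0 < len (fun j => x j t) i) -> continuous stage_rate t.
Proof.
  intros Hlen. unfold stage_rate, distance_rate.
  assert (Hc : forall f i, cont2 f -> (i <= N)%nat -> continuous (fun s => f (x i s) s) t).
  { intros f i Hf Hi. apply cont2_comp; auto.
    apply (mo_cont HM), Hi. apply continuous_id. }
  apply continuous_Rplus.
  - apply (continuous_opp (V := R_NormedModule) (fun s => RInt (fun y => uxx y s * ut y s) 0 1)).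
    apply (cont2_RInt (fun y s => uxx y s * ut y s)), cont2_mult;
      [apply (so_uxx Hsol)|apply (so_ut Hsol)].
  - apply (sum1_continuous (fun i s => face_term N p (velocity W N p (fun i => x i s))
      (fun i => ux (x i s) s) (fun i => ut (x i s) s) i)).
    intros i Hi. unfold face_term.
    assert (Hv := velocity_continuous W N p x a b i t HM Hi (Hlen i Hi)).
    assert (Hux := fun j => Hc ux j (so_ux Hsol)).
    assert (Hut := fun j => Hc ut j (so_ut Hsol)).
    assert (Hcst : forall c : R, continuous (fun _ : R => c) t) by (intros; apply continuous_const).
    apply continuous_Rplus; [apply continuous_Rminus|].
    + apply continuous_Rmult; [exact Hv|].
      apply continuous_Rminus; apply Hux; lia.
    + apply continuous_Rmult; [exact Hv|apply Hcst].
    + apply continuous_Rmult; [apply Hcst|].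
      apply continuous_Rplus; (apply continuous_Rmult; [apply Hcst|apply Hut; lia]).
Qed.

Lemma stage_distance_D_in t : a <= t <= b ->
  (forall i, is_face N i -> 0 < len (fun j => x j t) i) ->
  D_in stage_distance stage_rate (Icc a b) t.
Proof.
  intros Ht Hlen. apply D_in_of_interior; auto.
  - intros s Hs. apply stage_distance_derive, Hs.
  - apply stage_distance_continuous.
  - apply stage_rate_continuous, Hlen.
Qed.

(** Gronwall's inequality over the stage: the distance, discounted by
    [exp (- Lam * t)], grows at most at the rate [Gam]. *)
Lemma stage_gronwall Lam Gam :
  0 <= Lam -> 0 <= Gam ->
  (forall t, a < t < b -> stage_rate t <= Lam * stage_distance t + Gam) ->
  forall t, a <= t <= b ->
  exp (- Lam * t) * stage_distance t - Gam * t <=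
  exp (- Lam * a) * stage_distance a - Gam * a.
Proof.
  intros HL HG Hr t Ht.
  apply (nonincreasing_of_derive (fun s => exp (- Lam * s) * stage_distance s - Gam * s)
    (fun s => exp (- Lam * s) * (stage_rate s - Lam * stage_distance s) - Gam)).
  - lra.
  - intros s Hs. assert (Hd := stage_distance_derive s ltac:(lra)).
    assert (He : is_derive (fun s => exp (- Lam * s)) s (- Lam * exp (- Lam * s))).
    { auto_derive; auto. ring. }
    apply is_derive_eq with (- Lam * exp (- Lam * s) * stage_distance s +
      exp (- Lam * s) * stage_rate s - Gam * 1); [|ring].
    apply is_derive_Rminus.
    + apply (is_derive_mult (fun s => exp (- Lam * s)) stage_distance); auto.
      intros; apply Rmult_comm.
    + apply (is_derive_scal (fun s => s)). apply (is_derive_id (K := R_AbsRing)).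
  - intros s _.
    apply continuous_Rminus.
    + apply continuous_Rmult.
      * apply (ex_derive_continuous (V := R_NormedModule)). auto_derive. auto.
      * apply stage_distance_continuous.
    + apply (continuous_scal_r (V := R_NormedModule) Gam (fun s => s)). apply continuous_id.
  - intros s Hs. specialize (Hr s ltac:(lra)).
    assert (He : exp (- Lam * s) <= 1).
    { rewrite <- exp_0. assert (Ha := proj1 Hab).
      destruct (Req_dec (- Lam * s) 0) as [->|Hn]; [lra|].
      apply Rlt_le, exp_increasing. nra. }
    assert (He0 := exp_pos (- Lam * s)). nra.
Qed.

End Stage.

(** * From one-sided derivatives on the rectangle to the extended solution *)

Lemma D_in_unique (f g df dg : R -> R) a b x : a < b -> a <= x <= b ->
  (forall y, Icc a b y -> f y = g y) ->
  D_in f df (Icc a b) x -> D_in g dg (Icc a b) x -> df x = dg x.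
Proof.
  intros Hab Hx Hfg Hf Hg. apply NNPP. intros Hne.
  assert (He : 0 < Rabs (df x - dg x) / 2).
  { apply Rdiv_lt_0_compat; [apply Rabs_pos_lt|]; lra. }
  destruct (Hf _ He) as (d1 & Hd1 & H1). destruct (Hg _ He) as (d2 & Hd2 & H2).
  simpl in H1, H2. unfold Rdist, D_x, Icc in H1, H2.
  set (r := Rmin (Rmin d1 d2 / 2) ((b - a) / 2)).
  assert (R1 := Rmin_l (Rmin d1 d2 / 2) ((b - a) / 2)).
  assert (R2 := Rmin_r (Rmin d1 d2 / 2) ((b - a) / 2)).
  assert (R3 := Rmin_l d1 d2). assert (R4 := Rmin_r d1 d2).
  assert (R5 : 0 < Rmin d1 d2) by (apply Rmin_pos; assumption).
  assert (R6 : 0 < r) by (apply Rmin_pos; lra). fold r in R1, R2.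
  assert (Hy : exists y, a <= y <= b /\ y <> x /\ Rabs (y - x) < d1 /\ Rabs (y - x) < d2).
  { destruct (Rle_lt_dec x ((a + b) / 2)) as [L|L].
    - exists (x + r). replace (x + r - x) with r by ring. rewrite Rabs_right by lra.
      repeat split; lra.
    - exists (x - r). replace (x - r - x) with (- r) by ring.
      rewrite Rabs_Ropp, Rabs_right by lra. repeat split; lra. }
  destruct Hy as (y & Hy & Hyx & Y1 & Y2).
  specialize (H1 y (conj (conj Hy (not_eq_sym Hyx)) Y1)).
  specialize (H2 y (conj (conj Hy (not_eq_sym Hyx)) Y2)).
  rewrite (Hfg y Hy), (Hfg x Hx) in H1.
  set (q := (g y - g x) / (y - x)) in *.
  assert (H3 := Rabs_triang (df x - q) (q - dg x)).
  replace (df x - q + (q - dg x)) with (df x - dg x) in H3 by ring.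
  rewrite Rabs_minus_sym in H1. lra.
Qed.

Lemma partial_x_clamp T f fx x t : 0 <= T -> partial_x T f fx -> 0 < x < 1 ->
  is_derive (fun y => f (clamp 0 1 y) (clamp 0 T t)) x (fx (clamp 0 1 x) (clamp 0 T t)).
Proof.
  intros HT H Hx. rewrite (clamp_id 0 1 x) by lra.
  apply (is_derive_ext_loc (fun y => f y (clamp 0 T t))).
  - destruct (proj1 (locally_Rabs _ x) (locally_between 0 1 x Hx)) as (d & Hd & Hl).
    apply locally_Rabs. exists d. split; [exact Hd|]. intros y Hy.
    specialize (Hl y Hy). rewrite (clamp_id 0 1 y) by lra. reflexivity.
  - apply (D_in_is_derive _ (fun y => fx y (clamp 0 T t)) 0 1 x Hx).
    apply H; [unfold Icc; lra|apply clamp_in, HT].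
Qed.

Lemma partial_t_clamp T f ft x t : partial_t T f ft -> 0 < t < T ->
  is_derive (fun s => f (clamp 0 1 x) (clamp 0 T s)) t (ft (clamp 0 1 x) (clamp 0 T t)).
Proof.
  intros H Ht. rewrite (clamp_id 0 T t) by lra.
  apply (is_derive_ext_loc (fun s => f (clamp 0 1 x) s)).
  - destruct (proj1 (locally_Rabs _ t) (locally_between 0 T t Ht)) as (d & Hd & Hl).
    apply locally_Rabs. exists d. split; [exact Hd|]. intros s Hs.
    specialize (Hl s Hs). rewrite (clamp_id 0 T s) by lra. reflexivity.
  - apply (D_in_is_derive _ (fun s => ft (clamp 0 1 x) s) 0 T t Ht).
    apply H; [apply clamp_in; lra|unfold Icc; lra].
Qed.

(** Uniqueness of relative derivatives identifies the given partial derivatives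
    with the continuous ones that the regularity class provides. *)
Lemma solution_extension W T u ux ut uxx :
  0 < T -> Cn_rect T 3 u -> partial_x T u ux -> partial_t T u ut -> partial_x T ux uxx ->
  (forall x t, Icc 0 1 x -> Icc 0 T t ->
     ut x t / sqrt (1 + ux x t ^ 2) = Derive_n W 2 (ux x t) * uxx x t) ->
  (forall t, Icc 0 T t -> u 0 t = 0 /\ u 1 t = 0) ->
  exists U Ux Ut Uxx Uxt Utx, solution W T U Ux Ut Uxx Uxt Utx /\
    (forall x t, Icc 0 1 x -> Icc 0 T t -> U x t = u x t /\ Ux x t = ux x t).
Proof.
  intros HT [Cu (ux1 & ut1 & P1 & P2 & C1 & C2)] Hux Hut Huxx Hpde Hbc.
  destruct C1 as [Cux (uxx1 & uxt1 & P3 & P4 & C3 & C4)].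
  destruct C2 as [Cut (utx1 & utt1 & P5 & P6 & C5 & C6)].
  assert (E1 : forall x t, Icc 0 1 x -> Icc 0 T t -> ux1 x t = ux x t).
  { intros x t Hx Ht. apply (D_in_unique (fun y => u y t) (fun y => u y t)
      (fun y => ux1 y t) (fun y => ux y t) 0 1 x);
      [lra|exact Hx|auto|apply P1; assumption|apply Hux; assumption]. }
  assert (E2 : forall x t, Icc 0 1 x -> Icc 0 T t -> ut1 x t = ut x t).
  { intros x t Hx Ht. apply (D_in_unique (fun s => u x s) (fun s => u x s)
      (fun s => ut1 x s) (fun s => ut x s) 0 T t);
      [lra|exact Ht|auto|apply P2; assumption|apply Hut; assumption]. }
  assert (E3 : forall x t, Icc 0 1 x -> Icc 0 T t -> uxx1 x t = uxx x t).
  { intros x t Hx Ht. apply (D_in_unique (fun y => ux1 y t) (fun y => ux y t)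
      (fun y => uxx1 y t) (fun y => uxx y t) 0 1 x);
      [lra|exact Hx|auto|apply P3; assumption|apply Huxx; assumption]. }
  set (ext := fun (f : R -> R -> R) x t => f (clamp 0 1 x) (clamp 0 T t)).
  assert (Hin : forall x t, Icc 0 1 (clamp 0 1 x) /\ Icc 0 T (clamp 0 T t)).
  { intros x t. split; apply clamp_in; lra. }
  assert (Hid : forall f x t, Icc 0 1 x -> Icc 0 T t -> ext f x t = f x t).
  { intros f x t Hx Ht. unfold ext. rewrite !clamp_id by assumption. reflexivity. }
  exists (ext u), (ext ux1), (ext ut1), (ext uxx1), (ext uxt1), (ext utx1). split.
  - constructor.
    + exact HT.
    + apply cont2_clamp; [lra|exact Cu].
    + apply cont2_clamp; [lra|exact Cux].
    + apply cont2_clamp; [lra|exact Cut].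
    + apply cont2_clamp; [lra|apply C3].
    + apply cont2_clamp; [lra|apply C4].
    + apply cont2_clamp; [lra|apply C5].
    + intros x t Hx _. apply partial_x_clamp; auto; lra.
    + intros x t _ Ht. apply partial_t_clamp; auto.
    + intros x t Hx _. apply partial_x_clamp; auto; lra.
    + intros x t _ Ht. apply partial_t_clamp; auto.
    + intros x t Hx _. apply partial_x_clamp; auto; lra.
    + intros x t Hx Ht. rewrite !Hid by assumption.
      rewrite E1, E2, E3 by assumption. unfold mobility.
      rewrite Rmult_assoc, <- Hpde by assumption.
      assert (H := sqrt1_ge1 (ux x t)). field. lra.
    + intros t Ht. rewrite !Hid by (try assumption; unfold Icc; lra). apply Hbc, Ht.
  - intros x t Hx Ht. rewrite !Hid by assumption. split; [reflexivity|apply E1; assumption].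
Qed.

(** * Bound of the H^1 norm by the distance *)

(** An elementary Poincare inequality: [f x] is the mean of [h] up to [x],
    and the integral of [(h - f x) ^ 2] is nonnegative. *)
Lemma sq_integral_bound (h : R -> R) x c E : 0 <= x <= 1 ->
  is_RInt h 0 x c -> is_RInt (fun y => h y ^ 2) 0 1 E -> c ^ 2 <= E.
Proof.
  intros Hx H1 H2.
  assert (X1 : ex_RInt (fun y => h y ^ 2) 0 x).
  { apply (ex_RInt_Chasles_1 (V := R_CompleteNormedModule)) with 1; [exact Hx|]. exists E. exact H2. }
  assert (X2 : ex_RInt (fun y => h y ^ 2) x 1).
  { apply (ex_RInt_Chasles_2 (V := R_CompleteNormedModule)) with 0; [exact Hx|]. exists E. exact H2. }
  assert (HE : RInt (fun y => h y ^ 2) 0 x + RInt (fun y => h y ^ 2) x 1 = E).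
  { rewrite <- (is_RInt_unique _ _ _ _ H2).
    apply (RInt_Chasles (V := R_CompleteNormedModule)); assumption. }
  assert (Hr : 0 <= RInt (fun y => h y ^ 2) x 1).
  { apply RInt_ge_0; [lra|exact X2|]. intros; apply pow2_ge_0. }
  assert (Hq : is_RInt (fun y => (h y - c) ^ 2) 0 x
    (RInt (fun y => h y ^ 2) 0 x + -2 * c * c + (x - 0) * c ^ 2)).
  { apply (is_RInt_ext (fun y => plus (plus (h y ^ 2) (scal (-2 * c) (h y))) (c ^ 2))).
    - intros y _. unfold plus, scal; simpl; unfold mult; simpl. ring.
    - apply is_RInt_Rplus; [apply is_RInt_Rplus|].
      + apply (RInt_correct (V := R_CompleteNormedModule)), X1.
      + apply (is_RInt_scal (V := R_NormedModule)), H1.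
      + apply (is_RInt_const (V := R_NormedModule)). }
  assert (Hq0 : 0 <= RInt (fun y => (h y - c) ^ 2) 0 x).
  { apply RInt_ge_0; [lra|eexists; exact Hq|]. intros; apply pow2_ge_0. }
  rewrite (is_RInt_unique _ _ _ _ Hq) in Hq0. nra.
Qed.

Lemma face_of_point N (x : nat -> R) y : x 0%nat = 0 -> x N = 1 -> 0 < y <= 1 ->
  exists i, is_face N i /\ x (i - 1)%nat < y <= x i.
Proof.
  intros X0 X1 Hy.
  destruct (nearest_below (fun i => x i < y) 0 N) as (i & Hi & H1 & H2).
  - destruct N; [lra|lia].
  - lra.
  - lra.
  - exists (S i). unfold is_face. split; [lia|]. replace (S i - 1)%nat with i by lia.
    split; [exact H1|]. apply Rnot_lt_le, H2. lia.
Qed.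

Lemma H1_norm_bound (f u0 G g : R -> R) N p x :
  linear_on_faces f N p x -> f 0 = 0 -> G 0 = 0 ->
  (forall y, continuous G y) -> (forall y, continuous g y) ->
  (forall y, 0 < y < 1 -> is_derive G y (g y)) ->
  (forall y, 0 <= y <= 1 -> u0 y = G y) ->
  0 <= slope_distance g N p x /\
  H1_norm (fun y => u0 y - f y) <= 2 * sqrt (slope_distance g N p x).
Proof.
  intros Hf F0 G0 CG Cg Dg Hu0. set (D := slope_distance g N p x).
  destruct (Hf) as (X0 & X1 & Hl).
  set (line := fun i y => f (x (i - 1)%nat) + p i * (y - x (i - 1)%nat)).
  assert (Dline : forall i y, is_derive (line i) y (p i)).
  { intros i y. unfold line. auto_derive; auto. ring. }
  assert (Cline : forall i y, continuous (line i) y).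
  { intros i y. apply (ex_derive_continuous (V := R_NormedModule)). exists (p i). apply Dline. }
  set (h := fun y => Derive (fun z => u0 z - f z) y).
  assert (Hh : forall i y, is_face N i -> x (i - 1)%nat < y < x i -> h y = g y - p i).
  { intros i y Hi Hy. destruct (faces_range f N p x i Hf Hi). apply is_derive_unique.
    apply (is_derive_ext_loc (fun z => G z - f z)).
    - destruct (proj1 (locally_Rabs _ y) (locally_between 0 1 y ltac:(lra))) as (d & Hd & Hz).
      apply locally_Rabs. exists d. split; [exact Hd|]. intros z Hzd.
      specialize (Hz z Hzd). rewrite Hu0 by lra. reflexivity.
    - apply is_derive_Rminus.
      + apply Dg. lra.
      + apply (face_derive f N p x); assumption. }
  assert (Hh2 : is_RInt (fun y => h y ^ 2) 0 1 (2 * D)).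
  { unfold D, slope_distance. rewrite <- Rmult_assoc, Rinv_r, Rmult_1_l by lra.
    rewrite <- X0, <- X1 at 1.
    apply (faces_is_RInt _ (fun i y => (g y - p i) ^ 2)). intros i Hi.
    destruct (Hl i Hi) as [Hx _]. split; [exact Hx|]. split.
    - intros y Hy. rewrite (Hh i) by assumption. reflexivity.
    - intros y. apply sq_diff_continuous, Cg. }
  assert (HD : 0 <= D).
  { assert (H : 0 <= RInt (fun y => h y ^ 2) 0 1).
    { apply RInt_ge_0; [lra|eexists; exact Hh2|]. intros; apply pow2_ge_0. }
    rewrite (is_RInt_unique _ _ _ _ Hh2) in H. lra. }
  assert (Hface : forall i y, is_face N i -> x (i - 1)%nat <= y <= x i ->
    is_RInt h (x (i - 1)%nat) y ((G y - f y) - (G (x (i - 1)%nat) - f (x (i - 1)%nat)))).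
  { intros i y Hi Hy. destruct (faces_range f N p x i Hf Hi).
    destruct (Hl i Hi) as [_ Hly].
    apply (is_RInt_ext (fun y => g y - p i)).
    { intros z. rewrite Rmin_left, Rmax_right by lra. intros Hz. symmetry.
      apply Hh; [exact Hi|lra]. }
    assert (Cgp : forall z, continuous (fun y => g y - p i) z).
    { intros z. apply continuous_Rminus; [apply Cg|apply continuous_const]. }
    rewrite (Hly y) by exact Hy.
    replace (G y - (f (x (i - 1)%nat) + p i * (y - x (i - 1)%nat)) -
      (G (x (i - 1)%nat) - f (x (i - 1)%nat))) with
      (RInt (fun y => g y - p i) (x (i - 1)%nat) y).
    - apply (RInt_correct (V := R_CompleteNormedModule)), ex_RInt_cont, Cgp.
    - rewrite (RInt_of_derive (fun y => G y - line i y)).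
      + unfold line. apply Rminus_diag_uniq. ring.
      + lra.
      + intros z Hz. apply is_derive_Rminus.
        apply Dg. lra. apply Dline.
      + intros z _. apply continuous_Rminus; auto.
      + exact Cgp. }
  assert (Hcorner : forall n, (n <= N)%nat -> is_RInt h 0 (x n) (G (x n) - f (x n))).
  { induction n as [|n IH]; intros Hn.
    - rewrite X0, G0, F0, Rminus_0_r. apply (is_RInt_point (V := R_NormedModule)).
    - assert (Hi : is_face N (S n)) by (unfold is_face; lia).
      assert (H := Hface (S n) (x (S n)) Hi).
      replace (S n - 1)%nat with n in H by lia.
      destruct (Hl (S n) Hi) as [Hx _]. replace (S n - 1)%nat with n in Hx by lia.
      specialize (H ltac:(lra)). specialize (IH ltac:(lia)).
      assert (HC := is_RInt_Chasles (V := R_NormedModule) _ _ _ _ _ _ IH H).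
      unfold plus in HC; simpl in HC.
      replace (G (x (S n)) - f (x (S n))) with
        (G (x n) - f (x n) + (G (x (S n)) - f (x (S n)) - (G (x n) - f (x n)))) by ring.
      exact HC. }
  assert (Hpt : forall y, 0 < y < 1 -> (u0 y - f y) ^ 2 <= 2 * D).
  { intros y Hy. destruct (face_of_point N x y X0 X1 ltac:(lra)) as (i & Hi & Hxy).
    rewrite Hu0 by lra. apply (sq_integral_bound h y); [lra| |exact Hh2].
    assert (H1 := Hcorner (i - 1)%nat ltac:(unfold is_face in Hi; lia)).
    assert (H2 := Hface i y Hi ltac:(lra)).
    assert (HC := is_RInt_Chasles (V := R_NormedModule) _ _ _ _ _ _ H1 H2).
    unfold plus in HC; simpl in HC.
    replace (G y - f y) with
      (G (x (i - 1)%nat) - f (x (i - 1)%nat) + (G y - f y - (G (x (i - 1)%nat) - f (x (i - 1)%nat))))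
      by ring.
    exact HC. }
  assert (Hsq : ex_RInt (fun y => (u0 y - f y) ^ 2) 0 1).
  { exists (sum1 (fun i => RInt (fun y => (G y - line i y) ^ 2) (x (i - 1)%nat) (x i)) N).
    rewrite <- X0, <- X1 at 1.
    apply (faces_is_RInt _ (fun i y => (G y - line i y) ^ 2)). intros i Hi.
    destruct (Hl i Hi) as [Hx Hly]. destruct (faces_range f N p x i Hf Hi).
    split; [exact Hx|]. split.
    - intros y Hy. rewrite Hu0 by lra. rewrite Hly by (unfold Icc; lra). reflexivity.
    - intros y. apply (continuous_ext (fun y => ((G y - line i y) - 0) ^ 2)).
      { intros; simpl; ring. }
      apply (sq_diff_continuous (fun y => G y - line i y)). intros z.
      apply continuous_Rminus; auto. }
  assert (Hle : RInt (fun y => (u0 y - f y) ^ 2) 0 1 <= 2 * D).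
  { replace (2 * D) with (RInt (fun _ => 2 * D) 0 1).
    - apply RInt_le; [lra|exact Hsq|apply ex_RInt_const|exact Hpt].
    - rewrite RInt_const. unfold scal; simpl; unfold mult; simpl. ring. }
  split; [exact HD|]. unfold H1_norm.
  change (RInt (fun z => Derive (fun y => u0 y - f y) z ^ 2) 0 1) with (RInt (fun y => h y ^ 2) 0 1).
  rewrite (is_RInt_unique _ _ _ _ Hh2).
  replace (2 * sqrt D) with (sqrt (4 * D)).
  - apply sqrt_le_1_alt. lra.
  - replace (4 * D) with (2 ^ 2 * D) by ring.
    rewrite sqrt_mult by lra. rewrite sqrt_pow2 by lra. reflexivity.
Qed.

(** * The succession of stages *)

Lemma tau_monotone (tau : nat -> R) K j k :
  (forall k, (k < K)%nat -> tau k < tau (k + 1)%nat) -> (j <= k <= K)%nat -> tau j <= tau k.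
Proof.
  intros H [Hjk HkK]. induction Hjk as [|k Hjk IH]; [lra|].
  specialize (IH ltac:(lia)). specialize (H k ltac:(lia)). rewrite Nat.add_1_r in H. lra.
Qed.

Lemma stage_of_time (tau : nat -> R) n t : tau 0%nat <= t < tau n ->
  exists k, (k < n)%nat /\ tau k <= t < tau (k + 1)%nat.
Proof.
  intros [H0 Hn]. destruct (nearest_below (fun k => tau k <= t) 0 n) as (k & Hk & H1 & H2).
  - destruct n; [lra|lia].
  - exact H0.
  - lra.
  - exists k. split; [lia|]. split; [exact H1|]. apply Rnot_le_lt, H2. lia.
Qed.

(** The function equal to [r k] during stage [k < n], and to [r n] from [tau n] on. *)
Fixpoint piecewise (r : nat -> R -> R) (tau : nat -> R) (n : nat) (t : R) : R :=
  match n with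
  | O => r 0%nat t
  | S k => if Rle_dec (tau n) t then r n t else piecewise r tau k t
  end.

Lemma piecewise_eq r tau K n k t :
  (forall k, (k < K)%nat -> tau k < tau (k + 1)%nat) -> (k <= n < K)%nat ->
  tau k <= t -> (k = n \/ t < tau (k + 1)%nat) -> piecewise r tau n t = r k t.
Proof.
  intros Ht [Hkn HnK] H1 H2. induction n as [|n IH].
  - simpl. replace k with 0%nat by lia. reflexivity.
  - cbn [piecewise]. destruct (Nat.eq_dec k (S n)) as [->|N].
    + destruct Rle_dec; [reflexivity|contradiction].
    + destruct H2 as [H2|H2]; [lia|].
      assert (H3 := tau_monotone tau K (k + 1) (S n) Ht ltac:(lia)).
      destruct Rle_dec; [lra|]. apply IH; [lia|lia|auto].
Qed.

Lemma continuous_on_glue (f : R -> R) a b c : a <= b <= c ->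
  continuous_on (Icc a b) f -> continuous_on (Icc b c) f -> continuous_on (Icc a c) f.
Proof.
  intros Hb H1 H2. apply continuous_on_eps. intros x Hx e He. unfold Icc in *.
  assert (Hpart : forall p q, continuous_on (Icc p q) f -> p <= q ->
    exists d, 0 < d /\ forall y, p <= y <= q -> Rabs (y - x) < d ->
      p <= x <= q -> Rabs (f y - f x) < e).
  { intros p q H Hpq. destruct (classic (p <= x <= q)) as [Hin|Hout].
    - destruct (proj1 (continuous_on_eps _ _) H x Hin e He) as (d & Hd & Hy).
      exists d. split; [exact Hd|]. intros y Hyp Hyd _. apply Hy; auto.
    - exists 1. split; [lra|]. intros; contradiction. }
  destruct (Hpart a b H1 ltac:(lra)) as (d1 & Hd1 & G1).
  destruct (Hpart b c H2 ltac:(lra)) as (d2 & Hd2 & G2).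
  destruct (Req_dec x b) as [E|E].
  - exists (Rmin d1 d2). split; [apply Rmin_pos; assumption|]. intros y Hy Hyd.
    assert (M1 := Rmin_l d1 d2). assert (M2 := Rmin_r d1 d2).
    destruct (Rle_lt_dec y b); [apply G1; lra|apply G2; lra].
  - assert (Hxb : 0 < Rabs (x - b)) by (apply Rabs_pos_lt; lra).
    exists (Rmin (Rmin d1 d2) (Rabs (x - b))). split; [repeat apply Rmin_pos; assumption|].
    intros y Hy Hyd.
    assert (M1 := Rmin_l d1 d2). assert (M2 := Rmin_r d1 d2).
    assert (M3 := Rmin_l (Rmin d1 d2) (Rabs (x - b))).
    assert (M4 := Rmin_r (Rmin d1 d2) (Rabs (x - b))).
    assert (Hyx := Rabs_def2 (y - x) (Rabs (x - b)) ltac:(lra)).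
    destruct (Rle_lt_dec x b) as [L|L].
    + rewrite Rabs_left in Hyx by lra. apply G1; lra.
    + rewrite Rabs_right in Hyx by lra. apply G2; lra.
Qed.

Section Evolution.
Context (W : R -> R) (Sl : R -> Prop) (T : R) (um0 : R -> R) (um : R -> R -> R)
  (K : nat) (tau : nat -> R) (st : nat -> stage)
  (HE : crystalline_evolution W Sl T um0 um K tau st).

Lemma stage_order : forall k, (k < K)%nat -> tau k < tau (k + 1)%nat.
Proof. apply (ce_stages _ _ _ _ _ _ _ _ HE). Qed.

Lemma stage_times k : (k <= K)%nat -> 0 <= tau k <= T.
Proof.
  intros Hk. destruct (ce_stages _ _ _ _ _ _ _ _ HE) as (_ & T0 & TK & _).
  rewrite <- T0 at 1. rewrite <- TK.
  split; apply (tau_monotone tau K); try lia; apply stage_order.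
Qed.

Lemma stage_linear k t : (k < K)%nat -> tau k <= t <= tau (k + 1)%nat ->
  linear_on_faces (fun y => um y t) (nfaces (st k)) (slope (st k)) (corners_at (st k) t).
Proof.
  intros Hk [H1 [H2|H2]].
  - apply (ce_admissible _ _ _ _ _ _ _ _ HE k t Hk). lra.
  - rewrite H2. apply (ce_stage_end _ _ _ _ _ _ _ _ HE k Hk).
Qed.

(** The corners of stage [k], constant in time outside the stage. *)
Definition stage_corner (k i : nat) (t : R) : R :=
  corner (st k) i (clamp (tau k) (tau (k + 1)%nat) t).

Lemma stage_corner_eq k t : tau k <= t <= tau (k + 1)%nat ->
  (fun i => stage_corner k i t) = corners_at (st k) t.
Proof. intros H. unfold stage_corner. rewrite clamp_id by exact H. reflexivity. Qed.

Lemma stage_motion k : (k < K)%nat ->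
  motion W (nfaces (st k)) (slope (st k)) (stage_corner k) (tau k) (tau (k + 1)%nat).
Proof.
  intros Hk. assert (Ho := stage_order k Hk).
  assert (Hcl : forall t, tau k <= clamp (tau k) (tau (k + 1)%nat) t <= tau (k + 1)%nat).
  { intros t. apply clamp_in. lra. }
  constructor.
  - exact Ho.
  - intros i t Hi. apply continuous_on_clamp; [lra|].
    apply (ce_corners_cont _ _ _ _ _ _ _ _ HE); assumption.
  - intros t. apply (stage_linear k _ Hk (Hcl t)).
  - intros t. apply (stage_linear k _ Hk (Hcl t)).
  - intros t i Ht Hi. rewrite stage_corner_eq by lra.
    apply (ce_admissible _ _ _ _ _ _ _ _ HE k t Hk Ht). exact Hi.
  - intros i Hi. rewrite stage_corner_eq by lra.
    destruct (stage_linear k (tau (k + 1)%nat) Hk ltac:(lra)) as (_ & _ & H).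
    destruct (H i Hi) as [Hx _]. unfold len. lra.
  - intros t i Ht Hi. rewrite stage_corner_eq by lra.
    apply (is_derive_ext_loc (corner (st k) i)).
    + destruct (proj1 (locally_Rabs _ t) (locally_between _ _ t Ht)) as (d & Hd & Hl).
      apply locally_Rabs. exists d. split; [exact Hd|]. intros s Hs.
      specialize (Hl s Hs). unfold stage_corner. rewrite clamp_id by lra. reflexivity.
    + apply (ce_corner_velocity _ _ _ _ _ _ _ _ HE k t i Hk Ht Hi).
Qed.

(** Adjacency and closeness of consecutive slopes persist. *)
Lemma slopes_stay_good m P w0 w1 L : Cn 3 W -> energy_bounds W P w0 w1 L ->
  good_slopes Sl m P (nfaces (st 0%nat)) (slope (st 0%nat)) ->
  forall k, (k < K)%nat -> good_slopes Sl m P (nfaces (st k)) (slope (st k)).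
Proof.
  intros HW HB H0. induction k as [|k IH]; intros Hk; [exact H0|].
  specialize (IH ltac:(lia)).
  assert (HM := stage_motion k ltac:(lia)).
  assert (Ho := stage_order k ltac:(lia)).
  assert (HU := ce_update _ _ _ _ _ _ _ _ HE k ltac:(lia)).
  rewrite Nat.add_1_r in HU. unfold faces_at in HU.
  eapply linked_update; [|exact IH| |exact HU].
  - intros a b [(Sa & Sb & Hab & Hadj) Hd]. split.
    + repeat split; auto. intros s Hs. rewrite Rmin_comm, Rmax_comm. apply Hadj, Hs.
    + rewrite Rabs_minus_sym. exact Hd.
  - intros i j l Hj Hl Lj Ll Li.
    apply (vanishing_face_flat W _ (slope (st k)) (stage_corner k) (tau k) (tau (k + 1)%nat)
      i j l HM); auto.
    + apply (good_slopes_convex_law W Sl m P w0 w1 L); assumption.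
    + intros n Hn. apply (good_slopes_distinct Sl m P (nfaces (st k))); assumption.
    + rewrite stage_corner_eq by lra. rewrite Nat.add_1_r. exact Lj.
    + rewrite stage_corner_eq by lra. rewrite Nat.add_1_r. exact Ll.
    + rewrite stage_corner_eq by lra. rewrite Nat.add_1_r. exact Li.
Qed.

Lemma time_in_stage t : 0 <= t <= T -> exists k, (k < K)%nat /\ tau k <= t <= tau (k + 1)%nat.
Proof.
  intros [H1 H2]. destruct (ce_stages _ _ _ _ _ _ _ _ HE) as (HK & T0 & TK & _).
  destruct H2 as [H2|H2].
  - destruct (stage_of_time tau K t) as (k & Hk & Hkt); [lra|].
    exists k. split; [exact Hk|lra].
  - exists (K - 1)%nat. split; [lia|].
    replace (K - 1 + 1)%nat with K by lia. rewrite TK, H2. split; [|lra].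
    apply stage_times. lia.
Qed.

(** Away from disappearances the current stage describes the evolution on a
    neighbourhood, relative to the whole time interval. *)
Lemma regular_time t : 0 <= t <= T -> ~ disappearance_time K tau st t ->
  exists k d, (k < K)%nat /\ tau k <= t <= tau (k + 1)%nat /\ 0 < d /\
    (forall i, is_face (nfaces (st k)) i -> 0 < len (corners_at (st k) t) i) /\
    forall s, 0 <= s <= T -> Rabs (s - t) < d ->
      tau k <= s <= tau (k + 1)%nat /\ (k = (K - 1)%nat \/ s < tau (k + 1)%nat).
Proof.
  intros Ht Hreg. destruct (ce_stages _ _ _ _ _ _ _ _ HE) as (HK & T0 & TK & _).
  assert (Hleft : forall k, (k < K)%nat -> tau k <= t ->
    exists d, 0 < d /\ forall s, 0 <= s <= T -> Rabs (s - t) < d -> tau k <= s).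
  { intros k Hk [Hlt|Heq].
    - exists (t - tau k). split; [lra|]. intros s _ Hs. apply Rabs_def2 in Hs. lra.
    - destruct k as [|k].
      + exists 1. split; [lra|]. intros. lra.
      + exfalso. apply Hreg.
        destruct (ce_vanish _ _ _ _ _ _ _ _ HE k) as (i & Hi & Hz); [lia|].
        exists k, i. rewrite Nat.add_1_r in *. rewrite <- Heq. repeat split; auto; try lia. apply Hi. apply Hi. }
  destruct (proj2 Ht) as [HtT|HtT].
  - destruct (stage_of_time tau K t) as (k & Hk & Hkt); [lra|].
    destruct (Hleft k Hk ltac:(lra)) as (d & Hd & Hs).
    exists k, (Rmin d (tau (k + 1)%nat - t)).
    split; [exact Hk|]. split; [lra|]. split; [apply Rmin_pos; lra|]. split.
    + intros i Hi. apply (ce_admissible _ _ _ _ _ _ _ _ HE k t Hk Hkt). exact Hi.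
    + intros s Hs1 Hs2. assert (M1 := Rmin_l d (tau (k + 1)%nat - t)).
      assert (M2 := Rmin_r d (tau (k + 1)%nat - t)).
      specialize (Hs s Hs1 ltac:(lra)). apply Rabs_def2 in Hs2. split; [lra|right; lra].
  - assert (Hk : (K - 1 < K)%nat) by lia.
    assert (EK : tau (K - 1 + 1)%nat = t).
    { replace (K - 1 + 1)%nat with K by lia. rewrite TK, HtT. reflexivity. }
    assert (Ho := stage_order (K - 1) Hk). rewrite EK in Ho.
    destruct (Hleft (K - 1)%nat Hk ltac:(lra)) as (d & Hd & Hs).
    exists (K - 1)%nat, d. rewrite EK.
    split; [exact Hk|]. split; [lra|]. split; [exact Hd|]. split.
    + intros i Hi. destruct (stage_linear (K - 1) t Hk ltac:(lra)) as (_ & _ & H).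
      destruct (H i Hi) as [Hx _].
      destruct (Rle_lt_or_eq_dec _ _ Hx) as [L|E]; [unfold len; lra|].
      exfalso. apply Hreg. exists (K - 1)%nat, i. rewrite EK. repeat split; auto; try apply Hi.
      unfold length_at, len. lra.
    + intros s Hs1 Hs2. split; [split; [apply Hs; assumption|lra]|left; reflexivity].
Qed.

End Evolution.

(** * The initial datum *)

Lemma initial_closeness f (u0 g G : R -> R) N p x m :
  linear_on_faces f N p x ->
  (forall y, 0 <= y <= 1 -> u0 y = G y) ->
  (forall y, continuous g y) -> (forall y, 0 < y < 1 -> is_derive G y (g y)) ->
  Rbar_le (Linf_norm (fun y => Derive f y - Derive u0 y)) (Finite m) ->
  forall i y, is_face N i -> x (i - 1)%nat < y < x i -> Rabs (g y - p i) <= m.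
Proof.
  intros Hf Hu0 Cg Dg Hn i y Hi Hy.
  destruct (faces_range f N p x i Hf Hi) as [R0 R1].
  rewrite Rabs_minus_sym.
  apply (Linf_norm_pointwise (fun y => Derive f y - Derive u0 y) (fun y => p i - g y)
    (x (i - 1)%nat) (x i) m); auto.
  - intros z Hz. f_equal.
    + apply is_derive_unique, (face_derive f N p x); assumption.
    + apply is_derive_unique. apply (is_derive_ext_loc G); [|apply Dg; lra].
      destruct (proj1 (locally_Rabs _ z) (locally_between 0 1 z ltac:(lra))) as (d & Hd & Hl).
      apply locally_Rabs. exists d. split; [exact Hd|]. intros w Hw.
      specialize (Hl w Hw). symmetry. apply Hu0. lra.
  - intros z. apply continuous_Rminus; [apply continuous_const|apply Cg].
Qed.

Lemma slope_distance_le_sq (g : R -> R) N p x m :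
  x 0%nat = 0 -> x N = 1 -> (forall i, is_face N i -> x (i - 1)%nat <= x i) ->
  (forall y, continuous g y) -> 0 <= m ->
  (forall i y, is_face N i -> x (i - 1)%nat < y < x i -> Rabs (g y - p i) <= m) ->
  slope_distance g N p x <= / 2 * m ^ 2.
Proof.
  intros X0 X1 Hx Cg Hm Hc. unfold slope_distance. apply Rmult_le_compat_l; [lra|].
  apply Rle_trans with (sum1 (fun i => m ^ 2 * (x i - x (i - 1)%nat)) N).
  - apply sum1_le. intros i Hi. specialize (Hx i Hi).
    apply Rle_trans with (RInt (fun _ => m ^ 2) (x (i - 1)%nat) (x i)).
    + apply RInt_le; [exact Hx| |apply ex_RInt_const|].
      * apply ex_RInt_cont. intros y. apply sq_diff_continuous, Cg.
      * intros y Hy. rewrite <- (pow2_abs (g y - p i)). apply pow_incr.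
        split; [apply Rabs_pos|apply Hc; assumption].
    + rewrite RInt_const. unfold scal; simpl; unfold mult; simpl. lra.
  - rewrite sum1_scal, sum1_telescope, X0, X1. lra.
Qed.

(** The bound on the initial slopes: each one is within [m] of a value of [g]. *)
Lemma initial_good_slopes Sl f (g : R -> R) N p x m M :
  compatible Sl f N p x -> 0 < m <= 1 ->
  (forall y, 0 <= y <= 1 -> Rabs (g y) <= M) ->
  (forall i y, is_face N i -> x (i - 1)%nat < y < x i -> Rabs (g y - p i) <= m) ->
  (forall i, (2 <= i <= N)%nat -> Rabs (p i - p (i - 1)%nat) <= m) ->
  good_slopes Sl m (M + 1) N p.
Proof.
  intros [[Hf Hpos] (_ & _ & Hadj)] Hm Hg Hc Hd. split.
  - intros i Hi. specialize (Hadj (S i) ltac:(lia)). specialize (Hd (S i) ltac:(lia)).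
    replace (S i - 1)%nat with i in * by lia. split; [exact Hadj|].
    rewrite Rabs_minus_sym. exact Hd.
  - intros i Hi. destruct (Hpos i Hi) as [_ Hl]. unfold len in Hl.
    destruct (faces_range f N p x i Hf Hi) as [R0 R1].
    set (y := (x (i - 1)%nat + x i) / 2).
    assert (Hy : x (i - 1)%nat < y < x i) by (unfold y; lra).
    specialize (Hg y ltac:(lra)). specialize (Hc i y Hi Hy).
    replace (p i) with (g y + - (g y - p i)) by ring.
    eapply Rle_trans; [apply Rabs_triang|]. rewrite Rabs_Ropp. lra.
Qed.

Theorem mainTheorem1 :
  forall (W : R -> R) (T : R) (u0 : R -> R) (u ux ut uxx : R -> R -> R),
    Cn 3 W -> strictly_convex W -> (forall p, 0 < Derive_n W 2 p) ->
    0 < T ->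
    Cn_rect T 3 u ->
    partial_x T u ux -> partial_t T u ut -> partial_x T ux uxx ->
    (forall x t, Icc 0 1 x -> Icc 0 T t ->
       ut x t / sqrt (1 + ux x t ^ 2) = Derive_n W 2 (ux x t) * uxx x t) ->
    (forall x, Icc 0 1 x -> u x 0 = u0 x) ->
    (forall t, Icc 0 T t -> u 0 t = 0 /\ u 1 t = 0) ->
    exists (m0 : R) (Lambda Gamma : R -> R) (C : R),
      0 < m0 /\
      (forall t, Icc 0 T t -> 0 <= Lambda t /\ 0 <= Gamma t) /\
      forall (m : R) (Sl : R -> Prop) (um0 : R -> R) (um : R -> R -> R)
             (K : nat) (tau : nat -> R) (st : nat -> stage),
        0 < m <= m0 ->
        locally_finite Sl ->
        compatible Sl um0
          (nfaces (st 0%nat)) (slope (st 0%nat)) (corners_at (st 0%nat) 0) ->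
        crystalline_evolution W Sl T um0 um K tau st ->
        Rbar_le (Linf_norm (fun x => Derive um0 x - Derive u0 x)) (Finite m) ->
        (forall i, (2 <= i <= nfaces (st 0%nat))%nat ->
           Rabs (slope (st 0%nat) i - slope (st 0%nat) (i - 1)%nat) <= m) ->
        continuous_on (Icc 0 T) (Upsilon ux um) /\
        (exists dUpsilon : R -> R,
           forall t, Icc 0 T t -> ~ disappearance_time K tau st t ->
             D_in (Upsilon ux um) dUpsilon (Icc 0 T) t /\
             continue_in dUpsilon (Icc 0 T) t /\
             dUpsilon t <= Lambda t * Upsilon ux um t + Gamma t * m) /\
        (forall t, Icc 0 T t ->
           H1_norm (fun x => u x t - um x t) <= C * sqrt m).
Proof.
  intros W T u0 u ux ut uxx HW _ HW2 HT Hu Hux Hut Huxx Hpde Hu0 Hbc.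
  destruct (solution_extension W T u ux ut uxx HT Hu Hux Hut Huxx Hpde Hbc)
    as (U & Ux & Ut & Uxx & Uxt & Utx & HS & EU).
  assert (CU := so_u HS). assert (CUx := so_ux HS).
  destruct (cont2_bounded Ux T ltac:(lra) CUx) as (M1 & P1 & B1).
  destruct (cont2_bounded Uxx T ltac:(lra) (so_uxx HS)) as (M2 & P2 & B2).
  destruct (cont2_bounded Utx T ltac:(lra) (so_utx HS)) as (M3 & P3 & B3).
  set (M := M1 + M2 + M3).
  destruct (energy_bounds_exist W (M + 1) ltac:(unfold M; lra) HW HW2) as (w0 & w1 & L & HEB).
  assert (HB : uniform_bounds W T Ux Ut Uxx Utx M w0 w1 L).
  { constructor; [unfold M; lra| | | |exact HEB]; intros x t Hx Ht.
    - specialize (B1 x t Hx Ht). unfold M. lra.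
    - specialize (B2 x t Hx Ht). unfold M. lra.
    - specialize (B3 x t Hx Ht). unfold M. lra. }
  set (G := growth_const M w0 w1 L).
  assert (HG : 0 <= G).
  { assert (H := eb_pos HEB). unfold G, growth_const.
    apply Rdiv_le_0_compat; [|lra]. apply Rmult_le_pos; apply pow2_ge_0. }
  assert (HM : 0 < M) by (unfold M; lra).
  exists 1, (fun _ => 2 * G), (fun _ => G + M),
    (2 * sqrt (exp (2 * G * T) * (1 + (G + M) * T))).
  split; [lra|]. split; [intros; lra|].
  intros m Sl um0 um K tau st Hm _ Hcomp HE Hinf Hgap.
  destruct (ce_stages _ _ _ _ _ _ _ _ HE) as (HK & T0 & TK & _).
  set (N := fun k => nfaces (st k)). set (p := fun k => slope (st k)).
  set (X := stage_corner tau st).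
  assert (Hc0 : forall i y, is_face (N 0%nat) i ->
    corners_at (st 0%nat) 0 (i - 1)%nat < y < corners_at (st 0%nat) 0 i ->
    Rabs (Ux y 0 - p 0%nat i) <= m).
  { apply (initial_closeness um0 u0 (fun y => Ux y 0) (fun y => U y 0)).
    - apply Hcomp.
    - intros y Hy. rewrite <- Hu0 by exact Hy. symmetry. apply EU; unfold Icc; lra.
    - intros y. apply cont2_fst, CUx.
    - intros y Hy. apply (so_du_dx HS); lra.
    - exact Hinf. }
  assert (Hgood : forall k, (k < K)%nat -> good_slopes Sl m (M + 1) (N k) (p k)).
  { apply (slopes_stay_good W Sl T um0 um K tau st HE m (M + 1) w0 w1 L HW HEB).
    apply (initial_good_slopes Sl um0 (fun y => Ux y 0) (N 0%nat) (p 0%nat)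
      (corners_at (st 0%nat) 0) m M); auto.
    intros y Hy. apply (ub_ux HB); lra. }
  assert (HMot : forall k, (k < K)%nat ->
    motion W (N k) (p k) (X k) (tau k) (tau (k + 1)%nat)).
  { intros k Hk. apply (stage_motion W Sl T um0 um K tau st HE k Hk). }
  assert (Htau : forall k, (k < K)%nat -> 0 <= tau k /\ tau (k + 1)%nat <= T).
  { intros k Hk. split; apply (stage_times W Sl T um0 um K tau st HE); lia. }
  assert (Hdist : forall k, (k < K)%nat -> (forall i, (1 <= i < N k)%nat -> p k i <> p k (i + 1)%nat)).
  { intros k Hk i Hi. apply (good_slopes_distinct Sl m (M + 1) (N k)); auto. }
  set (Phi := fun k => stage_distance U Ux (N k) (p k) (X k)).
  set (Psi := fun k => stage_rate W Ux Ut Uxx (N k) (p k) (X k)).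
  assert (EUps : forall k t, (k < K)%nat -> tau k <= t <= tau (k + 1)%nat ->
    Upsilon ux um t = slope_distance (fun y => Ux y t) (N k) (p k) (fun i => X k i t)).
  { intros k t Hk Ht. unfold X. rewrite stage_corner_eq by exact Ht.
    assert (HtT : 0 <= t <= T) by (specialize (Htau k Hk); lra).
    unfold Upsilon.
    assert (Hlin := stage_linear W Sl T um0 um K tau st HE k t Hk Ht).
    assert (H := slope_distance_is_RInt _ _ _ _ (fun y => Ux y t) (fun y => ux y t) Hlin
      (fun y => cont2_fst Ux t y CUx)
      (fun y Hy => eq_sym (proj2 (EU y t Hy HtT)))).
    rewrite (is_RInt_unique _ _ _ _ H). unfold N, p. field. }
  assert (EPhi : forall k t, (k < K)%nat -> tau k <= t <= tau (k + 1)%nat ->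
    Upsilon ux um t = Phi k t).
  { intros k t Hk Ht. rewrite (EUps k t Hk Ht). symmetry.
    apply (stage_distance_eq W T U Ux Ut Uxx Uxt Utx HS (N k) (p k) (X k)
      (tau k) (tau (k + 1)%nat)); auto. }
  assert (CPhi : forall k t, (k < K)%nat -> continuous (Phi k) t).
  { intros k t Hk. apply (stage_distance_continuous W T U Ux Ut Uxx Uxt Utx HS (N k) (p k) (X k)
      (tau k) (tau (k + 1)%nat)); auto. }
  assert (Hrate : forall k t, (k < K)%nat -> tau k <= t <= tau (k + 1)%nat ->
    (forall i, is_face (N k) i -> 0 < len (fun j => X k j t) i) ->
    Psi k t <= 2 * G * Upsilon ux um t + (G + M) * m).
  { intros k t Hk Ht Hlen. rewrite (EUps k t Hk Ht).
    specialize (Htau k Hk).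
    apply (distance_rate_bound W T U Ux Ut Uxx Uxt Utx HS M w0 w1 L HB HW Sl m); auto.
    - lra.
    - apply (mo_left (HMot k Hk)).
    - apply (mo_right (HMot k Hk)). }
  split; [|split].
  - assert (Hn : forall n, (n <= K)%nat -> continuous_on (Icc 0 (tau n)) (Upsilon ux um)).
    { induction n as [|n IH]; intros Hn.
      - rewrite T0. apply continuous_on_eps. intros x Hx e He. exists 1. split; [lra|].
        intros y Hy _. unfold Icc in *. replace y with x by lra.
        rewrite Rminus_diag, Rabs_R0. exact He.
      - assert (Hnk : (n < K)%nat) by lia.
        assert (Ho := mo_time (HMot n Hnk)).
        rewrite <- Nat.add_1_r. apply continuous_on_glue with (tau n).
        + specialize (Htau n Hnk). lra.
        + apply IH. lia.
        + apply continuous_on_eps. intros x Hx e He.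
          destruct (proj1 (continuous_eps (Phi n) x) (CPhi n x Hnk) e He) as (d & Hd & Hy).
          exists d. split; [exact Hd|]. intros y Hyn Hyd.
          rewrite !(EPhi n) by assumption. apply Hy, Hyd. }
    rewrite <- TK. apply Hn. lia.
  - exists (piecewise Psi tau (K - 1)). intros t Ht Hreg.
    destruct (regular_time W Sl T um0 um K tau st HE t Ht Hreg)
      as (k & d & Hk & Hkt & Hd & Hlen & Hnear).
    assert (Hlen' : forall i, is_face (N k) i -> 0 < len (fun j => X k j t) i).
    { intros i Hi. unfold X. rewrite stage_corner_eq by exact Hkt. apply Hlen, Hi. }
    assert (EPsi : forall s, 0 <= s <= T -> Rabs (s - t) < d ->
      piecewise Psi tau (K - 1) s = Psi k s).
    { intros s Hs Hsd. destruct (Hnear s Hs Hsd) as [H1 H2].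
      apply (piecewise_eq Psi tau K); [|lia|apply H1|exact H2].
      apply (stage_order W Sl T um0 um K tau st HE). }
    assert (Htt : Rabs (t - t) < d) by (rewrite Rminus_diag, Rabs_R0; exact Hd).
    rewrite (EPsi t Ht Htt). split; [|split].
    + assert (HD := stage_distance_D_in W T U Ux Ut Uxx Uxt Utx HS (N k) (p k) (X k)
        (tau k) (tau (k + 1)%nat) (HMot k Hk) (Htau k Hk) (Hdist k Hk) t Hkt Hlen').
      intros e He. destruct (HD e He) as (d1 & Hd1 & H). simpl in H. unfold D_x, Rdist in H.
      exists (Rmin d d1). split; [apply Rmin_pos; assumption|].
      simpl. unfold D_x, Rdist. intros s [[Hs Hst] Hsd].
      assert (R1 := Rmin_l d d1). assert (R2 := Rmin_r d d1).
      destruct (Hnear s Hs ltac:(lra)) as [Hks _].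
      rewrite (EPhi k s Hk Hks), (EPhi k t Hk Hkt), (EPsi t Ht Htt).
      apply H. split; [split; [exact Hks|exact Hst]|lra].
    + assert (HC := stage_rate_continuous W T U Ux Ut Uxx Uxt Utx HS (N k) (p k) (X k)
        (tau k) (tau (k + 1)%nat) (HMot k Hk) t Hlen').
      intros e He. destruct (proj1 (continuous_eps _ _) HC e He) as (d1 & Hd1 & H).
      exists (Rmin d d1). split; [apply Rmin_pos; assumption|].
      simpl. unfold D_x, Rdist. intros s [[Hs Hst] Hsd].
      assert (R1 := Rmin_l d d1). assert (R2 := Rmin_r d d1).
      rewrite (EPsi s Hs) by lra. rewrite (EPsi t Ht Htt). apply H. lra.
    + apply Hrate; assumption.
  - (* [z] below decreases from its initial value along each stage in turn *)
    intros t Ht.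
    set (Lam := 2 * G). set (Gam := (G + M) * m).
    set (z := fun s => exp (- Lam * s) * Upsilon ux um s - Gam * s).
    assert (HGam : 0 <= Gam) by (unfold Gam; nra).
    assert (Hstage : forall k s, (k < K)%nat -> tau k <= s <= tau (k + 1)%nat ->
      z s <= z (tau k)).
    { intros k s Hk Hs. unfold z.
      assert (Ho := mo_time (HMot k Hk)).
      rewrite (EPhi k s Hk Hs), (EPhi k (tau k) Hk ltac:(lra)).
      apply (stage_gronwall W T U Ux Ut Uxx Uxt Utx HS (N k) (p k) (X k)
        (tau k) (tau (k + 1)%nat) (HMot k Hk) (Htau k Hk) (Hdist k Hk) Lam Gam); auto.
      - unfold Lam. lra.
      - intros r Hr. fold (Phi k). fold (Phi k r). rewrite <- (EPhi k r Hk ltac:(lra)).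
        apply (Hrate k r Hk ltac:(lra)).
        intros i Hi. apply (mo_pos (HMot k Hk)); [lra|exact Hi]. }
    assert (Hz0 : forall k, (k < K)%nat -> z (tau k) <= z 0).
    { induction k as [|k IH]; intros Hk.
      - rewrite T0. lra.
      - specialize (IH ltac:(lia)). assert (Hk' : (k < K)%nat) by lia.
        assert (Ho := mo_time (HMot k Hk')).
        rewrite <- Nat.add_1_r. specialize (Hstage k (tau (k + 1)%nat) Hk' ltac:(lra)). lra. }
    destruct (time_in_stage W Sl T um0 um K tau st HE t Ht) as (k & Hk & Hkt).
    assert (Hz : z t <= z 0).
    { specialize (Hstage k t Hk Hkt). specialize (Hz0 k Hk). lra. }
    assert (Hlin := stage_linear W Sl T um0 um K tau st HE k t Hk Hkt).
    assert (HN0 := H1_norm_bound (fun y => um y t) (fun y => u y t) (fun y => U y t)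
      (fun y => Ux y t) _ _ _ Hlin
      (proj1 (ce_boundary _ _ _ _ _ _ _ _ HE t Ht))
      (proj1 (so_bc HS t Ht))
      (fun y => cont2_fst U t y CU) (fun y => cont2_fst Ux t y CUx)
      (fun y Hy => so_du_dx HS y t Hy Ht)
      (fun y Hy => eq_sym (proj1 (EU y t Hy Ht)))).
    assert (E := EUps k t Hk Hkt). unfold X in E. rewrite stage_corner_eq in E by exact Hkt.
    unfold N, p in E. rewrite <- E in HN0. destruct HN0 as [HU0 HN0].
    eapply Rle_trans; [exact HN0|].
    assert (HUi : Upsilon ux um 0 <= / 2 * m ^ 2).
    { assert (H0K : (0 < K)%nat) by lia.
      assert (Ho := mo_time (HMot 0%nat H0K)). rewrite T0 in Ho.
      assert (H01 : tau 0%nat <= 0 <= tau (0 + 1)%nat) by (rewrite T0; lra).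
      rewrite (EUps 0%nat 0 H0K H01). unfold X. rewrite stage_corner_eq by exact H01.
      destruct Hcomp as [[Hl _] _]. destruct Hl as (A0 & A1 & A2).
      apply slope_distance_le_sq; auto.
      - intros i Hi. apply (A2 i Hi).
      - intros y. apply cont2_fst, CUx.
      - lra. }
    assert (HUt : Upsilon ux um t <= exp (2 * G * T) * (1 + (G + M) * T) * m).
    { unfold z in Hz. rewrite !Rmult_0_r, exp_0, Rminus_0_r, Rmult_1_l in Hz.
      assert (HmT : 0 <= (G + M) * T) by (apply Rmult_le_pos; lra).
      assert (H1 : exp (- Lam * t) * Upsilon ux um t <= (1 + (G + M) * T) * m).
      { assert (Gam * t <= (G + M) * T * m).
        { unfold Gam. rewrite Rmult_assoc, (Rmult_assoc (G + M)).
          apply Rmult_le_compat_l; [lra|]. unfold Icc in Ht. nra. }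
        nra. }
      assert (H2 : exp (Lam * t) * exp (- Lam * t) = 1).
      { rewrite <- exp_plus. replace (Lam * t + - Lam * t) with 0 by ring. apply exp_0. }
      assert (H3 : exp (Lam * t) <= exp (2 * G * T)).
      { unfold Lam. unfold Icc in Ht. destruct (Req_dec (2 * G * t) (2 * G * T)) as [->|Hne]; [lra|].
        apply Rlt_le, exp_increasing. assert (2 * G * t <= 2 * G * T) by nra. lra. }
      assert (H4 := exp_pos (Lam * t)).
      replace (Upsilon ux um t) with (exp (Lam * t) * (exp (- Lam * t) * Upsilon ux um t))
        by (rewrite <- Rmult_assoc, H2; ring).
      rewrite Rmult_assoc. apply Rle_trans with (exp (Lam * t) * ((1 + (G + M) * T) * m)).
      - apply Rmult_le_compat_l; lra.
      - apply Rmult_le_compat_r; [nra|exact H3]. }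
    rewrite (Rmult_assoc 2). apply Rmult_le_compat_l; [lra|].
    rewrite <- sqrt_mult_alt.
    + apply sqrt_le_1_alt, HUt.
    + apply Rmult_le_pos; [apply Rlt_le, exp_pos|].
      assert (0 <= (G + M) * T) by (apply Rmult_le_pos; lra). lra.
Qed.
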